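(* Let $1\le d\le N$ be integers, $t>0$, and $z=e^{-t/2}$. The microchiral partition function $Z_N^d$ of two-dimensional Yang--Mills theory with gauge group $\mathrm{U}_N$ on a three-holed sphere of area $t$ admits the absolutely convergent series expansion $$Z_N^d=\frac{(zN^{-1})^d}{d!}\sum_{\alpha,\beta,\gamma\in\mathsf{Y}^d}P_{\alpha\beta\gamma}\sum_{r,s=0}^\infty\frac{(-t)^r(-1)^s}{r!\,N^{r+s}}\langle K_{\alpha\beta\gamma}K^rM_s\rangle,$$ where $\langle K_{\alpha\beta\gamma}K^rM_s\rangle$ is a mixed triple Hurwitz number, i.e. the number of tuples $(\pi,\rho,\sigma,\tau_1,\dots,\tau_r,\mu_1,\dots,\mu_s)$ of permutations in $\mathrm{S}^d$ such that $\pi\rho\sigma\tau_1\cdots\tau_r\mu_1\cdots\mu_s$ is the identity, $\pi\in K_\alpha$, $\rho\in K_\beta$, $\sigma\in K_\gamma$, the $\tau_k$ are transpositions, and $\mu_k=(i_k\ j_k)$ are transpositions with $i_k<j_k$ and $j_1\le\dots\le j_s$.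
   Context: $\mathsf{Y}^d$ is the set of Young diagrams with exactly $d$ cells and $\mathsf{Y}^d_N$ the subset of those with at most $N$ rows. For $\lambda\in\mathsf{Y}^d_N$, $\mathbf{W}_N^\lambda$ is the irreducible representation of the unitary group $\mathrm{U}_N$ with highest weight $\lambda$, $s_\lambda$ is its character, and $\hat C(\lambda)=\sum_{i=1}^N\lambda_i(\lambda_i+N+1-2i)$ is the corresponding eigenvalue of the quadratic Casimir. The microchiral partition function of the three-holed sphere (three holes, no handles) is the function on $\mathrm{U}_N^3$ defined by $$Z_N^d(U_1,U_2,U_3)=\sum_{\lambda\in\mathsf{Y}^d_N}\frac{s_\lambda(U_1)s_\lambda(U_2)s_\lambda(U_3)}{\dim\mathbf{W}_N^\lambda}e^{-\frac{t}{2N}\hat C(\lambda)}.$$ $p_\alpha(U)=\prod_{i=1}^{\ell(\alpha)}\mathrm{Tr}\,U^{\alpha_i}$ (with $\ell(\alpha)$ the number of rows of $\alpha$) and $P_{\alpha\beta\gamma}(U_1,U_2,U_3)=p_\alpha(U_1)p_\beta(U_2)p_\gamma(U_3)$. $K_\alpha$ is the conjugacy class of permutations of cycle type $\alpha$ in the symmetric group $\mathrm{S}^d$ and also the corresponding class sum in $\mathbb{C}\mathrm{S}^d$; $K$ is the sum of all transpositions; $K_{\alpha\beta\gamma}=K_\alpha K_\beta K_\gamma$. $M_s=h_s(J_1,\dots,J_d)$ is the complete homogeneous symmetric polynomial of degree $s$ in the (commuting) Jucys--Murphy elements $J_1=0$, $J_j=\sum_{i<j}(i\ j)$ of $\mathbb{C}\mathrm{S}^d$.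 For $A\in\mathbb{C}\mathrm{S}^d$, $\langle A\rangle$ denotes the coefficient of the identity permutation in $A$. *)

(* Defs.v *)
From HB Require Import structures.
From mathcomp Require Import all_boot all_order all_algebra all_fingroup.
From mathcomp Require Import spectral mxrepresentation complex.
From mathcomp Require Import boolp classical_sets functions reals ereal.
From mathcomp Require Import topology normedtype sequences esum exp.

Set Implicit Arguments.
Unset Strict Implicit.
Unset Printing Implicit Defensive.

Import Order.TTheory GRing.Theory Num.Theory.
Import numFieldNormedType.Exports.

Local Open Scope ring_scope.
Local Open Scope complex_scope.
Local Open Scope classical_set_scope.

(* The list of row lengths, weakly decreasing, padded with zeros to length d:
   a diagram with d cells has at most d rows. *)
Definition young (d : nat) :=
  {a : d.-tuple 'I_d.+1 |
    sorted geq (map val a) && (sumn (map val a) == d)}.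

Section Young.
Variable d : nat.
Implicit Type lam : young d.

Definition rows lam : seq nat := [seq x <- map val (val lam) | (0 < x)%N].

(* Row i, counted from 0. *)
Definition rowlen lam (i : nat) : nat := nth 0%N (rows lam) i.

Definition youngN (N : nat) : {set young d} :=
  [set lam | (size (rows lam) <= N)%N]%SET.

(* With rows numbered from 0, N + 1 - 2 i becomes N - 1 - 2 i. *)
Definition casimir (R : realType) (N : nat) lam : R :=
  \sum_(i < N)
    (rowlen lam i)%:R * ((rowlen lam i)%:R + N%:R - 1 - i.*2%:R).

End Young.

(* R[i]^o is R[i] with the topology of its norm. *)

Section UnitaryRepresentations.
Variables (R : realType) (N : nat).
Local Notation C := R[i].

Record unitary_rep := UnitaryRep {
  rep_dim : nat;
  rep_mx :> 'M[C]_N -> 'M[C]_rep_dim;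
  rep_mx1 : rep_mx 1%:M = 1%:M;
  rep_mxM : forall U V : 'M[C]_N, U \is unitarymx -> V \is unitarymx ->
    rep_mx (U *m V) = rep_mx U *m rep_mx V;
  rep_continuous :
    {within [set U : 'M[C^o]_N | U \is unitarymx],
      continuous (rep_mx : 'M[C^o]_N -> 'M[C^o]_rep_dim)} }.

Implicit Type W : unitary_rep.

Definition irreducible_rep W : Prop :=
  (0 < rep_dim W)%N /\
  forall V : {vspace 'cV[C]_(rep_dim W)},
    (forall (U : 'M[C]_N) (v : 'cV[C]_(rep_dim W)),
       U \is unitarymx -> v \in V -> W U *m v \in V) ->
    V = 0%VS \/ V = fullv.

(* mu is a weight for the maximal torus of diagonal unitary matrices. *)
Definition is_weight W (mu : 'I_N -> int) : Prop :=
  exists2 v : 'cV[C]_(rep_dim W), v != 0 &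
    forall u : 'rV[C]_N, (forall i, `|u 0 i| = 1) ->
      W (diag_mx u) *m v = (\prod_i u 0 i ^ mu i) *: v.

(* lam - mu is a sum of positive roots e_i - e_j, i < j. *)
Definition weight_le (mu lam : 'I_N -> int) : Prop :=
  exists c : 'I_N -> 'I_N -> nat, forall k,
    lam k - mu k =
    \sum_(i < N) \sum_(j < N | (i < j)%N) (c i j)%:Z * ((k == i)%:Z - (k == j)%:Z).

Definition highest_weight W (lam : 'I_N -> int) : Prop :=
  is_weight W lam /\ forall mu, is_weight W mu -> weight_le mu lam.

Definition is_irrep d (lam : young d) W : Prop :=
  irreducible_rep W /\ highest_weight W (fun i => (rowlen lam i)%:Z).

Definition rep_char W (U : 'M[C]_N) : C := \tr (W U).

(* To be used with is_irrep lam (W lam) for all lam in youngN d N; by the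
   theorem of the highest weight such a family W exists and the value does not
   depend on it. *)
Definition Zpart d (W : young d -> unitary_rep) (t : R)
    (U1 U2 U3 : 'M[C]_N) : C :=
  \sum_(lam in youngN d N)
    rep_char (W lam) U1 * rep_char (W lam) U2 * rep_char (W lam) U3
      / (rep_dim (W lam))%:R
    * (expR (- (t / (2 * N%:R)) * casimir R N lam))%:C.

Definition powersum d (a : young d) (U : 'M[C]_N) : C :=
  \prod_(k <- rows a) \tr (U ^+ k).

Definition powersum3 d (a b c : young d) (U1 U2 U3 : 'M[C]_N) : C :=
  powersum a U1 * powersum b U2 * powersum c U3.

End UnitaryRepresentations.

Definition cycle_type d (w : 'S_d) : seq nat :=
  sort geq [seq #|X| | X : {set 'I_d} <- enum (porbits w)].

Definition cycle_class d (a : young d) : {set 'S_d} :=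
  [set w | cycle_type w == rows a]%SET.

Definition transpositions d : {set 'S_d} :=
  [set tperm ij.1 ij.2 | ij : 'I_d * 'I_d & (ij.1 < ij.2)%N]%SET.

Section GroupAlgebra.
Variables (R : realType) (d : nat).
Local Notation C := R[i].
Local Notation G := [set: 'S_d]%G.

(* The group algebra C[S_d] is realised, as in mxrepresentation, inside the
   matrices of the regular representation. In 'S_d the product s * t applies s
   first; the reverse convention gives the same values of coef_id below, since
   class_sum, transp_sum and jm_complete are central. *)
Definition perm_elt (w : 'S_d) : 'M[C]_#|G| := regular_repr C G w.

Definition class_sum (a : young d) : 'M[C]_#|G| := gset_mx C G (cycle_class a).

Definition transp_sum : 'M[C]_#|G| := gset_mx C G (transpositions d).

Definition jucys_murphy (j : 'I_d) : 'M[C]_#|G| :=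
  \sum_(i < d | (i < j)%N) perm_elt (tperm i j).

(* h_s is the sum of the monomials x_(j_1) ... x_(j_s), j_1 <= ... <= j_s. *)
Definition jm_complete (s : nat) : 'M[C]_#|G| :=
  \sum_(j : s.-tuple 'I_d | sorted leq (map val j))
    \prod_(k < s) jucys_murphy (tnth j k).

Definition coef_id (A : 'M[C]_#|G|) : C := gring_row A 0 (gring_index G 1%g).

Definition hurwitz (a b c : young d) (r s : nat) : C :=
  coef_id (class_sum a * class_sum b * class_sum c * transp_sum ^+ r
           * jm_complete s).

End GroupAlgebra.

Definition monotone_walk d s (mu : s.-tuple 'S_d) : bool :=
  [exists ij : s.-tuple ('I_d * 'I_d),
    [&& [forall k, ((tnth ij k).1 < (tnth ij k).2)%N],
        [forall k, tnth mu k == tperm (tnth ij k).1 (tnth ij k).2]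
      & sorted leq [seq val x.2 | x <- ij]]].

Definition hurwitz_tuples d (a b c : young d) (r s : nat) :
    {set 'S_d * 'S_d * 'S_d * r.-tuple 'S_d * s.-tuple 'S_d} :=
  [set x | let: (p, q, u, tau, mu) := x in
    [&& (p * q * u * (\prod_(k < r) tnth tau k) * (\prod_(k < s) tnth mu k)
           == 1)%g,
        p \in cycle_class a, q \in cycle_class b, u \in cycle_class c,
        [forall k, tnth tau k \in transpositions d] & monotone_walk mu]]%SET.

Section DoubleSeries.
Variable R : realType.
Local Notation C := R[i].

Definition abs_convergent (f : nat -> nat -> C) : Prop :=
  summable [set: nat * nat] (fun k => (Normc.normc (f k.1 k.2))%:E).

(* For an absolutely convergent series the order of summation is irrelevant;
   square partial sums are used. *)
Definition double_series (f : nat -> nat -> C) : C :=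
  lim ((fun n : nat => \sum_(r < n) \sum_(s < n) f r s : C^o) @ \oo).

End DoubleSeries.

Definition expansion_term (R : realType) (N d : nat) (t : R)
    (a b c : young d) (r s : nat) : R[i] :=
  ((- t) ^+ r * (-1) ^+ s / (r`!%:R * N%:R ^+ (r + s)))%:C
  * hurwitz R a b c r s.

(* Main.v *)
(* Schur-Weyl duality.  Let X be the d-th tensor power of C^N and
   F(U) = sum_s p_s(U) s in C[S_d], where p_s is the power sum of the cycle type
   of s.  By Jucys' factorization F(1) = N^d prod_j (1 + J_j / N), and the series
   sum_s (-N)^-s h_s(J) inverts this product, so that the right-hand side is
   z^d / d! times the coefficient of the identity in
   F(U1) F(U2) F(U3) F(1)^-1 exp(-t K / N).  All factors are central, hence
   scalar on each Wedderburn block of C[S_d], with idempotent e_i of degree n_i: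
   tr (U^(x)d s) = p_s(U) gives F(U) e_i = w e_i with
   w <e_i> = tr (U^(x)d E_i), E_i being the image of e_i in End X, and
   d! <e_i> = n_i^2.

   It remains to match blocks and diagrams.  An irreducible W of highest weight
   lam is diagonalizable on the torus, with weights that are nonnegative of sum
   d, so its character is symmetric and homogeneous in the eigenvalues: by Newton
   it is a linear form in U^(x)d.  Hence W is a representation of the algebra
   spanned by the U^(x)d, which is the commutant of S_d in End X, and a single
   E_i acts on W as the identity; then tr (U^(x)d E_i) = n_i tr W(U).  The block
   determines the weights of W, so lam |-> i is injective; it is onto because the
   functions U |-> tr (U^(x)d E_i) are linearly independent in the span of the
   power sums indexed by diagrams.  The Casimir operator
   sum_ij D(E_ij) D(E_ji) = N d + 2 K evaluated at the highest weight vector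
   gives the scalar of K on the block. *)

Require Import Defs.
From mathcomp Require Import all_boot all_order all_algebra all_fingroup.
From mathcomp Require Import pgroup mxred mxrepresentation.
From mathcomp Require Import separable cyclotomic.
From mathcomp Require Import boolp classical_sets functions cardinality fsbigop.
From mathcomp Require Import ereal topology normedtype esum trigo ring.
From mathcomp Require Import spectral complex reals sequences exp.

Set Implicit Arguments.
Unset Strict Implicit.
Unset Printing Implicit Defensive.

Import Order.TTheory GRing.Theory Num.Theory.
Import numFieldNormedType.Exports.

Local Open Scope ring_scope.

(** * Subspaces and the density theorem *)

(** A [unitary_rep] is only a map continuous on the unitary matrices, so no Lie algebra acts on it.
    Two devices stand in for differentiation. On the tensor power, [tens (1 + (x - 1) Y)] is
    polynomial of degree at most d in x, so its derivative at x = 1 is a fixed combination of its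
    values at d + 1 points of the unit circle; every [dtens X] therefore lies in the span of the
    [tens U] with U unitary. On W, each circle of the torus is controlled first at one element of
    finite order close to 1, then at dyadic angles, then everywhere by continuity. The inequality d
    <= N acts in three places: a word with distinct letters makes C[S_d] act faithfully on X, every
    diagram with d cells has at most N rows, and j < d gives j / N < 1, which makes the series in s
    converge. *)

Lemma mulmx_col (R : pzRingType) m n p (A : 'M[R]_(m, n)) (B : 'M_(n, p)) j :
  col j (A *m B) = A *m col j B.
Proof. by rewrite !colE mulmxA. Qed.

Section Subspaces.
Variable F : fieldType.

Definition is_subspace (V : lmodType F) (Q : V -> Prop) :=
  Q 0 /\ forall a u v, Q u -> Q v -> Q (a *: u + v).

Section Closure.
Variables (V : lmodType F) (Q : V -> Prop).
Hypothesis sQ : is_subspace Q.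

Lemma subspaceZ a u : Q u -> Q (a *: u).
Proof. by move=> Qu; rewrite -[_ *: _]addr0; apply: sQ.2 => //; exact: sQ.1. Qed.

Lemma subspaceD u v : Q u -> Q v -> Q (u + v).
Proof. by move=> Qu Qv; rewrite -[u]scale1r; exact: sQ.2. Qed.

Lemma subspaceB u v : Q u -> Q v -> Q (u - v).
Proof. by move=> Qu Qv; rewrite addrC -scaleN1r; exact: sQ.2. Qed.

Lemma subspace_sum (I : Type) (r : seq I) (P : pred I) (f : I -> V) :
  (forall i, P i -> Q (f i)) -> Q (\sum_(i <- r | P i) f i).
Proof.
move=> Qf; apply: big_ind => //; [exact: sQ.1 | exact: subspaceD].
Qed.

End Closure.

(** A space of maximal dimension among those contained in [Q] is all of [Q], since a further vector
    of [Q] would enlarge it. Predicates given by existential formulas thus become spaces to which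
    irreducibility applies. *)
Lemma subspace_vspace (V : vectType F) (Q : V -> Prop) :
  is_subspace Q -> exists U : {vspace V}, forall v, v \in U <-> Q v.
Proof.
move=> sQ.
pose P k := `[< exists2 U : {vspace V}, (forall v, v \in U -> Q v) & \dim U = k >].
have exP : exists k, P k.
  exists 0%N; apply/asboolP; exists 0%VS; last exact: dimv0.
  by move=> v; rewrite memv0 => /eqP ->; exact: sQ.1.
have ubP k : P k -> (k <= \dim {:V})%N.
  by move=> /asboolP[U _ <-]; apply: dimvS; exact: subvf.
case: (ex_maxnP exP ubP) => k /asboolP[U sUQ dU] maxk.
exists U => v; split=> [/sUQ //|Qv].
have : P (\dim (U + <[v]>)%VS).
  apply/asboolP; exists (U + <[v]>)%VS => // w /memv_addP[u uU [x]].
  case/vlineP => a -> ->; rewrite addrC; apply: sQ.2 => //; exact: sUQ.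
move/maxk; rewrite -dU => le.
have /eqP -> : U == (U + <[v]>)%VS by rewrite eqEdim addvSl le.
by apply: (subvP (addvSr _ _)); exact: memv_line.
Qed.

Lemma subspace_rowmx n (Q : 'rV[F]_n -> Prop) : is_subspace Q ->
  exists k (M : 'M_(k, n)), forall v, (v <= M)%MS <-> Q v.
Proof.
move=> sQ; have [U UQ] := subspace_vspace sQ.
exists (\dim U), (\matrix_i (vbasis U)`_i) => v; rewrite -UQ; split.
  case/submxP => D ->; rewrite mulmx_sum_row memv_suml // => i _.
  by rewrite rowK memvZ // vbasis_mem // mem_nth // size_tuple.
move/coord_vbasis => ->; rewrite summx_sub // => i _; rewrite scalemx_sub //.
by rewrite (eq_row_sub i) // rowK.
Qed.

(** The columns of [cokermx M] annihilate [Q], hence vanish, so the rows of [M] span everything. *)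
Lemma subspace_full n (Q : 'rV[F]_n -> Prop) : is_subspace Q ->
  (forall z : 'cV_n, (forall v, Q v -> v *m z = 0) -> z = 0) -> forall v, Q v.
Proof.
move=> sQ ann; have [k [M MQ]] := subspace_rowmx sQ.
have M0 : cokermx M = 0.
  apply/matrixP => i j; have : col j (cokermx M) = 0.
    apply: ann => v /MQ; rewrite submxE => /eqP vM.
    by rewrite -mulmx_col vM; apply/colP => l; rewrite !mxE.
  by move/colP/(_ i); rewrite !mxE.
by move=> v; apply/MQ; rewrite submxE M0 mulmx0.
Qed.

End Subspaces.

Section Burnside.
Variables (C : numClosedFieldType) (n : nat) (P : 'M[C]_n -> Prop).
Hypotheses (n_gt0 : (0 < n)%N) (sP : is_subspace P) (P1 : P 1%:M).
Hypothesis PM : forall A B, P A -> P B -> P (A *m B).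
Hypothesis irrP : forall V : {vspace 'cV[C]_n},
  (forall A v, P A -> v \in V -> A *m v \in V) -> V = 0%VS \/ V = fullv.

(** The orbit of [v] under [P] is an invariant subspace, and it contains [v]. *)
Let orbit_full (v w : 'cV[C]_n) : v != 0 -> exists2 A, P A & A *m v = w.
Proof.
move=> v0; have sQ : is_subspace (fun w => exists2 A, P A & A *m v = w).
  split; first by exists 0; rewrite ?mul0mx //; exact: sP.1.
  move=> a _ _ [A PA <-] [B PB <-]; exists (a *: A + B); first exact: sP.2.
  by rewrite mulmxDl scalemxAl.
have [U UQ] := subspace_vspace sQ.
case: (irrP (V := U)) => [A x PA /UQ[B PB <-]|U0|Uf].
- by apply/UQ; exists (A *m B); [exact: PM | rewrite mulmxA].
- have : v \in U by apply/UQ; exists 1%:M; rewrite ?mul1mx.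
  by rewrite U0 memv0 (negbTE v0).
- by apply/UQ; rewrite Uf memvf.
Qed.

(** Write [A = K L] with r > 1 the rank. Subtracting an eigenvalue [l] from a non-scalar compression
    [N = L B K] gives [A B A - l A = K (N - l) L], which is nonzero and of smaller rank. *)
Let rank_drop A : P A -> (1 < \rank A)%N ->
  exists2 B, P B & (B != 0) && (\rank B < \rank A)%N.
Proof.
move=> PA; have := mulmx_base A; have := row_base_free A; have := col_base_full A.
move: (col_base A) (row_base A); set r := \rank A => K L fK fL AE r1.
have [K' K'K] := row_fullP fK; have [L' LL'] := row_freeP fL.
have r0 : (0 < r)%N by exact: ltnW.
pose i0 := Ordinal r0; pose i1 := Ordinal r1.
have Ki0 : col i0 K != 0.
  apply/eqP => k0; have := congr1 (mulmx K') k0.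
  rewrite -mulmx_col K'K mulmx0 => /colP/(_ i0); rewrite !mxE eqxx => /eqP.
  by rewrite oner_eq0.
(* This [B] makes [N] send the first basis vector to the second, so [N] is not scalar. *)
have [B PB BK] := orbit_full (L' *m col i1 1%:M) Ki0.
pose N := L *m B *m K.
have Ni0 : col i0 N = col i1 1%:M.
  by rewrite /N -!mulmxA !mulmx_col !BK mulmxA LL' mul1mx.
have [l /eigenvalueP[v vN v0]] := eigenvalue_closed N r0.
have rN : (\rank (N - l%:M)%R < r)%N.
  rewrite ltn_neqAle rank_leq_row andbT -[_ == r]/(row_free (N - l%:M)).
  apply: contra v0 => /row_free_inj inj; apply/eqP/inj.
  by rewrite mulmxBr mul_mx_scalar vN subrr mul0mx.
have N0 : N - l%:M != 0.
  apply/eqP => /(congr1 (col i0)); rewrite raddfB /= Ni0 => /colP/(_ i1).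
  by rewrite !mxE !eqxx mulr0n subr0 => /eqP; rewrite oner_eq0.
exists (A *m B *m A - l *: A).
  by apply: subspaceB => //; [do 2 apply: PM => // | exact: subspaceZ].
have -> : A *m B *m A - l *: A = K *m (N - l%:M) *m L.
  rewrite mulmxBr mulmxBl mul_mx_scalar -scalemxAl AE; congr (_ - _).
  by rewrite -{1 2}AE /N !mulmxA.
rewrite (leq_ltn_trans (mxrankM_maxl _ _)) ?(leq_ltn_trans (mxrankM_maxr _ _)) //.
rewrite andbT; apply: contra N0 => /eqP /(congr1 (fun X => K' *m X *m L')).
by rewrite !mulmxA K'K mul1mx -mulmxA LL' mulmx1 mulmx0 mul0mx => ->.
Qed.

Let rank_one : exists2 A, P A & \rank A = 1%N.
Proof.
suff H : forall r A, P A -> A != 0 -> (\rank A <= r)%N -> exists2 A, P A & \rank A = 1%N.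
  apply: (H n 1%:M) => //; last exact: rank_leq_row.
  by rewrite -mxrank_eq0 mxrank1 -lt0n.
elim=> [|r IH] A PA A0 Ar; first by rewrite leqn0 mxrank_eq0 (negbTE A0) in Ar.
have [rA|rA] := leqP (\rank A) 1.
  by exists A => //; apply/eqP; rewrite eqn_leq rA lt0n mxrank_eq0.
have [B PB /andP[B0 Br]] := rank_drop PA rA.
by apply: (IH B) => //; rewrite -ltnS (leq_trans Br).
Qed.

(** From one rank-one matrix [x y] in [P], transitivity on columns gives [v y] for every [v], and
    transitivity on rows then gives every elementary matrix. *)
Lemma Burnside A : P A.
Proof.
have [B PB B1] := rank_one.
have [x [y BE]] : exists x : 'cV[C]_n, exists y : 'rV[C]_n, B = x *m y.
  have := mulmx_base B; move: (col_base B) (row_base B); rewrite B1 => x y <-.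
  by exists x, y.
have B0 : x *m y != 0 by rewrite -BE -mxrank_eq0 B1.
have x0 : x != 0 by apply: contraNneq B0 => ->; rewrite mul0mx.
have y0 : y != 0 by apply: contraNneq B0 => ->; rewrite mulmx0.
have Pv v : P (v *m y).
  by have [D PD <-] := orbit_full v x0; rewrite -mulmxA -BE; exact: PM.
(* Transitivity on rows, by duality: the vectors killed by all [y D] form an invariant subspace,
   which is not the whole space because [y] is nonzero. *)
have row_full : forall u, exists2 D, P D & y *m D = u.
  apply: subspace_full.
    split; first by exists 0; rewrite ?mulmx0 //; exact: sP.1.
    move=> a _ _ [D PD <-] [E PE <-]; exists (a *: D + E); first exact: sP.2.
    by rewrite mulmxDr scalemxAr.
  move=> z zP.
  have [|U UQ] := @subspace_vspace _ 'cV[C]_n (fun w => forall D, P D -> y *m D *m w = 0).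
    split=> [D _|a u v Pu Pw D PD]; first by rewrite mulmx0.
    by rewrite mulmxDr -scalemxAr Pu // Pw // scaler0 addr0.
  have zU : z \in U by apply/UQ => D PD; apply: zP; exists D.
  case: (irrP (V := U)) => [D w PD /UQ wQ|U0|Uf].
  - by apply/UQ => E PE; rewrite mulmxA -(mulmxA y); apply: wQ; exact: PM.
  - by move: zU; rewrite U0 memv0 => /eqP.
  case/negP: y0; apply/eqP/rowP => j.
  have /UQ/(_ _ P1) : delta_mx j 0 \in U by rewrite Uf memvf.
  by rewrite mulmx1 -colE => /colP/(_ 0); rewrite !mxE.
rewrite [A]matrix_sum_delta; apply: subspace_sum => // i _.
apply: subspace_sum => // j _; apply: subspaceZ => //.
have [D PD yD] := row_full (delta_mx 0 j).
have -> : delta_mx i j = delta_mx i 0 *m (y *m D) :> 'M_n.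
  by rewrite yD mul_delta_mx.
by rewrite mulmxA; apply: PM.
Qed.

End Burnside.

(** * Newton's recursion for placement sums *)

Section Placements.
Variables (E : pzRingType) (I : eqType) (M : Type) (op : M -> M -> M).
Variable (io : I -> M -> E).
Hypothesis ioM : forall i a b, io i (op a b) = io i a * io i b.
Hypothesis ioC : forall i j a b, i != j -> io i a * io j b = io j b * io i a.

(* Sums over the injective placements of the entries of L at the indices of s. *)
Fixpoint place (L : seq M) (s : seq I) : E :=
  if L is a :: L' then \sum_(i <- s) io i a * place L' (rem i s) else 1.

Fixpoint bumps (a : M) (L : seq M) : seq (seq M) :=
  if L is b :: L' then (op a b :: L') :: [seq b :: K | K <- bumps a L'] else [::].

(* The new entry a lands either at a free index or on top of an entry of L. *)
Lemma placeD a L s : uniq s ->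
  (\sum_(i <- s) io i a) * place L s =
  place (a :: L) s + \sum_(K <- bumps a L) place K s.
Proof.
elim: L s => [|b L IH] s us.
  by rewrite /= big_nil addr0 mulr1; apply: eq_bigr => i _; rewrite mulr1.
rewrite [place (b :: L) s]/= mulr_sumr.
have step j : j \in s -> (\sum_(i <- s) io i a) * (io j b * place L (rem j s)) =
    io j (op a b) * place L (rem j s)
    + (\sum_(i <- s | i != j) io j b * (io i a * place L (rem i (rem j s)))
       + \sum_(K <- bumps a L) io j b * place K (rem j s)).
  move=> js; have -> : \sum_(i <- s | i != j) io j b * (io i a * place L (rem i (rem j s)))
       + \sum_(K <- bumps a L) io j b * place K (rem j s) =
       io j b * ((\sum_(i <- s | i != j) io i a) * place L (rem j s)).
    have -> : \sum_(i <- s | i != j) io i a = \sum_(i <- rem j s) io i a.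
      by rewrite rem_filter // big_filter.
    rewrite IH ?rem_uniq // mulrDr /= !mulr_sumr; congr (_ + _).
    by rewrite -(big_filter _ (fun i => i != j)) -(rem_filter j us).
  rewrite (bigD1_seq j) //= mulrDl ioM !mulrA; congr (_ + _).
  rewrite mulr_suml mulr_sumr; congr (_ * _).
  by apply: eq_bigr => i ij; rewrite ioC.
rewrite (eq_big_seq _ step) !big_split /= addrCA; congr (_ + _).
  rewrite (exchange_big_dep predT) //=; apply: eq_big_seq => i si.
  rewrite mulr_sumr (rem_filter _ us) big_filter.
  under eq_bigl do rewrite eq_sym.
  apply: eq_bigr => j ji; rewrite mulrA -ioC 1?eq_sym // -mulrA.
  congr (_ * (_ * place L _)); rewrite !rem_filter ?filter_uniq // -!filter_predI.
  by apply: eq_filter => x; rewrite /= andbC.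
rewrite big_cons /=; congr (_ + _).
by rewrite exchange_big /= big_map.
Qed.

Lemma bumps_size a L : all (fun K => size K == size L) (bumps a L).
Proof.
elim: L => //= b L IH; rewrite eqxx /= all_map; apply: sub_all IH => K /= /eqP ->.
exact: eqxx.
Qed.

(** Read [placeD] as a recursion: the placement sum of [a :: L] is the power sum of [a] times that
    of [L], minus placement sums of shorter lists. The grading [g] is trivial in the application to
    the commutant and is the degree in the application to symmetric functions. *)
Lemma place_closed (g : M -> nat) (A : nat -> E -> Prop) s :
    (forall a b, g (op a b) = (g a + g b)%N) ->
    A 0%N 1 -> (forall n, A n 0) ->
    (forall n x y, A n x -> A n y -> A n (x - y)) ->
    (forall m n x y, A m x -> A n y -> A (m + n)%N (x * y)) ->
    (forall a, A (g a) (\sum_(i <- s) io i a)) -> uniq s ->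
  forall L, A (sumn (map g L)) (place L s).
Proof.
move=> gM A1 AD0 AB AM AD us.
have bumpsg a L : all (fun K => sumn (map g K) == sumn (map g (a :: L))) (bumps a L).
  elim: L => //= b L IH; rewrite gM -addnA eqxx /= all_map.
  by apply: sub_all IH => K /= /eqP ->; rewrite addnCA.
have AN n x y : A n x -> A n y -> A n (x + y).
  by move=> Ax Ay; have := AB _ _ _ Ax (AB _ _ _ (AD0 n) Ay); rewrite sub0r opprK.
have Asum (T : eqType) n (r : seq T) (f : T -> E) :
    (forall x, x \in r -> A n (f x)) -> A n (\sum_(x <- r) f x).
  by move=> H; rewrite big_seq; apply: (big_ind (A n)) => //; exact: AN.
move=> L; have [n sL] := ubnP (size L); elim: n L sL => // n IH [|a L] //.
rewrite /= ltnS => sL; have := placeD a L us.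
move/eqP; rewrite -subr_eq /= => /eqP <-; apply: AB.
  by apply: AM => //; apply: IH.
rewrite big_tnth; apply: Asum => i _; set K := tnth _ _.
have Kb : K = nth [::] (bumps a L) i by rewrite /K (tnth_nth [::]).
have lti : (i < size (bumps a L))%N by [].
have /eqP /= <- := all_nthP [::] (bumpsg a L) i lti.
rewrite -Kb; apply: IH; rewrite Kb.
by have /eqP -> := all_nthP [::] (bumps_size a L) i lti.
Qed.

Lemma place_perms L s : uniq s -> size L = size s ->
  place L s = \sum_(t <- permutations s) \prod_(x <- zip L t) io x.2 x.1.
Proof.
elim: L s => [|a L IH] s us sz.
  by case: s us sz => // _ _; rewrite big_seq1 big_nil.
have s0 : (0 < size s)%N by rewrite -sz.
rewrite (perm_big _ (permutationsE s0)) /= big_allpairs_dep undup_id //.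
apply: eq_big_seq => i si; rewrite IH ?rem_uniq ?size_rem -?sz // mulr_sumr.
by apply: eq_bigr => t _; rewrite big_cons.
Qed.

End Placements.

(** * The tensor power and the commutant of the symmetric group *)

Local Open Scope sesquilinear_scope.

Lemma deriv_prod (R : comNzRingType) (I : finType) (f : I -> {poly R}) :
  (\prod_i f i)^`() = \sum_i (f i)^`() * \prod_(j | j != i) f j.
Proof.
suff H (r : seq I) : uniq r ->
    (\prod_(i <- r) f i)^`() = \sum_(i <- r) (f i)^`() * \prod_(j <- r | j != i) f j.
  by rewrite -H ?index_enum_uniq.
elim: r => [|i r IH] /=; first by rewrite !big_nil derivC.
case/andP => ir ur; rewrite !big_cons derivM IH // eqxx /=; congr (_ + _).
  congr (_ * _); rewrite [RHS]big_seq_cond [LHS]big_seq.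
  by apply: eq_bigl => j; case: eqVneq => [->|]; rewrite ?(negbTE ir) ?andbF ?andbT.
rewrite mulr_sumr; apply: eq_big_seq => j jr; rewrite big_cons.
by case: eqVneq => [ij|_]; [rewrite ij jr in ir | rewrite mulrCA].
Qed.

Section UnitCirclePoints.
Variable C : numClosedFieldType.

(** Cayley transforms of the natural numbers: explicit and pairwise distinct points of the unit
    circle. *)
Definition circle_point (k : nat) : C := (1 + k%:R * 'i) / (1 - k%:R * 'i).

Let den_neq0 k : 1 - k%:R * 'i != 0 :> C.
Proof.
apply/eqP => k0; have : (1 - k%:R * 'i) * (1 + k%:R * 'i) = 1 + k%:R ^+ 2 :> C.
  by rewrite -subr_sqr exprMn sqrCi expr1n mulrN1 opprK.
rewrite k0 mul0r => /esym/eqP.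
by apply/negP; rewrite gt_eqF.
Qed.

Lemma circle_point_norm k : `|circle_point k| = 1.
Proof.
rewrite /circle_point normrM normfV.
have -> : 1 + k%:R * 'i = (1 - k%:R * 'i)^* :> C.
  by rewrite rmorphB rmorphM /= conjCi conjC_nat rmorph1 mulrN opprK.
by rewrite norm_conjC divff // normr_eq0.
Qed.

Lemma circle_point_inj : injective circle_point.
Proof.
move=> k l; rewrite /circle_point => /eqP; rewrite eqr_div // => /eqP kl.
have : (k%:R - l%:R) * ('i *+ 2) = 0 :> C.
  by transitivity ((1 + k%:R * 'i) * (1 - l%:R * 'i)
      - (1 + l%:R * 'i) * (1 - k%:R * 'i) : C); [ring | rewrite kl; ring].
move/eqP; rewrite mulf_eq0 subr_eq0 eqr_nat mulrn_eq0 /= (negbTE (neq0Ci _)) orbF.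
by move/eqP.
Qed.

(* Lagrange interpolation at d + 1 points of the unit circle. *)
Lemma circle_deriv d : exists s : seq (C * C), all (fun cx => `|cx.2| == 1) s /\
  forall p : {poly C}, (size p <= d.+1)%N ->
    \sum_(cx <- s) cx.1 * p.[cx.2] = p^`().[1].
Proof.
pose a : 'rV[C]_d.+1 := \row_i circle_point i.
pose V := Vandermonde d.+1 a.
have uV : V \in unitmx.
  rewrite unitmxE unitfE det_Vandermonde; apply/prodf_neq0 => i _.
  apply/prodf_neq0 => j ij; rewrite !mxE subr_eq0 (inj_eq circle_point_inj).
  by rewrite eq_sym neq_ltn ij.
(* The Vandermonde system is solved so that the functional takes the value k on X^k, which is the
   derivative of X^k at 1. *)
pose c := invmx V *m \col_i (i%:R : C).
exists [seq (c i 0, circle_point i) | i : 'I_d.+1 <- enum 'I_d.+1]; split.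
  by apply/allP => _ /mapP[i _ ->]; rewrite circle_point_norm eqxx.
move=> p sp; rewrite big_map big_enum /=.
under eq_bigr do rewrite (horner_coef_wide _ sp) mulr_sumr.
rewrite exchange_big /=.
have cV (k : 'I_d.+1) : \sum_(i < d.+1) c i 0 * circle_point i ^+ k = k%:R.
  have /matrixP/(_ k 0) := mulKVmx uV (\col_i (i%:R : C)).
  rewrite -/c !mxE => <-; apply: eq_bigr => i _; rewrite !mxE; exact: mulrC.
transitivity (\sum_(k < d.+1) p`_k * k%:R).
  apply: eq_bigr => k _; rewrite -cV mulr_sumr; apply: eq_bigr => i _.
  by rewrite mulrCA.
rewrite -{2}(take_poly_id sp) /take_poly poly_def raddf_sum /= horner_sum.
apply: eq_bigr => k _; rewrite derivZ derivXn hornerZ hornerMn hornerXn expr1n.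
by [].
Qed.

End UnitCirclePoints.

Section Words.
Variables (C : numClosedFieldType) (d N : nat).

Definition word := {ffun 'I_d -> 'I_N}.
Local Notation m := #|{: word}|.

Definition wmx (f : word -> word -> C) : 'M[C]_m :=
  \matrix_(i, j) f (enum_val i) (enum_val j).

Definition went (B : 'M[C]_m) (x y : word) : C := B (enum_rank x) (enum_rank y).

Lemma wmxE f x y : went (wmx f) x y = f x y.
Proof. by rewrite /went mxE !enum_rankK. Qed.

Lemma wmxP A B : (forall x y, went A x y = went B x y) <-> A = B.
Proof.
split=> [AB|-> //]; apply/matrixP => i j.
by rewrite -[ i ]enum_valK -[j]enum_valK; exact: AB.
Qed.

Lemma sum_word (R : nmodType) (f : 'I_m -> R) :
  \sum_i f i = \sum_(x : word) f (enum_rank x).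
Proof. by rewrite (reindex enum_rank) //; exact/onW_bij/enum_rank_bij. Qed.

Lemma wentM A B x y : went (A *m B) x y = \sum_z went A x z * went B z y.
Proof. by rewrite /went mxE sum_word. Qed.

Lemma went1 x y : went 1%:M x y = (x == y)%:R.
Proof. by rewrite /went mxE (inj_eq enum_rank_inj). Qed.

Lemma wentD A B x y : went (A + B) x y = went A x y + went B x y.
Proof. by rewrite /went mxE. Qed.

Lemma wentZ a B x y : went (a *: B) x y = a * went B x y.
Proof. by rewrite /went mxE. Qed.

Lemma went_sum (I : Type) (r : seq I) (P : pred I) (F : I -> 'M_m) x y :
  went (\sum_(i <- r | P i) F i) x y = \sum_(i <- r | P i) went (F i) x y.
Proof. by rewrite /went summxE. Qed.

Lemma tr_word A : \tr A = \sum_x went A x x.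
Proof. by rewrite /mxtrace sum_word. Qed.

Definition tenf (X : 'I_d -> 'M[C]_N) : 'M[C]_m :=
  wmx (fun x y => \prod_k X k (x k) (y k)).

Lemma tenfE X x y : went (tenf X) x y = \prod_k X k (x k) (y k).
Proof. exact: wmxE. Qed.

Lemma tenfM X Y : tenf X *m tenf Y = tenf (fun k => X k *m Y k).
Proof.
apply/wmxP => x y; rewrite wentM tenfE.
under [RHS]eq_bigr do rewrite mxE.
rewrite bigA_distr_bigA /=; apply: eq_bigr => z _.
by rewrite !tenfE -big_split.
Qed.

Lemma eq_tenf X Y : X =1 Y -> tenf X = tenf Y.
Proof.
by move=> XY; apply/wmxP => x y; rewrite !tenfE; apply: eq_bigr => k _; rewrite XY.
Qed.

Lemma prod_delta (x y : word) : \prod_k (1%:M : 'M[C]_N) (x k) (y k) = (x == y)%:R.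
Proof.
case: eqVneq => [->|xy]; first by rewrite big1 // => k _; rewrite mxE eqxx.
have [k kxy] : exists k, x k != y k.
  apply/existsP; apply: contraNT xy; rewrite negb_exists => /forallP H.
  by apply/eqP/ffunP => k; apply/eqP; have := H k; rewrite negbK.
by rewrite (bigD1 k) //= mxE (negbTE kxy) mul0r.
Qed.

Lemma tenf1 : tenf (fun=> 1%:M) = 1%:M.
Proof. by apply/wmxP => x y; rewrite tenfE went1 prod_delta. Qed.

Definition tens (U : 'M[C]_N) := tenf (fun=> U).

Lemma tensM U V : tens (U *m V) = tens U *m tens V.
Proof. by rewrite /tens tenfM. Qed.

Lemma tens1 : tens 1%:M = 1%:M. Proof. exact: tenf1. Qed.

(** The basis word [y] goes to the composite of [y] with [s]; as a product in ['S_d] applies its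
    left factor first, this is a homomorphism. *)
Definition rho (s : 'S_d) : 'M[C]_m :=
  wmx (fun x y => (x == [ffun k => y (s k)])%:R).

Lemma rhoE s x y : went (rho s) x y = (x == [ffun k => y (s k)])%:R.
Proof. exact: wmxE. Qed.

Lemma went_rhoM s A x y :
  went (rho s *m A) x y = went A [ffun k => x ((s^-1)%g k)] y.
Proof.
rewrite wentM (bigD1 [ffun k => x ((s^-1)%g k)]) //= big1 => [|z zx].
  rewrite rhoE addr0; case: eqP => [_|[]]; first by rewrite mul1r.
  by apply/ffunP => k; rewrite !ffunE permK.
rewrite rhoE; case: eqP => [xz|_]; last by rewrite mul0r.
by case/eqP: zx; apply/ffunP => k; rewrite xz !ffunE permKV.
Qed.

Lemma went_Mrho s A x y :
  went (A *m rho s) x y = went A x [ffun k => y (s k)].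
Proof.
rewrite wentM (bigD1 [ffun k => y (s k)]) //= big1 => [|z zx].
  by rewrite rhoE addr0 eqxx mulr1.
by rewrite rhoE (negbTE zx) mulr0.
Qed.

Lemma rhoM s t : rho (s * t)%g = rho s *m rho t.
Proof.
apply/wmxP => x y; rewrite went_Mrho !rhoE; congr (_ == _)%:R.
by apply/ffunP => k; rewrite !ffunE permM.
Qed.

Lemma rho1 : rho 1%g = 1%:M.
Proof.
apply/wmxP => x y; rewrite rhoE went1; congr (_ == _)%:R.
by apply/ffunP => k; rewrite ffunE perm1.
Qed.

Lemma rho_tenf s X : rho s *m tenf X = tenf (X \o s) *m rho s.
Proof.
apply/wmxP => x y; rewrite went_rhoM went_Mrho !tenfE (reindex_inj (@perm_inj _ s)).
by apply: eq_bigr => k _ /=; rewrite !ffunE permK.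
Qed.

Lemma rho_tens s U : rho s *m tens U = tens U *m rho s.
Proof. by rewrite /tens rho_tenf. Qed.

Definition commutant (B : 'M[C]_m) := forall s, B *m rho s = rho s *m B.

Lemma commutantP B : commutant B <-> forall (s : 'S_d) (x y : word),
  went B [ffun k => x (s k)] [ffun k => y (s k)] = went B x y.
Proof.
split=> [cB s x y|cB s]; last apply/wmxP => x y.
  rewrite -went_Mrho cB went_rhoM; congr (went _ _ _).
  by apply/ffunP => k; rewrite !ffunE permKV.
rewrite went_Mrho went_rhoM -[RHS](cB s); congr (went _ _ _).
by apply/ffunP => k; rewrite !ffunE permK.
Qed.

Definition slot (k : 'I_d) (X : 'M[C]_N) : 'M[C]_m :=
  tenf (fun l => if l == k then X else 1%:M).

Lemma slotE k X x y : went (slot k X) x y =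
  X (x k) (y k) * \prod_(l | l != k) (1%:M : 'M[C]_N) (x l) (y l).
Proof.
rewrite tenfE (bigD1 k) //= eqxx; congr (_ * _).
by apply: eq_bigr => l /negbTE ->.
Qed.

Lemma slotM k X Y : slot k (X *m Y) = slot k X *m slot k Y.
Proof. by rewrite /slot tenfM; apply: eq_tenf => l; case: eqP; rewrite ?mul1mx. Qed.

Lemma slotC k l X Y : k != l -> slot k X *m slot l Y = slot l Y *m slot k X.
Proof.
move=> kl; rewrite /slot !tenfM; apply: eq_tenf => i.
case: eqVneq => [->|_]; first by rewrite (negbTE kl) mul1mx mulmx1.
by rewrite mul1mx mulmx1.
Qed.

(** The derivative of [tens] at 1 in the direction [X]: the action of the Lie algebra gl_N on the
    tensor power. *)
Definition dtens (X : 'M[C]_N) : 'M[C]_m := \sum_k slot k X.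

Lemma dtens_linear a X Y : dtens (a *: X + Y) = a *: dtens X + dtens Y.
Proof.
rewrite /dtens scaler_sumr -big_split /=; apply: eq_bigr => k _.
by apply/wmxP => x y; rewrite wentD wentZ !slotE !mxE mulrDl mulrA.
Qed.

Lemma dtens_sub X Y : dtens (X - Y) = dtens X - dtens Y.
Proof. by rewrite addrC -scaleN1r dtens_linear addrC scaleN1r. Qed.

Lemma dtensZ a X : dtens (a *: X) = a *: dtens X.
Proof.
have d0 : dtens 0 = 0 by rewrite -(subrr (0 : 'M[C]_N)) dtens_sub subrr.
by rewrite -[a *: X]addr0 dtens_linear d0 addr0.
Qed.

Lemma dtens_commutant X : commutant (dtens X).
Proof.
move=> s; rewrite /dtens mulmx_suml mulmx_sumr [RHS](reindex_inj (@perm_inj _ s)) /=.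
apply: eq_bigr => k _; rewrite /slot rho_tenf; congr (_ *m _).
by apply: eq_tenf => l /=; rewrite (inj_eq perm_inj).
Qed.

Definition unitary_span (B : 'M[C]_m) : Prop := exists s : seq (C * 'M[C]_N),
  all (fun cU => cU.2 \is unitarymx) s /\ B = \sum_(cU <- s) cU.1 *: tens cU.2.

Lemma unitary_spanW U : U \is unitarymx -> unitary_span (tens U).
Proof.
by move=> uU; exists [:: (1, U)]; rewrite /= uU big_seq1 scale1r.
Qed.

Lemma unitary_span_subspace : is_subspace unitary_span.
Proof.
split; first by exists [::]; rewrite big_nil.
move=> a _ _ [s [us ->]] [t [ut ->]].
exists ([seq (a * cU.1, cU.2) | cU <- s] ++ t); rewrite all_cat all_map us ut.
split=> //; rewrite big_cat big_map scaler_sumr; congr (_ + _).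
by apply: eq_bigr => cU _; rewrite scalerA.
Qed.

Lemma unitary_spanM A B : unitary_span A -> unitary_span B -> unitary_span (A *m B).
Proof.
move=> [s [us ->]] [t [ut ->]].
rewrite mulmx_suml big_seq; apply: (subspace_sum unitary_span_subspace) => p ps.
rewrite mulmx_sumr big_seq; apply: (subspace_sum unitary_span_subspace) => q qt.
rewrite -scalemxAl -scalemxAr -tensM; do 2 apply: (subspaceZ unitary_span_subspace).
apply: unitary_spanW; apply: mul_unitarymx; [exact: (allP us _ ps) | exact: (allP ut _ qt)].
Qed.

(* For an orthogonal projection Y and |x| = 1 the matrix 1 + (x - 1) Y is
   unitary, and dtens Y is the derivative of its tensor power at x = 1. *)
Lemma dtens_proj (s : seq (C * C)) Y :
  (forall p : {poly C}, (size p <= d.+1)%N ->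
    \sum_(cx <- s) cx.1 * p.[cx.2] = p^`().[1]) ->
  dtens Y = \sum_(cx <- s) cx.1 *: tens (1%:M + (cx.2 - 1) *: Y).
Proof.
move=> hs; apply/wmxP => x y.
(* Entries of 1 + (x - 1) Y are affine in x, so a product of d of them has degree at most d, within
   reach of the interpolation formula. *)
pose q k : {poly C} := ((1%:M - Y) (x k) (y k))%:P + (Y (x k) (y k)) *: 'X.
have sq k : (size (q k) <= 2)%N.
  rewrite (leq_trans (size_polyD _ _)) // geq_max (leq_trans (size_polyC_leq1 _)) //.
  by rewrite (leq_trans (size_scale_leq _ _)) ?size_polyX.
have qx k z : (q k).[z] = (1%:M + (z - 1) *: Y) (x k) (y k).
  by rewrite /q hornerD hornerC hornerZ hornerX !mxE; ring.
have := hs (\prod_k q k); rewrite (leq_trans (size_prod_leq _ _)); last first.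
  rewrite /= card_ord leq_subLR addnS ltnS.
  apply: (@leq_trans (\sum_(k < d) 2)); first by apply: leq_sum => k _; exact: sq.
  by rewrite sum_nat_const card_ord muln2 addnn.
move/(_ isT) => e.
transitivity ((\prod_k q k)^`().[1]).
  rewrite deriv_prod horner_sum went_sum; apply: eq_bigr => k _.
  rewrite slotE hornerM horner_prod; congr (_ * _).
    by rewrite /q derivD derivC add0r derivZ derivX hornerZ hornerC mulr1.
  by apply: eq_bigr => l _; rewrite qx subrr scale0r addr0.
rewrite -e went_sum; apply: eq_bigr => cx _; rewrite wentZ tenfE horner_prod.
by congr (_ * _); apply: eq_bigr => k _; rewrite qx.
Qed.

Lemma unitary_span_dtens_proj Y : Y *m Y = Y -> Y ^t* = Y ->
  unitary_span (dtens Y).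
Proof.
move=> YY Yh; have [s [us hs]] := circle_deriv C d.
rewrite (dtens_proj Y hs) big_seq; apply: (subspace_sum unitary_span_subspace).
move=> cx cxs; apply: (subspaceZ unitary_span_subspace); apply: unitary_spanW.
have /eqP n1 := allP us _ cxs; apply/unitarymxP.
rewrite linearD /= map_mxD tr_scalar_mx map_scalar_mx /= rmorph1.
rewrite linearZ /= map_mxZ Yh /= rmorphB rmorph1.
rewrite mulmxDl mulmxDr !mulmx1 mulmxDr mulmx1 -scalemxAl -!scalemxAr mul1mx YY.
rewrite scalerA -!addrA -!scalerDl rmorph1.
have -> : cx.2^* - 1 + (cx.2 - 1 + (cx.2 - 1) * (cx.2^* - 1)) = cx.2 * cx.2^* - 1.
  by ring.
by rewrite -normCK n1 expr1n subrr scale0r addr0.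
Qed.

(** Divided by [c], the outer product is the orthogonal projection onto a line. *)
Lemma unitary_span_dtens_outer (v : 'rV[C]_N) c : c \is Num.real -> c != 0 ->
  v *m v ^t* = c%:M -> unitary_span (dtens (v ^t* *m v)).
Proof.
move=> cr c0 vv.
have -> : v ^t* *m v = c *: (c^-1 *: (v ^t* *m v)) by rewrite scalerA divff ?scale1r.
rewrite dtensZ; apply: (subspaceZ unitary_span_subspace).
apply: unitary_span_dtens_proj.
  rewrite -scalemxAl -scalemxAr !mulmxA -(mulmxA _ v) vv mul_mx_scalar.
  by rewrite -scalemxAl [in LHS]scalerA mulVf // scale1r.
have -> : (c^-1 *: (v ^t* *m v)) ^t* = c^-1^* *: (v ^t* *m v).
  by apply/matrixP => i j; rewrite !mxE !big_ord1 !mxE !rmorphM /= conjCK [v 0 j * _]mulrC.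
by rewrite conj_Creal // rpredV.
Qed.

(** Polarization: outer products of [v i + w v j] with |w| = 1 produce w E_ij + conj(w) E_ji modulo
    diagonal matrices, and the two values 1 and ['i] of w separate E_ij. *)
Lemma unitary_span_dtens X : unitary_span (dtens X).
Proof.
pose S := unitary_span_subspace.
have dD a b : unitary_span (dtens a) -> unitary_span (dtens b) ->
    forall e, unitary_span (dtens (e *: a + b)).
  by move=> Sa Sb e; rewrite dtens_linear; apply: S.2.
pose v (i : 'I_N) : 'rV[C]_N := delta_mx 0 i.
have vh i : v i ^t* = delta_mx i 0.
  by rewrite /v trmx_delta map_delta_mx.
have Sii i : unitary_span (dtens (delta_mx i i)).
  have := @unitary_span_dtens_outer (v i) 1 (rpred1 _) (oner_neq0 _).
  by rewrite vh !mul_delta_mx; apply; apply/matrixP => k l; rewrite !ord1 !mxE !eqxx.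
have Sij i j : unitary_span (dtens (delta_mx i j)).
  have [->//|ij] := eqVneq i j.
  have Sw w : `|w| = 1 ->
      unitary_span (dtens (w *: delta_mx i j + w^* *: delta_mx j i)).
    move=> w1.
    have wwc : w^* * w = 1 by rewrite mulrC -normCK w1 expr1n.
    have H := @unitary_span_dtens_outer (v i + w *: v j) 2%:R (realn _ _) _.
    have E : (v i + w *: v j) ^t* = delta_mx i 0 + w^* *: delta_mx j 0.
      by rewrite linearD linearZ /= map_mxD map_mxZ !vh.
    have -> : w *: delta_mx i j + w^* *: delta_mx j i =
       (v i + w *: v j) ^t* *m (v i + w *: v j) - (delta_mx i i + delta_mx j j) :> 'M[C]_N.
      rewrite E mulmxDl !mulmxDr -!scalemxAl -!scalemxAr !mul_delta_mx scalerA wwc.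
      rewrite scale1r; apply/matrixP => k l; rewrite !mxE; ring.
    rewrite dtens_sub; apply: (subspaceB S); last first.
      by rewrite -[delta_mx i i]scale1r; exact: dD.
    apply: H; first by rewrite pnatr_eq0.
    rewrite E mulmxDl !mulmxDr -!scalemxAl -!scalemxAr !mul_delta_mx_cond.
    rewrite !eqxx (negbTE ij) eq_sym (negbTE ij) !mulr0n !mulr1n !scaler0 addr0 add0r.
    rewrite scalerA mulrC wwc scale1r; apply/matrixP => k l.
    by rewrite !ord1 !mxE !eqxx.
  have -> : delta_mx i j = 2^-1 *: ((1 *: delta_mx i j + 1^* *: delta_mx j i)
      - 'i *: ('i *: delta_mx i j + 'i^* *: delta_mx j i)) :> 'M[C]_N.
    rewrite conjCi rmorph1; apply/matrixP => k l; rewrite !mxE.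
    set a := (_ && _)%:R; set b := (_ && _)%:R.
    have -> : 'i * ('i * a + - 'i * b) = b - a :> C.
      by rewrite mulrDr !mulrA mulrN -expr2 sqrCi; ring.
    by field.
  rewrite dtensZ dtens_sub [dtens ('i *: _)]dtensZ; apply: (subspaceZ S).
  apply: (subspaceB S); first by apply: Sw; rewrite normr1.
  by apply: (subspaceZ S); apply: Sw; rewrite normCi.
rewrite [X]matrix_sum_delta /dtens.
have dsum (I : Type) (r : seq I) (f : I -> 'M[C]_N) :
    (forall i, unitary_span (dtens (f i))) -> unitary_span (dtens (\sum_(i <- r) f i)).
  move=> H; elim: r => [|i r IH]; first by rewrite big_nil -[0](subrr 0) dtens_sub subrr; exact: S.1.
  by rewrite big_cons -[f i]scale1r; exact: dD.
by apply: (dsum) => i; apply: (dsum) => j; rewrite dtensZ; apply: (subspaceZ S).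
Qed.

(* The commutant is spanned by the symmetrizations of pure tensors, which are
   noncommutative polynomials in the dtens X. *)
Lemma commutant_unitary_span B : commutant B -> unitary_span B.
Proof.
move=> cB; pose S := unitary_span_subspace.
have uI := enum_uniq 'I_d.
have Splace (L : seq 'M[C]_N) : unitary_span (place slot L (enum 'I_d)).
  have := @place_closed _ _ _ (fun a b : 'M[C]_N => a *m b) slot (fun k a b => slotM k a b)
    (fun k l a b kl => slotC a b kl) (fun=> 0%N) (fun=> unitary_span) (enum 'I_d).
  move/(_ (fun _ _ => erefl)); apply=> //.
  - by rewrite -[1]/(1%:M) -tens1; apply: unitary_spanW; apply/unitarymxP;
       rewrite mul1mx tr_scalar_mx map_scalar_mx rmorph1.
  - by move=> _; exact: S.1.
  - by move=> _ x y; exact: (subspaceB S).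
  - by move=> _ _ x y; exact: unitary_spanM.
  - by move=> a; rewrite big_enum; exact: unitary_span_dtens.
pose L (x y : word) : seq 'M[C]_N := [seq delta_mx (x k) (y k) | k <- enum 'I_d].
(* Expand [B] in elementary tensors and move the tensor slots by [t]: this conjugates [B] by a
   permutation, which leaves it unchanged. Summing over the d! arrangements [t] turns the expansion
   into placement sums. *)
have perm_part t : t \in permutations (enum 'I_d) ->
    \sum_x \sum_y went B x y *: (\prod_(z <- zip (L x y) t) slot z.2 z.1) = B.
  rewrite mem_permutations => pt.
  have /tuple_permP[s ts] : perm_eq t (ord_tuple d) by rewrite val_ord_tuple.
  have prodE (F : 'I_d -> 'M[C]_N) (r : seq 'I_d) : uniq r ->
      \prod_(z <- zip [seq F k | k <- r] [seq s k | k <- r]) slot z.2 z.1 =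
      tenf (fun k => if (s^-1)%g k \in r then F ((s^-1)%g k) else 1%:M).
    elim: r => [_|k r IH] /=; first by rewrite big_nil; exact: (esym tenf1).
    case/andP => kr ur; rewrite big_cons IH //= -[_ * _]/(_ *m _) tenfM.
    apply: eq_tenf => l; rewrite inE (canF_eq (permKV s)).
    case: eqVneq => [->|_]; last by rewrite mul1mx.
    by rewrite permK (negbTE kr) mulmx1.
  have tE : t = [seq s k | k <- enum 'I_d].
    rewrite ts /=; apply: eq_map => k; by rewrite tnth_ord_tuple.
  apply/wmxP => x' y'; pose x := [ffun k => x' (s k)]; pose y := [ffun k => y' (s k)].
  have dE u v : went (\prod_(z <- zip (L u v) t) slot z.2 z.1) x' y' =
      ((x == u) && (y == v))%:R.
    rewrite tE prodE ?enum_uniq // tenfE (reindex_inj (@perm_inj _ s)) /=.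
    have -> : ((x == u) && (y == v))%:R = (x == u)%:R * (y == v)%:R :> C by case: eqP; rewrite ?mul0r ?mul1r.
    rewrite -!prod_delta -big_split /=; apply: eq_bigr => k _.
    rewrite permK mem_enum !mxE !ffunE.
    by case: eqP; rewrite ?mul0r ?mul1r.
  rewrite went_sum (bigD1 x) //= went_sum (bigD1 y) //= wentZ dE !eqxx mulr1.
  rewrite !big1 ?addr0 => [|u /negbTE ux|v /negbTE vy].
  - by move/commutantP: cB => ->.
  - by rewrite went_sum big1 // => v _; rewrite wentZ dE eq_sym ux mulr0.
  - by rewrite wentZ dE [y == v]eq_sym vy andbF mulr0.
have: unitary_span (\sum_(t <- permutations (enum 'I_d)) B).
  rewrite -(eq_big_seq _ perm_part) exchange_big /=; apply: (subspace_sum S) => x _.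
  rewrite exchange_big /=; apply: (subspace_sum S) => y _.
  rewrite -scaler_sumr; apply: (subspaceZ S).
  by rewrite -place_perms ?size_map.
rewrite big_const_seq count_predT size_permutations // iter_addr_0 -scaler_nat.
by move/(subspaceZ S (size (enum 'I_d))`!%:R^-1); rewrite scalerA mulVf ?scale1r.
Qed.

End Words.

Local Close Scope sesquilinear_scope.

(** * Traces on the tensor power *)

Local Open Scope sesquilinear_scope.

Section TensorTraces.
Variables (C : numClosedFieldType) (d N : nat).
Local Notation word := (word d N).
Local Notation tens := (@tens C d N).
Local Notation rho := (@rho C d N).
Local Notation dtens := (@dtens C d N).
Local Notation slot := (@slot C d N).

Definition cycle_trace (U : 'M[C]_N) (s : 'S_d) : C :=
  \prod_(X in porbits s) \tr (U ^+ #|X|).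

Lemma tr_conj n (V A : 'M[C]_n) : V \in unitmx -> \tr (invmx V *m A *m V) = \tr A.
Proof. by move=> uV; rewrite mxtrace_mulC mulmxA mulmxV // mul1mx. Qed.

Lemma exp_conj n (V A : 'M[C]_n) k : V \in unitmx ->
  (invmx V *m A *m V) ^+ k = invmx V *m A ^+ k *m V.
Proof.
move=> uV; elim: k => [|k IH]; first by rewrite !expr0 mulmx1 mulVmx.
by rewrite !exprS IH -[LHS]/(_ *m _) !mulmxA mulmxK.
Qed.

Lemma diag_exp n (u : 'rV[C]_n) k : diag_mx u ^+ k = diag_mx (\row_i u 0 i ^+ k).
Proof.
elim: k => [|k IH].
  by rewrite expr0; apply/matrixP => i j; rewrite !mxE expr0.
rewrite exprS IH -[LHS]/(_ *m _) mulmx_diag; congr diag_mx.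
by apply/rowP => i; rewrite !mxE exprS.
Qed.

Lemma prod_porbits (R : comPzSemiRingType) (s : 'S_d) (F : 'I_d -> R) :
  \prod_k F k = \prod_(X in porbits s) \prod_(k in X) F k.
Proof.
rewrite (partition_big (porbit s) (mem (porbits s))) /=; last first.
  by move=> k _; exact: imset_f.
apply: eq_bigr => X /imsetP[x _ ->]; apply: eq_bigl => k.
by rewrite eq_porbit_mem.
Qed.

(** Only words constant on the cycles of [s] contribute to the trace, and such a word is a choice of
    one letter per cycle. *)
Lemma tr_tens_rho_diag (u : 'rV[C]_N) s : (0 < N)%N ->
  \tr (tens (diag_mx u) *m rho s) = cycle_trace (diag_mx u) s.
Proof.
move=> N0; pose a0 := Ordinal N0.
rewrite tr_word; under eq_bigr do rewrite went_Mrho tenfE.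
rewrite /cycle_trace.
have -> : \prod_(X in porbits s) \tr (diag_mx u ^+ #|X|) =
    \prod_(X in porbits s) \sum_a u 0 a ^+ #|X|.
  by apply: eq_bigr => X _; rewrite diag_exp mxtrace_diag; apply: eq_bigr => a _; rewrite mxE.
rewrite (big_distr_big_dep a0) /=.
(* [g] reads the letter on each cycle and [h] spreads it back; [a0] is the value that the
   distributed product prescribes on sets that are not cycles. *)
pose g (x : word) : {ffun {set 'I_d} -> 'I_N} :=
  [ffun X : {set 'I_d} => if X \in porbits s then
     if [pick k in X] is Some k then x k else a0 else a0].
pose h (f : {ffun {set 'I_d} -> 'I_N}) : word := [ffun k => f (porbit s k)].
rewrite (bigID (fun x : word => [forall k, x k == x (s k)])) /= addrC big1 => [|x]; last first.
  rewrite negb_forall => /existsP[k xk].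
  by rewrite (bigD1 k) //= !mxE ffunE (negbTE xk) mul0r.
have gx (x : word) X : [forall k, x k == x (s k)] -> X \in porbits s -> forall k, k \in X ->
    g x X = x k.
  move=> /forallP xs /[dup] Xs /imsetP[y _ ->] k ky; rewrite ffunE imset_f //.
  have xi i z : x ((s ^+ i)%g z) = x z.
    by elim: i => [|i IH]; rewrite ?perm1 // expgSr permM -(eqP (xs ((s ^+ i)%g z))).
  case: pickP => [l|/(_ y)]; last by rewrite porbit_id.
  by move: ky => /porbitP[i ->] /porbitP[j ->]; rewrite !xi.
rewrite add0r [RHS](reindex_onto g h) /=.
  apply: eq_big => [x|x /= xs].
    apply/idP/andP => [xs|[_ /eqP <-]]; last first.
      apply/forallP => k; have e : porbit s (s k) = porbit s k.
        by apply/eqP; rewrite eq_porbit_mem -{1}[s]expg1 mem_porbit.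
      by rewrite !ffunE e.
    split; last first.
      by apply/eqP/ffunP => k; rewrite ffunE (gx _ _ xs _ k) ?porbit_id ?imset_f.
    by apply/familyP => X; rewrite ffunE; case: ifP => // _; rewrite inE.
  rewrite (prod_porbits s); apply: eq_bigr => X Xs.
  have -> : #|X| = \sum_(k in X) 1%N by rewrite sum1_card.
  rewrite -[LHS]/(\prod_(k in X) _).
  rewrite (eq_bigr (fun=> u 0 (g x X))) => [|k kX].
    by rewrite prodr_const sum1_card.
  by rewrite mxE ffunE -(eqP (forallP xs k)) eqxx (gx _ _ xs Xs k kX) mulr1n.
move=> f /familyP fP; apply/ffunP => X; rewrite ffunE.
have := fP X; case: ifP => Xs; last by rewrite inE => /eqP ->.
move=> _; case/imsetP: Xs => y _ ->; case: pickP => [k ky|/(_ y)]; last by rewrite porbit_id.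
by rewrite ffunE; congr (f _); apply/eqP; rewrite eq_porbit_mem.
Qed.

Lemma unitary_diag (U : 'M[C]_N) : U \is unitarymx ->
  exists u : 'rV[C]_N, exists V : 'M[C]_N, [/\ V \is unitarymx,
    forall i, `|u 0 i| = 1 & U = invmx V *m diag_mx u *m V].
Proof.
move=> uU.
have nU : U \is normalmx.
  apply/normalmxP; rewrite (unitarymxP uU).
  by rewrite -(invmx_unitary uU) mulVmx ?unitarymx_unit.
have /orthomx_spectralP UE := nU; set V := spectralmx U in UE.
have uV : V \is unitarymx by exact: spectral_unitarymx.
exists (spectral_diag U), V; split=> // i; set u := spectral_diag U in UE *.
have uD : diag_mx u \is unitarymx.
  have -> : diag_mx u = V *m U *m V ^t*.
    rewrite UE !mulmxA mulmxV ?unitarymx_unit // mul1mx -(invmx_unitary uV).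
    by rewrite -mulmxA mulmxV ?unitarymx_unit // mulmx1.
  by rewrite !mul_unitarymx ?trmxC_unitary.
have /unitarymxP/matrixP/(_ i i) := uD.
rewrite mxE (bigD1 i) //= big1 => [|j ji]; last by rewrite !mxE eq_sym (negbTE ji) mul0r.
rewrite !mxE eqxx !mulr1n addr0 -normCK => /eqP.
by rewrite sqrp_eq1 ?normr_ge0 // => /eqP.
Qed.

Lemma cycle_trace_conj (V A : 'M[C]_N) s : V \in unitmx ->
  cycle_trace (invmx V *m A *m V) s = cycle_trace A s.
Proof. by move=> uV; apply: eq_bigr => X _; rewrite exp_conj // tr_conj. Qed.

Lemma tens_unit (V : 'M[C]_N) : V \in unitmx -> tens V \in unitmx.
Proof.
move=> uV; have := mulmxV uV => /(congr1 tens); rewrite tensM tens1.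
by case/mulmx1_unit.
Qed.

Lemma tens_conj (V A : 'M[C]_N) : V \in unitmx ->
  tens (invmx V *m A *m V) = invmx (tens V) *m tens A *m tens V.
Proof.
move=> uV; rewrite !tensM; congr (_ *m _ *m _).
have uT := tens_unit uV; rewrite -[LHS]mul1mx -(mulVmx uT) -mulmxA -tensM.
by rewrite mulmxV // tens1 mulmx1.
Qed.

Lemma tr_tens_rho (U : 'M[C]_N) s : (0 < N)%N -> U \is unitarymx ->
  \tr (tens U *m rho s) = cycle_trace U s.
Proof.
move=> N0 /unitary_diag[u [V [/unitarymx_unit uV _ ->]]].
rewrite cycle_trace_conj // -tr_tens_rho_diag // tens_conj //.
rewrite -(mulmxA _ (tens V)) -rho_tens mulmxA -(mulmxA (invmx _)).
by rewrite tr_conj ?tens_unit.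
Qed.

Lemma cycle_traceV U s : cycle_trace U s^-1%g = cycle_trace U s.
Proof. by rewrite /cycle_trace porbitsV. Qed.

Lemma tens_dtens (U X Y : 'M[C]_N) : U *m X = Y *m U ->
  tens U *m dtens X = dtens Y *m tens U.
Proof.
move=> UX; rewrite /dtens mulmx_sumr mulmx_suml; apply: eq_bigr => k _.
rewrite /slot /tens !tenfM; apply: eq_tenf => l.
by case: eqP; rewrite ?UX ?mul1mx ?mulmx1.
Qed.

(** On two different tensor factors, the sum of E_ij (x) E_ji is the flip; on a single factor, the
    sum of E_ij E_ji is N. The pairs (k, l) are ordered, so each transposition occurs twice. *)
Lemma dtens_casimir :
  \sum_i \sum_j dtens (delta_mx i j) *m dtens (delta_mx j i) =
  (N * d)%:R%:M + \sum_k \sum_(l | l != k) rho (tperm k l).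
Proof.
have -> : \sum_i \sum_j dtens (delta_mx i j) *m dtens (delta_mx j i) =
    \sum_k \sum_l \sum_i \sum_j slot k (delta_mx i j) *m slot l (delta_mx j i).
  transitivity (\sum_i \sum_j \sum_k \sum_l slot k (delta_mx i j) *m slot l (delta_mx j i)).
    apply: eq_bigr => i _; apply: eq_bigr => j _.
    by rewrite /dtens mulmx_suml; apply: eq_bigr => k _; rewrite mulmx_sumr.
  under eq_bigr do rewrite exchange_big.
  rewrite exchange_big; apply: eq_bigr => k _ /=.
  under eq_bigr do rewrite exchange_big.
  by rewrite exchange_big.
have diag k : \sum_i \sum_j slot k (delta_mx i j) *m slot k (delta_mx j i) = N%:R%:M.
  rewrite exchange_big /=.
  have e j : \sum_i slot k (delta_mx i j) *m slot k (delta_mx j i) = 1%:M.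
    apply/wmxP => x y; rewrite went_sum went1 -(prod_delta C) [RHS](bigD1 k) //=.
    rewrite (eq_bigr (fun i => (delta_mx i i : 'M[C]_N) (x k) (y k) *
      \prod_(l | l != k) (1%:M : 'M[C]_N) (x l) (y l))); last first.
      by move=> i _; rewrite -slotM mul_delta_mx slotE.
    rewrite -mulr_suml; congr (_ * _); rewrite -summxE -mx1_sum_delta.
    by [].
  by rewrite (eq_bigr (fun=> 1%:M)) // sumr_const card_ord -scaler_nat scalemx1.
have off k l : l != k -> \sum_i \sum_j slot k (delta_mx i j) *m slot l (delta_mx j i)
    = rho (tperm k l).
  move=> lk; apply/wmxP => x y; rewrite went_sum rhoE.
  under eq_bigr do rewrite went_sum.
  have e i j : went (slot k (delta_mx i j) *m slot l (delta_mx j i)) x y =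
    (delta_mx i j : 'M[C]_N) (x k) (y k) * (delta_mx j i : 'M[C]_N) (x l) (y l) *
    \prod_(n | (n != k) && (n != l)) (1%:M : 'M[C]_N) (x n) (y n).
    rewrite /slot tenfM tenfE (bigD1 k) //= eqxx eq_sym (negbTE lk) mulmx1.
    rewrite (bigD1 l) //= eqxx (negbTE lk) mul1mx mulrA; congr (_ * _).
    by apply: eq_bigr => n /andP[/negbTE -> /negbTE ->]; rewrite mulmx1.
  under eq_bigr do under eq_bigr do rewrite e.
  rewrite -prod_delta [RHS](bigD1 k) //= [in RHS](bigD1 l) //= !ffunE tpermL tpermR mulrA.
  have -> : \prod_(n | (n != k) && (n != l)) (1%:M : 'M[C]_N) (x n) ([ffun n => y (tperm k l n)] n) =
      \prod_(n | (n != k) && (n != l)) (1%:M : 'M[C]_N) (x n) (y n).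
    by apply: eq_bigr => n /andP[nk nl]; rewrite ffunE tpermD // eq_sym.
  under eq_bigr do rewrite -mulr_suml.
  rewrite -mulr_suml; congr (_ * _).
  rewrite (bigD1 (x k)) //= (bigD1 (y k)) //= !big1 ?addr0.
  - rewrite !mxE !eqxx mul1r; case: (x l == y k); rewrite ?mulr0 ?mulr1 //=.
    by rewrite eq_sym.
  - by move=> i ik; apply: big1 => j _; rewrite mxE eq_sym (negbTE ik) mul0r.
  - by move=> j jk; rewrite mxE [y k == j]eq_sym (negbTE jk) andbF mul0r.
have -> : (N * d)%:R%:M = \sum_(k < d) (N%:R%:M : 'M[C]_#|{: word}|).
  by rewrite sumr_const card_ord -[N%:R%:M *+ d]scaler_nat scale_scalar_mx -natrM mulnC.
rewrite -big_split /=; apply: eq_bigr => k _.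
by rewrite (bigD1 k) //= diag; congr (_ + _); apply: eq_bigr => l lk; rewrite off.
Qed.

End TensorTraces.

Local Close Scope sesquilinear_scope.

(** * Newton: symmetric functions of the eigenvalues *)

Section HomogeneousFunctions.
Variables (C : numClosedFieldType) (N : nat).

Definition homogeneous n (f : 'M[C]_N -> C) : Prop :=
  exists s : seq (C * seq ('I_N * 'I_N)), all (fun cl => size cl.2 == n) s /\
    forall U, f U = \sum_(cl <- s) cl.1 * \prod_(p <- cl.2) U p.1 p.2.

Lemma homogeneous0 n : homogeneous n (fun=> 0).
Proof. by exists [::]; split=> // U; rewrite big_nil. Qed.

Lemma homogeneousD n a f g : homogeneous n f -> homogeneous n g ->
  homogeneous n (fun U => a * f U + g U).
Proof.
move=> [s [ss fs]] [r [sr gr]].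
exists ([seq (a * cl.1, cl.2) | cl <- s] ++ r); rewrite all_cat all_map ss sr.
split=> // U; rewrite big_cat big_map fs gr mulr_sumr; congr (_ + _).
by apply: eq_bigr => cl _; rewrite mulrA.
Qed.

Lemma homogeneous_sum n (I : Type) (r : seq I) (f : I -> 'M[C]_N -> C) :
  (forall i, homogeneous n (f i)) -> homogeneous n (fun U => \sum_(i <- r) f i U).
Proof.
move=> hf; elim: r => [|i r IH].
  by under eq_fun do rewrite big_nil; exact: homogeneous0.
under eq_fun do rewrite big_cons -[f i _]mul1r.
exact: homogeneousD.
Qed.

Lemma homogeneousM m n f g : homogeneous m f -> homogeneous n g ->
  homogeneous (m + n) (fun U => f U * g U).
Proof.
move=> [s [ss fs]] [r [sr gr]].
exists [seq (x.1 * y.1, x.2 ++ y.2) | x <- s, y <- r]; split.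
  apply/allP => _ /allpairsP[[x y] /= [xs yr ->]] /=.
  by rewrite size_cat (eqP (allP ss _ xs)) (eqP (allP sr _ yr)).
move=> U; rewrite fs gr big_allpairs_dep mulr_suml; apply: eq_bigr => x _.
rewrite mulr_sumr; apply: eq_bigr => y _ /=; rewrite big_cat /=; ring.
Qed.

Lemma homogeneous_const a : homogeneous 0 (fun=> a).
Proof.
by exists [:: (a, [::])]; split=> // U; rewrite big_seq1 big_nil mulr1.
Qed.

Lemma homogeneous_exp k i j : homogeneous k (fun U => (U ^+ k) i j).
Proof.
elim: k i j => [|k IH] i j.
  under eq_fun do rewrite expr0; exact: homogeneous_const.
have h l : homogeneous 1 (fun U => U i l).
  by exists [:: (1, [:: (i, l)])]; split=> // U; rewrite !big_seq1 mul1r.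
have -> : (fun U : 'M[C]_N => (U ^+ k.+1) i j) = (fun U => \sum_l U i l * (U ^+ k) l j).
  by apply/funext => U; rewrite exprS mxE.
by apply: homogeneous_sum => l; exact: (@homogeneousM 1).
Qed.

Lemma homogeneous_trace k : homogeneous k (fun U => \tr (U ^+ k)).
Proof. by apply: homogeneous_sum => i; exact: homogeneous_exp. Qed.

(** A monomial of degree d in the entries of [U] is one entry of its d-th tensor power, at the words
    of row and column indices. *)
Lemma homogeneous_tens d f : homogeneous d f ->
  exists Phi : 'M[C]_#|{: word d N}|, forall U, f U = \tr (Phi *m tens d U).
Proof.
move=> [s [ss fs]]; elim: s f ss fs => [|[c l] s IH] f /= ss fs.
  by exists 0 => U; rewrite fs big_nil mul0mx mxtrace0.
case/andP: ss => /eqP sl ss.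
have [Phi hPhi] := IH _ ss (fun=> erefl).
pose t : d.-tuple ('I_N * 'I_N) := tcast sl (in_tuple l).
pose x : word d N := [ffun k => (tnth t k).1].
pose y : word d N := [ffun k => (tnth t k).2].
exists (c *: delta_mx (enum_rank y) (enum_rank x) + Phi) => U.
rewrite fs big_cons hPhi mulmxDl mxtraceD -scalemxAl mxtraceZ; congr (c * _ + _).
have -> : \tr (delta_mx (enum_rank y) (enum_rank x) *m tens d U) = went (tens d U) x y.
  rewrite /mxtrace (bigD1 (enum_rank y)) //= big1 => [|i iy].
    rewrite addr0 mxE (bigD1 (enum_rank x)) //= big1 => [|j jx].
      by rewrite addr0 [X in X * _]mxE !eqxx mul1r.
    by rewrite mxE (negbTE jx) andbF mul0r.
  by rewrite mxE big1 // => j _; rewrite mxE (negbTE iy) mul0r.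
rewrite tenfE; have -> : l = tval t by rewrite val_tcast.
rewrite big_tuple.
by apply: eq_bigr => k _; rewrite !ffunE.
Qed.

(** [ms] lists exponent vectors with repetition; for the weights of a representation this is its
    character on the torus. *)
Definition monomial_sum (ms : seq (seq nat)) (u : 'rV[C]_N) : C :=
  \sum_(L <- ms) \prod_i u 0 i ^+ nth 0%N L i.

(* Newton: a symmetric polynomial in the eigenvalues is a polynomial in power
   sums, hence in the entries of the matrix. *)
Lemma symmetric_eigenvalue_function d (ms : seq (seq nat)) :
    all (fun L => (size L == N) && (sumn L == d)) ms ->
  exists Phi : 'M[C]_#|{: word d N}|, forall (u : 'rV[C]_N) V, V \in unitmx ->
    (forall s : 'S_N, monomial_sum ms (col_perm s u) = monomial_sum ms u) ->
    monomial_sum ms u = \tr (Phi *m tens d (invmx V *m diag_mx u *m V)).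
Proof.
move=> hms.
pose io (i : 'I_N) (a : nat) (u : 'rV[C]_N) : C := u 0 i ^+ a.
(* The functions of the eigenvalues that come from a homogeneous function of degree [n] in the
   matrix, whatever the diagonalizing [V]. *)
pose A n (g : 'rV[C]_N -> C) := exists2 f, homogeneous n f &
  forall u V, V \in unitmx -> g u = f (invmx V *m diag_mx u *m V).
have Aplace L : A (sumn L) (place io L (enum 'I_N)).
  rewrite -[L in sumn L]map_id; apply: (@place_closed _ _ _ addn io) => //.
  - by move=> i a b; apply/funext => u; rewrite /io exprD.
  - by move=> i j a b _; apply/funext => u; rewrite /= mulrC.
  - by exists (fun=> 1); [exact: homogeneous_const |].
  - by move=> n; exists (fun=> 0); [exact: homogeneous0 |].
  - move=> n x y [f hf fx] [g hg gy]; exists (fun U => -1 * g U + f U).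
      exact: homogeneousD.
    by move=> u V uV; rewrite mulN1r addrC -fx // -gy.
  - move=> m n x y [f hf fx] [g hg gy]; exists (fun U => f U * g U).
      exact: homogeneousM.
    by move=> u V uV; rewrite -fx // -gy.
  - move=> a; exists (fun U => \tr (U ^+ a)); first exact: homogeneous_trace.
    move=> u V uV; rewrite exp_conj // tr_conj // diag_exp mxtrace_diag fct_sumE.
    by rewrite big_enum; apply: eq_bigr => i _; rewrite mxE.
  - exact: enum_uniq.
(* Placing the N exponents injectively on the N indices means summing over the N! orders of the
   variables; by symmetry at [u] each order contributes [monomial_sum ms u]. *)
pose c := (size (permutations (enum 'I_N)))%:R : C.
have c0 : c != 0.
  by rewrite pnatr_eq0 size_permutations ?enum_uniq // -lt0n fact_gt0.
have [f hf fE] : A d (fun u => \sum_(L <- ms) place io L (enum 'I_N) u).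
  elim: ms hms => [_|L ms IH] /=.
    by exists (fun=> 0) => [|u V _]; [exact: homogeneous0 | rewrite big_nil].
  case/andP => /andP[_ /eqP sL] /IH[f hf fE].
  have := Aplace L; rewrite sL => -[g hg gE].
  exists (fun U => 1 * g U + f U); first exact: homogeneousD.
  by move=> u V uV; rewrite big_cons mul1r (gE _ V) // (fE _ V).
have [Phi hPhi] := homogeneous_tens hf.
exists (c^-1 *: Phi) => u V uV sym.
rewrite -scalemxAl mxtraceZ -hPhi -fE //.
suff -> : \sum_(L <- ms) place io L (enum 'I_N) u = c * monomial_sum ms u.
  by rewrite mulrA mulVf ?mul1r.
transitivity (\sum_(t <- permutations (enum 'I_N)) \sum_(L <- ms) \prod_(z <- zip L t) u 0 z.2 ^+ z.1).
  rewrite exchange_big /=; apply: eq_big_seq => L Lms.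
  have /andP[/eqP sL _] := allP hms _ Lms.
  rewrite place_perms ?enum_uniq ?size_enum_ord // fct_sumE.
  by apply: eq_bigr => t _; rewrite fct_prodE.
rewrite (eq_big_seq (fun=> monomial_sum ms u)) /= => [|t].
  by rewrite big_const_seq count_predT iter_addr_0 /c mulr_natl.
rewrite mem_permutations => pt.
have /tuple_permP[s ts] : perm_eq t (ord_tuple N) by rewrite val_ord_tuple.
rewrite -(sym s); apply: eq_big_seq => L Lms.
have /andP[/eqP sL _] := allP hms _ Lms.
have tE : t = [seq s k | k <- enum 'I_N].
  by rewrite ts /=; apply: eq_map => k; rewrite tnth_ord_tuple.
have LE : L = [seq nth 0%N L k | k : 'I_N <- enum 'I_N].
  transitivity [seq nth 0%N L i | i <- map val (enum 'I_N)]; last by rewrite -map_comp.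
  by rewrite val_enum_ord -sL -/(mkseq _ _) mkseq_nth.
rewrite tE {1}LE; have zm (r : seq 'I_N) : \prod_(z <- zip [seq nth 0%N L k | k : 'I_N <- r]
    [seq s k | k <- r]) u 0 z.2 ^+ z.1 = \prod_(k <- r) u 0 (s k) ^+ nth 0%N L k.
  by elim: r => [|k r IH] /=; rewrite ?big_nil // !big_cons IH.
by rewrite zm big_enum; apply: eq_bigr => k _; rewrite mxE.
Qed.

End HomogeneousFunctions.

(** As d <= N there is a word with distinct letters, and its rearrangements by different
    permutations are different basis vectors. *)
Lemma rho_free (C : numClosedFieldType) d N (a : 'S_d -> C) : (d <= N)%N ->
  \sum_s a s *: rho C N s = 0 -> forall s, a s = 0.
Proof.
move=> dN a0 t; pose x : word d N := [ffun k => widen_ord dN k].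
have := congr1 (fun A => went A [ffun k => x (t k)] x) a0.
rewrite went_sum (bigD1 t) //= big1 => [|s st].
  by rewrite wentZ rhoE eqxx mulr1 addr0 /went mxE.
rewrite wentZ rhoE; case: eqP => [e|_]; last by rewrite mulr0.
case/eqP: st; apply/permP => k; have := congr1 (fun w : word d N => w k) e.
by rewrite !ffunE => /(congr1 val) /= /val_inj.
Qed.

(** * Transfer of traces between commuting algebras *)

Section IdempotentTrace.
Variable F : fieldType.

Lemma idempotent_factor n (A : 'M[F]_n) : A *m A = A ->
  exists K : 'M_(n, \rank A), exists L : 'M_(\rank A, n), A = K *m L /\ L *m K = 1%:M.
Proof.
move=> AA; have := mulmx_base A; have := row_base_free A; have := col_base_full A.
move: (col_base A) (row_base A); move: (\rank A) => r K L /row_fullP[K' KK].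
move=> /row_freeP[L' LL] AE; exists K, L; split=> //.
have := congr1 (fun X => K' *m X *m L') AA; rewrite /= -AE !mulmxA KK !mul1mx.
by rewrite -!(mulmxA _ L L') LL !mulmx1.
Qed.

Lemma idempotent_trace n (A : 'M[F]_n) : A *m A = A -> \tr A = (\rank A)%:R.
Proof.
move=> /idempotent_factor[K [L [AE LK]]].
by rewrite {1}AE mxtrace_mulC LK mxtrace1.
Qed.

(* psi sends a rank one idempotent to a rank one idempotent. *)
Lemma trace_matrix_morphism r n (psi : 'M[F]_r -> 'M[F]_n) :
    (0 < n)%N -> (forall a A B, psi (a *: A + B) = a *: psi A + psi B) ->
    (forall A B, psi (A *m B) = psi A *m psi B) -> psi 1%:M = 1%:M ->
    (forall X, exists A, psi A = X) -> forall A, \tr (psi A) = \tr A.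
Proof.
move=> n0 lin mul one surj.
have nz : (1%:M : 'M[F]_n) != 0 by rewrite -mxrank_eq0 mxrank1 -lt0n.
have psi0 : psi 0 = 0.
  have := lin (-1) 0 0; rewrite scaler0 addr0 => {1}->; by rewrite scaleN1r addNr.
have psiZ a A : psi (a *: A) = a *: psi A by rewrite -[a *: A]addr0 lin psi0 addr0.
have psiD A B : psi (A + B) = psi A + psi B by rewrite -[A]scale1r lin !scale1r.
have psi_sum (I : Type) (s : seq I) (f : I -> 'M_r) :
    psi (\sum_(i <- s) f i) = \sum_(i <- s) psi (f i).
  by elim: s => [|i s IH]; rewrite ?big_nil // !big_cons psiD IH.
have r0 : (0 < r)%N.
  case: (posnP r) => // r0; have /eqP := one; subst r.
  by rewrite (flatmx0 1%:M) psi0 eq_sym (negbTE nz).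
pose i0 := Ordinal r0; pose q := psi (delta_mx i0 i0).
have dq : q *m q = q by rewrite /q -mul mul_delta_mx.
have q0 : q != 0.
  apply/eqP => q0; have /eqP := one; rewrite mx1_sum_delta psi_sum big1.
    by rewrite eq_sym (negbTE nz).
  move=> i _; have -> : delta_mx i i = delta_mx i i0 *m (delta_mx i0 i0 *m delta_mx i0 i) :> 'M[F]_r.
    by rewrite !mul_delta_mx.
  by rewrite !mul -/q q0 mul0mx mulmx0.
have tq : \tr q = 1.
  have [K [L [qE LK]]] := idempotent_factor dq.
  move Ec: (\rank q) K L qE LK => c K L qE LK.
  (* By surjectivity every matrix on the image of [q] is of the form [q (psi A) q], and this is a
     multiple of [q] because [delta_mx i0 i0] has rank one. An image all of whose endomorphisms are
     scalar has dimension at most 1. *)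
  have scal (Y : 'M[F]_c) : exists l, Y = l%:M.
    have [A AE] := surj (K *m Y *m L).
    exists (A i0 i0); have e : q *m psi A *m q = A i0 i0 *: q.
      rewrite /q -!mul -psiZ; congr psi; apply/matrixP => i j.
      rewrite !mxE (bigD1 i0) //= big1 => [|k kj]; last by rewrite !mxE (negbTE kj) mulr0.
      rewrite addr0 !mxE (bigD1 i0) //= big1 => [|k kj]; last by rewrite !mxE (negbTE kj) andbF mul0r.
      by rewrite addr0 !mxE eqxx andbT; case: (i == i0); case: (j == i0); rewrite ?(mul0r, mulr0, mul1r, mulr1).
    transitivity (L *m (q *m psi A *m q) *m K).
      rewrite AE qE; transitivity ((L *m K) *m (L *m K) *m Y *m (L *m K) *m (L *m K)).
        by rewrite LK !mul1mx !mulmx1.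
      by rewrite !mulmxA.
    rewrite e -scalemxAr -scalemxAl qE.
    transitivity (A i0 i0 *: ((L *m K) *m (L *m K))); first by rewrite !mulmxA.
    by rewrite LK mulmx1 scalemx1.
  rewrite idempotent_trace //; suff -> : \rank q = 1%N by [].
  apply/eqP; rewrite eqn_leq lt0n mxrank_eq0 q0 andbT leqNgt Ec; apply/negP => q1.
  pose k0 := Ordinal (ltnW q1); pose k1 := Ordinal q1.
  have [l /matrixP/(_ k0 k1)] := scal (delta_mx k0 k1).
  by rewrite !mxE !eqxx /= => /eqP; rewrite oner_eq0.
have tdelta i j : \tr (psi (delta_mx i j)) = (i == j)%:R.
  have -> : delta_mx i j = delta_mx i i0 *m delta_mx i0 j :> 'M[F]_r by rewrite mul_delta_mx.
  rewrite mul mxtrace_mulC -mul mul_delta_mx_cond.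
  by case: (eqVneq i j) => _; rewrite ?mulr1n // mulr0n psi0 mxtrace0.
move=> A; rewrite {1}[A]matrix_sum_delta psi_sum raddf_sum; apply: eq_bigr => i _ /=.
rewrite psi_sum raddf_sum (bigD1 i) //= big1 => [|j ji]; rewrite psiZ mxtraceZ tdelta.
  by rewrite eqxx mulr1 addr0.
by rewrite eq_sym (negbTE ji) mulr0.
Qed.

End IdempotentTrace.

Section TraceTransfer.
Variables (F : fieldType) (m n r : nat) (a0 : 'I_r).
Variables (eps : 'I_r -> 'I_r -> 'M[F]_m) (Com : 'M[F]_m -> Prop) (w : 'M[F]_m -> 'M[F]_n).
Hypothesis epsM : forall a b c e, eps a b *m eps c e = if b == c then eps a e else 0.
Local Notation E := (\sum_a eps a a).
Let Phi T := \sum_a eps a a0 *m T *m eps a0 a.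
Hypothesis ComPhi : forall T, Com (Phi T).
Hypothesis ComE : forall B a b, Com B -> B *m eps a b = eps a b *m B.
Hypothesis wlin : forall a A B, w (a *: A + B) = a *: w A + w B.
Hypothesis wM : forall A B, Com A -> Com B -> w (A *m B) = w A *m w B.
Hypothesis wE : w E = 1%:M.
Hypothesis wsurj : forall X, exists2 B, Com B & w B = X.
Hypothesis n_gt0 : (0 < n)%N.

(** [Phi] copies an operator on the image of the corner [P = eps a0 a0] along the diagonal, and so
    identifies the full matrix algebra of that image with [Com] cut by [E]. Followed by [w] this is
    a unital surjection of matrix algebras, which preserves traces, while [tr (B E)] is r times
    [tr (B P)]. *)
Lemma trace_transfer B : Com B -> \tr (B *m E) = r%:R * \tr (w B).
Proof.
pose P := eps a0 a0.
have PP : P *m P = P by rewrite /P epsM eqxx.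
have [K [L]] := idempotent_factor PP; move: (\rank P) K L => c K L [PE LK].
pose Psi M := Phi (K *m M *m L).
have epsP a : eps a a0 = eps a a0 *m K *m L by rewrite -mulmxA -PE /P epsM eqxx.
have Peps a : eps a0 a = K *m (L *m eps a0 a) by rewrite mulmxA -PE /P epsM eqxx.
have PsiE T : Phi T = Psi (L *m T *m K).
  apply: eq_bigr => a _; rewrite {1}epsP {1}Peps !mulmxA; congr (_ *m _).
have PhiM S T : Phi S *m Phi T = Phi (S *m P *m T).
  rewrite /Phi mulmx_suml; apply: eq_bigr => a _.
  rewrite mulmx_sumr (bigD1 a) //= big1 => [|b ba].
    by rewrite addr0 !mulmxA -(mulmxA _ (eps a0 a)) epsM eqxx.
  by rewrite !mulmxA -(mulmxA _ (eps a0 a)) epsM eq_sym (negbTE ba) mulmx0 !mul0mx.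
have Phi1 : Phi 1%:M = E.
  by apply: eq_bigr => a _; rewrite mulmx1 epsM eqxx.
have PhiB A : Com A -> Phi A = A *m E.
  move=> cA; rewrite /Phi mulmx_sumr; apply: eq_bigr => a _.
  by rewrite -ComE // -mulmxA epsM eqxx.
have LKL M : L *m (K *m M *m L) *m K = M.
  by rewrite !mulmxA LK mul1mx -mulmxA LK mulmx1.
have trw M : \tr (w (Psi M)) = \tr M.
  apply: (trace_matrix_morphism (psi := fun M => w (Psi M))) => //.
  - move=> a S T; rewrite -wlin; congr w; rewrite /Psi /Phi scaler_sumr -big_split /=.
    by apply: eq_bigr => b _; rewrite !(mulmxDr, mulmxDl, =^~ scalemxAr, =^~ scalemxAl).
  - move=> S T; rewrite -wM; [|exact: ComPhi..].
    rewrite /Psi PhiM; congr w; congr Phi.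
    transitivity (K *m S *m (L *m K) *m (L *m K) *m T *m L); last by rewrite PE !mulmxA.
    by rewrite LK !mulmx1 !mulmxA.
  - by rewrite -wE; congr w; rewrite -Phi1 (PsiE 1%:M) mulmx1 LK.
  - move=> X; have [D cD <-] := wsurj X; exists (L *m D *m K).
    rewrite -PsiE PhiB // wM //; last by rewrite -Phi1.
    by rewrite wE mulmx1.
move=> cB; have -> : w B = w (Psi (L *m B *m K)).
  rewrite -PsiE PhiB // wM //; last by rewrite -Phi1.
  by rewrite wE mulmx1.
rewrite trw [in RHS]mxtrace_mulC [in RHS]mulmxA -PE [in RHS]mxtrace_mulC.
rewrite mulmx_sumr raddf_sum /= (eq_bigr (fun=> \tr (B *m P))) => [|a _].
  by rewrite sumr_const card_ord mulr_natl.
have -> : eps a a = eps a a0 *m eps a0 a by rewrite epsM eqxx.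
by rewrite mulmxA mxtrace_mulC ComE // mulmxA epsM eqxx -ComE.
Qed.

End TraceTransfer.

(** * Blocks of a group algebra *)

Section WedderburnBlocks.
Variables (F : numClosedFieldType) (gT : finGroupType) (G : {group gT}).
Variable sG : irrType F G.
Local Notation aG := (regular_repr F G).
Local Notation R_G := (group_ring F G).
Local Notation n_ := (@irr_degree F gT G sG).
Local Notation e_ := (@Wedderburn_id F gT G sG).
Local Notation R_ := (@Wedderburn_subring F gT G sG).

Lemma num_pchar_group : ([pchar F]^').-group%g G.
Proof. by rewrite /pgroup pcharf'_nat pnatr_eq0 -lt0n cardG_gt0. Qed.
Let F'G := num_pchar_group.
Let splitG : group_splitting_field F G := @group_closure_closed_field F gT G.

Lemma block_sub i A : (A \in R_ i)%MS -> (A \in R_G)%MS.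
Proof. by move=> RA; rewrite -(Wedderburn_sum_pchar sG F'G) (sumsmx_sup i). Qed.

Lemma block_id_mem i : (e_ i \in R_G)%MS.
Proof. exact: (block_sub (Wedderburn_id_mem i)). Qed.

Lemma block_idealr i A B : (A \in R_ i)%MS -> (B \in R_G)%MS -> (A *m B \in R_ i)%MS.
Proof. by move=> RA RB; case/andP: (Wedderburn_ideal i) => _ /mulsmx_subP; apply. Qed.

Lemma block_ideall i A B : (A \in R_G)%MS -> (B \in R_ i)%MS -> (A *m B \in R_ i)%MS.
Proof. by move=> RA RB; case/andP: (Wedderburn_ideal i) => /mulsmx_subP + _; apply. Qed.

Lemma block_idM i j : e_ i *m e_ j = if i == j then e_ i else 0.
Proof.
case: eqVneq => [<-|ij]; last by rewrite (Wedderburn_mulmx0 ij) ?Wedderburn_id_mem.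
by have [_ Re _ idr] := Wedderburn_is_id_pchar F'G i; rewrite idr.
Qed.

Lemma block_id_central i A : (A \in R_G)%MS -> e_ i *m A = A *m e_ i.
Proof.
move=> RA; rewrite -[A in LHS]mulmx1 -[A in RHS]mul1mx.
rewrite -(Wedderburn_sum_id_pchar sG F'G) mulmx_sumr mulmx_suml mulmx_sumr mulmx_suml.
rewrite (bigD1 i) //= [RHS](bigD1 i) //= !big1 ?addr0 ?mulmxA // => [j ji|j ji].
- by rewrite (@Wedderburn_mulmx0 _ _ _ _ j i) ?block_idealr ?Wedderburn_id_mem.
- by rewrite (@Wedderburn_mulmx0 _ _ _ _ i j) 1?eq_sym ?block_ideall ?Wedderburn_id_mem.
Qed.

Lemma block_central_scalar i A : (A \in R_G)%MS ->
  (forall x, x \in G -> A *m aG x = aG x *m A) -> exists w, A *m e_ i = w *: e_ i.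
Proof.
move=> RA cA; have Z : (A *m e_ i \in 'Z(R_ i))%MS.
  rewrite sub_capmx block_ideall ?Wedderburn_id_mem //=.
  apply/cent_mxP => B RB; have [_ _ idl idr] := Wedderburn_is_id_pchar F'G i.
  rewrite -mulmxA idl // mulmxA.
  have -> : B *m A = A *m B.
    have /envelop_mxP[b ->] := block_sub RB; rewrite mulmx_suml mulmx_sumr.
    by apply: eq_bigr => x Gx; rewrite -scalemxAl -scalemxAr cA.
  by rewrite -mulmxA idr.
move: Z; rewrite (Wedderburn_subring_center_pchar F'G splitG).
by case/sub_rVP => w e; exists w; apply: (can_inj mxvecK); rewrite linearZ.
Qed.

(** Elementary matrices are pulled back through the irreducible representation of the block, which
    is injective on the block and onto all matrices because [F] is a splitting field. *)
Lemma block_matrix_units i : exists eps : 'I_(n_ i) -> 'I_(n_ i) -> 'M_#|G|,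
  [/\ forall a b, (eps a b \in R_G)%MS, \sum_a eps a a = e_ i,
      forall a b c e, eps a b *m eps c e = if b == c then eps a e else 0
    & forall A, (A \in R_G)%MS ->
        exists X : 'M_(n_ i), A *m e_ i = \sum_b \sum_c X b c *: eps b c].
Proof.
pose rG := irr_repr i; have irrG : mx_irreducible rG by exact: socle_irr.
have iE : irr_comp sG rG = i by exact: irr_reprK_pchar F'G i.
have inj := regular_op_inj_pchar F'G irrG (sG := sG); rewrite iE in inj.
have surj (X : 'M_(n_ i)) : exists A, (A \in R_ i)%MS && (gring_op rG A == X).
  have := irr_comp_envelop_pchar sG F'G irrG; rewrite iE => imE.
  have /andP[_ fE] := splitG irrG.
  have : (mxvec X <= R_ i *m lin_mx (gring_op rG))%MS by rewrite imE submx_full.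
  case/submxP => D XE; exists (vec_mx (D *m R_ i)).
  rewrite vec_mxK submxMl /=; apply/eqP/(can_inj mxvecK).
  by rewrite XE mulmxA mul_rV_lin.
pose eps a b := xchoose (surj (delta_mx a b)).
have epsP a b : (eps a b \in R_ i)%MS /\ gring_op rG (eps a b) = delta_mx a b.
  by have /andP[? /eqP ?] := xchooseP (surj (delta_mx a b)).
exists eps; split=> [a b||a b c e|A RA]; first exact: (block_sub (epsP a b).1).
  apply: inj => /=; rewrite ?inE.
  - by rewrite linear_sum summx_sub // => a _; exact: (epsP a a).1.
  - exact: Wedderburn_id_mem.
  rewrite op_Wedderburn_id_pchar // linear_sum mx1_sum_delta.
  by apply: eq_bigr => a _; rewrite /= (epsP a a).2.
apply: inj => /=; rewrite ?inE.
- by rewrite block_idealr ?(epsP a b).1 // (block_sub (epsP c e).1).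
- by case: eqP => _; rewrite ?(epsP a e).1 // linear0 sub0mx.
  rewrite gring_opM ?(block_sub (epsP c e).1) // !(epsP _ _).2 mul_delta_mx_cond.
  by case: eqP => _; rewrite ?(epsP a e).2 ?mulr1n // mulr0n linear0.
exists (gring_op rG A); apply: inj => /=; rewrite ?inE.
- by rewrite block_ideall ?Wedderburn_id_mem.
- rewrite linear_sum summx_sub // => b _; rewrite linear_sum summx_sub // => c _.
  by rewrite linearZ scalemx_sub // (epsP b c).1.
rewrite gring_opM ?block_id_mem // op_Wedderburn_id_pchar // mulmx1 linear_sum.
rewrite [LHS]matrix_sum_delta; apply: eq_bigr => b _; rewrite linear_sum.
by apply: eq_bigr => c _; rewrite linearZ /= (epsP b c).2.
Qed.

Definition identity_coef (A : 'M[F]_#|G|) : F := gring_row A 0 (gring_index G 1%g).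

Lemma identity_coefP a A B :
  identity_coef (a *: A + B) = a * identity_coef A + identity_coef B.
Proof. by rewrite /identity_coef linearP !mxE. Qed.

Lemma identity_coefG x : x \in G -> identity_coef (aG x) = (x == 1%g)%:R.
Proof.
move=> Gx; rewrite /identity_coef !mxE gring_indexK // mul1g eqxx /=.
congr (nat_of_bool _)%:R; apply/eqP/eqP => [e|->//].
by have := congr1 enum_val e; rewrite !gring_indexK // => ->.
Qed.

Lemma trace_identity_coef A : (A \in R_G)%MS -> \tr A = #|G|%:R * identity_coef A.
Proof.
case/envelop_mxP => a ->; rewrite raddf_sum /identity_coef linear_sum summxE mulr_sumr.
apply: eq_bigr => x Gx; rewrite /= mxtraceZ linearZ [in RHS]mxE -/(identity_coef _) identity_coefG //.
rewrite mulrCA; congr (_ * _); rewrite /mxtrace.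
transitivity (\sum_(k < #|G|) (x == 1%g)%:R : F); last first.
  by rewrite sumr_const card_ord mulr_natl.
apply: eq_bigr => k _; rewrite !mxE eqxx /=; congr (nat_of_bool _)%:R.
have Gk := enum_valP k.
apply/eqP/eqP => [e|->]; last by rewrite mulg1 gring_valK.
apply: (mulgI (enum_val k)); have := congr1 enum_val e.
by rewrite mulg1 gring_indexK ?groupM // => <-.
Qed.

(** In the regular representation [e_ i] is an idempotent whose image is the block, of dimension
    n_i^2; its trace is |G| times its coefficient at 1. *)
Lemma block_id_coef i : #|G|%:R * identity_coef (e_ i) = (n_ i ^ 2)%:R.
Proof.
rewrite -trace_identity_coef ?block_id_mem //.
have ee := block_idM i i; rewrite eqxx in ee.
rewrite idempotent_trace // -(rank_Wedderburn_subring_pchar F'G splitG).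
rewrite genmxE mxrankMfree ?gring_free //; congr (_%:R); apply/eqmx_rank.
have [_ _ idl idr] := Wedderburn_is_id_pchar F'G i.
apply/andP; split; last first.
  apply/row_subP => k; set v := row k _.
  have Rv : (gring_mx aG v \in R_ i)%MS by rewrite genmxE mem_gring_mx row_sub.
  have := congr1 (@gring_row F gT G) (idr _ Rv); rewrite gring_row_mul gring_mxK => <-.
  exact: submxMl.
apply/row_subP => k; rewrite rowE -mem_gring_mx -(genmxE (i *m _)).
have -> : gring_mx aG (delta_mx 0 k *m e_ i) = gring_mx aG (delta_mx 0 k) *m e_ i.
  by rewrite -{2}(gring_rowK (block_id_mem i)) -gring_mxA gring_rowK ?block_id_mem.
by rewrite block_ideall ?gring_mxP ?Wedderburn_id_mem.
Qed.

End WedderburnBlocks.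

(** * Jucys-Murphy elements *)

Section MonotoneSums.
Variables (E : pzSemiRingType) (d : nat) (J : 'I_d -> E).

(** This is h_s of the variables J_k, ..., J_(d-1), each monomial written in increasing order of its
    indices. *)
Definition monotone_sum (k s : nat) : E :=
  \sum_(t : s.-tuple 'I_d | sorted leq (map val t) && all (fun i : 'I_d => (k <= i)%N) t)
    \prod_(i <- t) J i.

Lemma monotone_sum_deg0 k : monotone_sum k 0 = 1.
Proof.
rewrite /monotone_sum (bigD1 [tuple]) //= big_nil big1 ?addr0 // => t /andP[_].
by rewrite tuple0 => /eqP/(_ erefl).
Qed.

Lemma monotone_sum_none s : monotone_sum d s.+1 = 0.
Proof.
rewrite /monotone_sum big1 // => t /andP[_]; case/tupleP: t => i t /= /andP[].
by rewrite leqNgt ltn_ord.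
Qed.

Lemma monotone_sum_rec (k : 'I_d) s :
  monotone_sum k s.+1 = J k * monotone_sum k s + monotone_sum k.+1 s.+1.
Proof.
rewrite /monotone_sum (bigID (fun t : s.+1.-tuple 'I_d => thead t == k)) /=; congr (_ + _).
  rewrite mulr_sumr (reindex_onto (fun u : s.-tuple 'I_d => cons_tuple k u)
    (fun t => behead_tuple t)) /=; last first.
    by move=> t /andP[_ /eqP <-]; rewrite [RHS]tuple_eta; apply: val_inj.
  apply: eq_big => [u|u _]; last by rewrite big_cons.
  rewrite theadE eqxx leqnn /= andbT.
  have -> : behead_tuple (cons_tuple k u) == u by apply/eqP/val_inj.
  rewrite andbT; case: (boolP (all _ u)) => [ku|_]; rewrite ?andbF //= !andbT.
  by rewrite path_min_sorted // all_map.
apply: eq_bigl => t; case/tupleP: t => i t /=; rewrite theadE.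
case: (ltngtP k i) => [ki|ki|/val_inj <-] /=; rewrite ?andbF ?andbT //=; last first.
  by rewrite eqxx andbF.
have -> : i != k by apply: contraTneq ki => ->; rewrite ltnn.
rewrite andbT; case: (boolP (path leq i (map val t))) => //= pt.
have /allP ti : all (leq i) (map val t) by apply: order_path_min pt; exact: leq_trans.
have kt l : l \in tval t -> (k < l)%N.
  by move=> lt; apply: leq_trans ki (ti _ _); exact: map_f.
by apply/idP/idP => _; apply/allP => l /kt //; exact: ltnW.
Qed.

End MonotoneSums.

Section SymmetricGroupAlgebra.
Variables (C : numClosedFieldType) (d : nat).
Local Notation G := [set: 'S_d]%G.
Local Notation pelt := (regular_repr C G).

Definition jm (j : 'I_d) : 'M[C]_#|G| := \sum_(i < d | (i < j)%N) pelt (tperm i j).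

Lemma peltM (s t : 'S_d) : pelt (s * t)%g = pelt s * pelt t.
Proof. by rewrite repr_mxM ?inE. Qed.

Lemma ringmxZl n a (A B : 'M[C]_n) : (a *: A) * B = a *: (A * B).
Proof. exact: esym (scalemxAl _ _ _). Qed.

Lemma ringmxZr n a (A B : 'M[C]_n) : A * (a *: B) = a *: (A * B).
Proof. exact: esym (scalemxAr _ _ _). Qed.

Lemma pelt1 : pelt 1%g = 1. Proof. exact: repr_mx1. Qed.

(* Row sums bound the group algebra coefficients submultiplicatively. *)
Definition row_bound (A : 'M[C]_#|G|) (c : C) := forall i, \sum_j `|A i j| <= c.

Lemma row_bound_pelt s : row_bound (pelt s) 1.
Proof.
move=> i; rewrite (bigD1 (gring_index G (enum_val i * s)%g)) //= big1 => [|j].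
  by rewrite addr0 !mxE !eqxx normr1.
by rewrite !mxE => /negbTE ->; rewrite normr0.
Qed.

Lemma row_boundM A B a b : row_bound A a -> row_bound B b -> row_bound (A * B) (a * b).
Proof.
move=> hA hB i; apply: (@le_trans _ _ (\sum_j \sum_k `|A i k| * `|B k j|)).
  apply: ler_sum => j _; rewrite mxE (le_trans (ler_norm_sum _ _ _)) // ler_sum // => k _.
  by rewrite normrM.
have b0 : 0 <= b by apply: le_trans (hB i); rewrite sumr_ge0.
rewrite exchange_big /= (le_trans _ (ler_wpM2r b0 (hA i))) //.
by rewrite mulr_suml ler_sum // => k _; rewrite -mulr_sumr ler_wpM2l.
Qed.

Lemma row_bound_sum (I : Type) (r : seq I) (P : pred I) (F : I -> 'M_#|G|) (c : I -> C) :
  (forall i, P i -> row_bound (F i) (c i)) ->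
  row_bound (\sum_(i <- r | P i) F i) (\sum_(i <- r | P i) c i).
Proof.
move=> hF k; elim: r => [|i r IH].
  by rewrite !big_nil big1 // => j _; rewrite mxE normr0.
rewrite !big_cons; case: ifP => // Pi.
apply: le_trans (lerD (hF i Pi k) IH); rewrite -big_split /= ler_sum // => j _.
by rewrite mxE ler_normD.
Qed.

Lemma row_bound_ex A : exists2 c, 0 <= c & row_bound A c.
Proof.
exists (\sum_i \sum_j `|A i j|); first by do 2 (apply: sumr_ge0 => ? _).
by move=> i; rewrite [X in _ <= X](bigD1 i) //= lerDl; do 2 (apply: sumr_ge0 => ? _).
Qed.

Lemma row_bound1 : row_bound 1 1.
Proof. by rewrite -pelt1; exact: row_bound_pelt. Qed.

Lemma row_boundX A a r : row_bound A a -> row_bound (A ^+ r) (a ^+ r).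
Proof.
move=> hA; elim: r => [|r IH]; first by rewrite !expr0; exact: row_bound1.
by rewrite !exprS; exact: row_boundM.
Qed.

Lemma row_bound_gset (X : {set 'S_d}) : row_bound (gset_mx C G X) #|X|%:R.
Proof.
by rewrite -sum1_card natr_sum; apply: row_bound_sum => s _; exact: row_bound_pelt.
Qed.

Lemma row_bound_jm j : row_bound (jm j) j%:R.
Proof.
have e : (j : nat) = (\sum_(i < d | (i < j)%N) 1)%N.
  by rewrite -(big_ord_widen d (fun=> 1%N)) ?sum1_card ?card_ord // ltnW.
rewrite [X in row_bound _ X%:R]e natr_sum; apply: row_bound_sum => i _.
exact: row_bound_pelt.
Qed.

Lemma row_bound_monotone_sum k s :
  row_bound (monotone_sum jm k s) (monotone_sum (fun j : 'I_d => j%:R) k s).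
Proof.
apply: row_bound_sum => t _; elim: (tval t) => [|i u IH].
  by rewrite !big_nil; exact: row_bound1.
by rewrite !big_cons; apply: row_boundM => //; exact: row_bound_jm.
Qed.

Lemma row_bound_coef A a : row_bound A a -> `|identity_coef A| <= a.
Proof.
move=> hA; rewrite /identity_coef mxE; set i := gring_index _ _.
by apply: le_trans (hA i); rewrite (bigD1 i) //= lerDl sumr_ge0.
Qed.

Lemma identity_coef_pelt s : identity_coef (pelt s) = (s == 1%g)%:R.
Proof. by rewrite identity_coefG ?inE. Qed.

Lemma identity_coefZ a (A : 'M[C]_#|G|) : identity_coef (a *: A) = a * identity_coef A.
Proof. by rewrite /identity_coef linearZ mxE. Qed.

Lemma identity_coef_sum (I : Type) (r : seq I) (P : pred I) (F : I -> 'M[C]_#|G|) :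
  identity_coef (\sum_(i <- r | P i) F i) = \sum_(i <- r | P i) identity_coef (F i).
Proof. by rewrite /identity_coef linear_sum summxE. Qed.

(* prod_(k <= j < k + m) (1 - y J_j), largest j first. *)
Fixpoint jm_prod (y : C) (k m : nat) : 'M[C]_#|G| :=
  if m is m'.+1 then
    jm_prod y k.+1 m' * (1 - y *: (if insub k is Some j then jm j else 0))
  else 1.

Definition trunc_gen (y : C) (k n : nat) := \sum_(s < n) y ^+ s *: monotone_sum jm k s.

(** The identity (1 - y J_k) H_k = H_(k+1) of generating series, together with the boundary term
    that truncation leaves. *)
Lemma trunc_gen_rec y (k : 'I_d) n :
  (1 - y *: jm k) * trunc_gen y k n.+1 =
  trunc_gen y k.+1 n.+1 - y ^+ n.+1 *: (jm k * monotone_sum jm k n).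
Proof.
have e : trunc_gen y k n.+1 = y *: (jm k * trunc_gen y k n) + trunc_gen y k.+1 n.+1.
  rewrite /trunc_gen big_ord_recl [in RHS]big_ord_recl /= !monotone_sum_deg0 addrCA; congr (_ + _).
  rewrite mulr_sumr scaler_sumr -big_split /=; apply: eq_bigr => s _.
  by rewrite monotone_sum_rec scalerDr exprS -scalerA ringmxZr.
rewrite mulrBl mul1r {1}e addrAC !ringmxZl -scalerBr -mulrBr.
rewrite {2}/trunc_gen big_ord_recr /= opprD addrA subrr sub0r mulrN ringmxZr scalerN.
by rewrite scalerA -exprS addrC.
Qed.

Definition fixes_from (k : nat) (s : 'S_d) := [forall j : 'I_d, (k <= j)%N ==> (s j == j)].

Lemma fixes_fromP k (s : 'S_d) :
  reflect (forall j : 'I_d, (k <= j)%N -> s j = j) (fixes_from k s).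
Proof.
apply: (iffP forallP) => h j; first by move=> kj; have := h j; rewrite kj => /eqP.
by apply/implyP => kj; rewrite h.
Qed.

(** The points from [k] on are fixed but still count as cycles, so the sum is x^d at k = 0; at k = d
    and x = N it is F(1). *)
Definition cycle_weight (x : C) (k : nat) : 'M[C]_#|G| :=
  \sum_(s | fixes_from k s) x ^+ #|porbits s| *: pelt s.

Lemma cycle_weight0 x : cycle_weight x 0 = x ^+ d *: 1%:M.
Proof.
rewrite /cycle_weight (bigD1 1%g) /=; last by apply/fixes_fromP => j _; rewrite perm1.
rewrite big1 => [|s /andP[/fixes_fromP h /eqP[]]]; last first.
  by apply/permP => j; rewrite perm1 h.
rewrite addr0 pelt1; congr (x ^+ _ *: _).
have -> : porbits (1%g : 'S_d) = [set [set i] | i : 'I_d].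
  by apply: eq_imset => i; apply/setP => j; rewrite inE; apply/porbitP/eqP => [[k ->]|->];
    [rewrite expg1n perm1 | exists 0%N; rewrite perm1].
by rewrite card_imset ?card_ord //; exact: set1_inj.
Qed.

(* Jucys: multiplying by (i k), i < k, a permutation that fixes k and all
   larger points merges two cycles. *)
Lemma cycle_weight_rec x (k : 'I_d) : x != 0 ->
  cycle_weight x k.+1 = (1 + x^-1 *: jm k) * cycle_weight x k.
Proof.
move=> x0; pose c (i : 'I_d) : C := if i == k then 1 else x^-1.
have -> : 1 + x^-1 *: jm k = \sum_(i < d | (i <= k)%N) c i *: pelt (tperm i k).
  rewrite [RHS](bigD1 k) //= /c eqxx scale1r tperm1 pelt1 /jm scaler_sumr; congr (_ + _).
  apply: eq_big => [i|i ik]; first by rewrite ltn_neqAle andbC.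
  by rewrite -val_eqE /= ltn_eqF.
rewrite mulr_suml /cycle_weight.
(* A permutation fixing all points beyond k is in a unique way [(i k)] times one that also fixes k,
   with [i] the preimage of k. *)
rewrite (partition_big (fun s : 'S_d => (s^-1)%g k) (fun i : 'I_d => (i <= k)%N)) /=; last first.
  move=> s /fixes_fromP h; rewrite leqNgt; apply/negP => kl.
  have := h _ kl; rewrite permKV => e; by rewrite -e ltnn in kl.
apply: eq_bigr => i ik; rewrite mulr_sumr (reindex_inj (mulgI (tperm i k))) /=.
apply: eq_big => [s|s].
  rewrite invMg permM tpermV.
  apply/andP/fixes_fromP => [[/fixes_fromP h /eqP e] j|h].
    rewrite leq_eqVlt => /predU1P[/val_inj <-|kj].
      have : (s^-1)%g k = k by rewrite -[LHS](tpermK i k) e tpermL.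
      by move=> e'; rewrite -{1}e' permKV.
    have := h j kj; rewrite permM tpermD //.
      by apply: contraTneq kj => <-; rewrite -leqNgt.
    by apply: contraTneq kj => <-; rewrite ltnn.
  have sk : s k = k by exact: h.
  split; last by rewrite (_ : (s^-1)%g k = k) ?tpermR // -{1}sk permK.
  apply/fixes_fromP => j kj; rewrite permM tpermD ?h //; first exact: ltnW.
    by apply: contraTneq kj => <-; rewrite -leqNgt.
  by apply: contraTneq kj => <-; rewrite ltnn.
case/andP => /fixes_fromP h /eqP e.
have sk : s k = k.
  have : (s^-1)%g k = k.
    by move: e; rewrite invMg permM tpermV => /(congr1 (tperm i k)); rewrite tpermK tpermL.
  by move=> e'; rewrite -{1}e' permKV.
rewrite peltM ringmxZl ringmxZr scalerA; congr (_ *: _).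
have := porbits_mul_tperm s i k; rewrite /c.
have [->|ik'] := eqVneq i k; first by rewrite tperm1 mul1g mul1r.
have -> : i \notin porbit s k.
  apply/porbitP => -[m im]; case/eqP: ik'; rewrite im.
  by elim: m {im} => [|m IH]; rewrite ?perm1 // expgS permM sk.
rewrite /= addn2 addn1 => -[<-].
by rewrite exprS mulrA mulVf // mul1r.
Qed.

End SymmetricGroupAlgebra.

(** * Blocks acting on the tensor power *)

(** Primeness of the matrix algebra, tested on elementary matrices. *)
Lemma mulmx_delta_eq0 (F : fieldType) n (A B : 'M[F]_n) :
  (forall X, A *m X *m B = 0) -> A = 0 \/ B = 0.
Proof.
move=> h; case: (eqVneq A 0) => [|A0]; [by left | right].
have /matrix0Pn[a [b Aab]] := A0.
apply/matrixP => c e; have := congr1 (fun M : 'M_n => M a e) (h (delta_mx b c)).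
rewrite -(mul_delta_mx (0 : 'I_1)) mulmxA -colE -mulmxA -rowE [in RHS]mxE mxE big_ord1 !mxE.
by move/eqP; rewrite mulf_eq0 (negbTE Aab) => /eqP.
Qed.

Lemma linear_map0 (R : nzRingType) (U V : lmodType R) (f : U -> V) :
  (forall a x y, f (a *: x + y) = a *: f x + f y) -> f 0 = 0.
Proof.
by move=> fl; apply: (addrI (f 0)); have := fl 1 0 0; rewrite !scale1r !addr0 => <-.
Qed.

Section SchurWeyl.
Variables (C : numClosedFieldType) (d N : nat).
Hypothesis dN : (d <= N)%N.
Local Notation m := #|{: word d N}|.
Local Notation G := [set: 'S_d]%G.
Local Notation pelt := (regular_repr C G).
Local Notation R_G := (group_ring C G).
Local Notation rho := (@rho C d N).
Local Notation tens := (@tens C d N).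
Local Notation Com := (@commutant C d N).

Lemma rho_is_repr : mx_repr G rho.
Proof. by split=> [|s t _ _]; [exact: rho1 | exact: rhoM]. Qed.
Definition rho_repr := MxRepresentation rho_is_repr.
Local Notation op := (gring_op rho_repr).

Lemma op_pelt s : op (pelt s) = rho s.
Proof. by rewrite gring_opG ?inE. Qed.

Lemma op_inj A : (A \in R_G)%MS -> op A = 0 -> A = 0.
Proof.
case/envelop_mxP => a -> e; rewrite big1 // => s _.
suff -> : a s = 0 by rewrite scale0r.
apply: (@rho_free C d N a dN _ s); rewrite -[RHS]e linear_sum /=.
by apply: eq_big => [t|t _]; rewrite ?inE // linearZ /= op_pelt.
Qed.

Lemma op_commutant A B : (A \in R_G)%MS -> Com B -> B *m op A = op A *m B.
Proof.
case/envelop_mxP => a -> cB; rewrite linear_sum mulmx_suml mulmx_sumr.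
by apply: eq_bigr => s _; rewrite linearZ /= op_pelt -scalemxAl -scalemxAr cB.
Qed.

Lemma commutantM A B : Com A -> Com B -> Com (A *m B).
Proof. by move=> cA cB s; rewrite -mulmxA cB mulmxA cA mulmxA. Qed.

Lemma commutant_tens U : Com (tens U).
Proof. by move=> s; rewrite rho_tens. Qed.

Lemma commutant_sum (I : Type) (r : seq I) (P : pred I) (F : I -> 'M_m) :
  (forall i, P i -> Com (F i)) -> Com (\sum_(i <- r | P i) F i).
Proof.
by move=> cF s; rewrite mulmx_suml mulmx_sumr; apply: eq_bigr => i /cF; apply.
Qed.

Variable sG : irrType C G.
Local Notation n_ := (@irr_degree C _ G sG).
Local Notation e_ := (@Wedderburn_id C _ G sG).
Let F'G := num_pchar_group C G.

Definition block_op (i : sG) : 'M_m := op (e_ i).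
Local Notation E := block_op.

Lemma block_opM i j : E i *m E j = if i == j then E i else 0.
Proof. by rewrite /E -gring_opM ?block_id_mem // block_idM; case: eqP => _; rewrite ?linear0. Qed.

Lemma sum_block_op : \sum_i E i = 1%:M.
Proof.
have h := Wedderburn_sum_id_pchar sG F'G; have := congr1 op h.
by rewrite linear_sum /= gring_op1.
Qed.

Lemma block_op_neq0 i : E i != 0.
Proof.
have [h _ _ _] := Wedderburn_is_id_pchar F'G i.
by apply: contraNneq h => e; rewrite (op_inj (block_id_mem i) e).
Qed.

Lemma block_op_commutant i : Com (E i).
Proof.
move=> s; rewrite -op_pelt /E -!gring_opM ?block_id_mem ?envelop_mx_id ?inE //.
by rewrite block_id_central // envelop_mx_id ?inE.
Qed.

Lemma tr_block_op i : \tr (E i) != 0.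
Proof.
have h := block_opM i i; rewrite eqxx in h.
by rewrite idempotent_trace // pnatr_eq0 mxrank_eq0 block_op_neq0.
Qed.

Lemma central_block i A : (A \in R_G)%MS -> (forall s, A *m pelt s = pelt s *m A) ->
  exists w, A *m e_ i = w *: e_ i.
Proof. by move=> RA cA; apply: (block_central_scalar i RA) => s _. Qed.

(** [w] is linear on all of End X, but only its restriction to the commutant is a representation.
    Surjectivity encodes irreducibility, by Burnside's theorem. *)
Definition commutant_rep n (w : 'M[C]_m -> 'M[C]_n) : Prop :=
  [/\ forall a A B, w (a *: A + B) = a *: w A + w B,
      forall A B, Com A -> Com B -> w (A *m B) = w A *m w B,
      w 1%:M = 1%:M & forall X, exists2 B, Com B & w B = X].

(** Both sides are linear in [B] and the tensor powers of unitary matrices span the commutant.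
    Applied once in each factor, this extends multiplicativity from the group to the commutant. *)
Lemma linear_subspace n (w : 'M[C]_m -> 'M[C]_n) (f : 'M[C]_n -> 'M[C]_n) (g : 'M[C]_m -> 'M[C]_m) :
  (forall a A B, w (a *: A + B) = a *: w A + w B) ->
  (forall a A B, f (a *: A + B) = a *: f A + f B) ->
  (forall a A B, g (a *: A + B) = a *: g A + g B) ->
  (forall U, U \is unitarymx -> w (g (tens U)) = f (w (tens U))) ->
  forall B, Com B -> w (g B) = f (w B).
Proof.
move=> wl fl gl h B /commutant_unitary_span [s [/allP sU ->]].
have w0 := linear_map0 wl; have f0 := linear_map0 fl; have g0 := linear_map0 gl.
elim: s sU => [|p s IH] sU; first by rewrite big_nil g0 w0 f0.
rewrite big_cons gl !wl fl h ?sU ?mem_head // IH // => q qs.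
by rewrite sU // inE qs orbT.
Qed.

Lemma unitary_commutant_repM n (w : 'M[C]_m -> 'M[C]_n) :
  (forall a A B, w (a *: A + B) = a *: w A + w B) ->
  (forall U V, U \is unitarymx -> V \is unitarymx ->
    w (tens (U *m V)) = w (tens U) *m w (tens V)) ->
  forall A B, Com A -> Com B -> w (A *m B) = w A *m w B.
Proof.
move=> wl wU A B cA cB.
apply: (@linear_subspace n w (fun X => X *m w B) (fun X => X *m B) wl _ _ _ A cA).
- by move=> a X Y; rewrite mulmxDl scalemxAl.
- by move=> a X Y; rewrite mulmxDl scalemxAl.
move=> U UU; apply: (@linear_subspace n w (fun X => w (tens U) *m X) (fun X => tens U *m X) wl _ _ _ B cB).
- by move=> a X Y; rewrite mulmxDr scalemxAr.
- by move=> a X Y; rewrite mulmxDr scalemxAr.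
by move=> V UV; rewrite -tensM wU.
Qed.

Section OneRep.
Variables (n : nat) (w : 'M[C]_m -> 'M[C]_n).
Hypotheses (n_gt0 : (0 < n)%N) (wrep : commutant_rep w).

Lemma rep_linear a A B : w (a *: A + B) = a *: w A + w B. Proof. by case: wrep. Qed.
Lemma rep_mul A B : Com A -> Com B -> w (A *m B) = w A *m w B.
Proof. by case: wrep => _ h _ _; apply: h. Qed.
Lemma rep_1 : w 1%:M = 1%:M. Proof. by case: wrep. Qed.
Lemma rep_surj X : exists2 B, Com B & w B = X. Proof. by case: wrep. Qed.

Lemma rep_0 : w 0 = 0.
Proof. exact: linear_map0 rep_linear. Qed.

Lemma rep_Z a A : w (a *: A) = a *: w A.
Proof. by have := rep_linear a A 0; rewrite rep_0 !addr0. Qed.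

Lemma rep_D A B : w (A + B) = w A + w B.
Proof. by have := rep_linear 1 A B; rewrite !scale1r. Qed.

Lemma rep_sum (I : Type) (r : seq I) (P : pred I) (F : I -> 'M_m) :
  w (\sum_(i <- r | P i) F i) = \sum_(i <- r | P i) w (F i).
Proof. by apply: (big_morph w rep_D rep_0). Qed.

(** The [w (E i)] sum to 1, so one of them is nonzero; it is a central idempotent of a full matrix
    algebra, hence 1 by primeness. *)
Lemma rep_block : exists i : sG, w (E i) = 1%:M.
Proof.
have w1 : w 1%:M != 0 by rewrite rep_1 -mxrank_eq0 mxrank1 -lt0n.
have [i wi] : exists i : sG, w (E i) != 0.
  apply/existsP; apply: contraNT w1 => /existsPn h; rewrite -sum_block_op rep_sum.
  by rewrite big1 // => i _; apply/eqP; have := h i; rewrite negbK.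
exists i; suff [/eqP|/eqP] : 1%:M - w (E i) = 0 \/ w (E i) = 0.
- by rewrite subr_eq0 => /eqP.
- by rewrite (negbTE wi).
apply: mulmx_delta_eq0 => X; have [B cB <-] := rep_surj X.
have cE := block_op_commutant i; have ee := block_opM i i; rewrite eqxx in ee.
rewrite -mulmxA -rep_mul // op_commutant ?block_id_mem // rep_mul // mulmxA.
by rewrite mulmxBl mul1mx -rep_mul // ee subrr mul0mx.
Qed.

Lemma rep_trace (i : sG) B : w (E i) = 1%:M -> Com B ->
  \tr (B *m E i) = (n_ i)%:R * \tr (w B).
Proof.
move=> wE cB; have [eps [epsR epsE epsM epsX]] := block_matrix_units i.
have EE : E i = \sum_a op (eps a a) by rewrite /E /block_op -epsE linear_sum.
have a0 : 'I_(n_ i) by exists 0%N; exact: irr_degree_gt0.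
rewrite EE; apply: (@trace_transfer C m n _ a0 (fun a b => op (eps a b)) Com w) => //.
- by move=> a b c e; rewrite -gring_opM // epsM; case: eqP; rewrite ?linear0.
(* Left and right multiplication by [s] act on the matrix units of the block through the same matrix
   [X], so the averaged operator commutes with [rho s]. *)
- move=> T s; have RS : (pelt s \in R_G)%MS by rewrite envelop_mx_id ?inE.
  have [X hX] := epsX _ RS.
  have eE a b : e_ i *m eps a b = eps a b.
    rewrite -epsE mulmx_suml (bigD1 a) //= epsM eqxx big1 ?addr0 // => c ca.
    by rewrite epsM (negbTE ca).
  have Ee a b : eps a b *m e_ i = eps a b.
    rewrite -epsE mulmx_sumr (bigD1 b) //= epsM eqxx big1 ?addr0 // => c cb.
    by rewrite epsM eq_sym (negbTE cb).
  have sl a b : pelt s *m eps a b = \sum_c X c a *: eps c b.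
    rewrite -[in LHS]eE mulmxA hX mulmx_suml; apply: eq_bigr => c _.
    rewrite mulmx_suml (bigD1 a) //= big1 => [|e ea].
      by rewrite addr0 -scalemxAl epsM eqxx.
    by rewrite -scalemxAl epsM (negbTE ea) scaler0.
  have sr a b : eps a b *m pelt s = \sum_c X b c *: eps a c.
    rewrite -[in LHS]Ee -mulmxA block_id_central // hX mulmx_sumr (bigD1 b) //= [X in _ + X]big1 => [|c cb].
      by rewrite addr0 mulmx_sumr; apply: eq_bigr => c _; rewrite -scalemxAr epsM eqxx.
    rewrite mulmx_sumr big1 // => e _.
    by rewrite -scalemxAr epsM eq_sym (negbTE cb) scaler0.
  rewrite mulmx_suml mulmx_sumr -op_pelt.
  transitivity (\sum_a \sum_c X a c *: (op (eps a a0) *m T *m op (eps a0 c))).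
    apply: eq_bigr => a _; rewrite -[LHS]mulmxA -gring_opM // sr linear_sum mulmx_sumr.
    by apply: eq_bigr => c _; rewrite linearZ /= -scalemxAr.
  rewrite exchange_big /=; apply: eq_bigr => a _; rewrite !mulmxA -gring_opM // sl linear_sum !mulmx_suml.
  by apply: eq_bigr => c _; rewrite linearZ /= -!scalemxAl.
- by move=> B' a b cB'; rewrite op_commutant.
- exact: rep_linear.
- exact: rep_mul.
- by rewrite -EE.
- exact: rep_surj.
Qed.

End OneRep.

(** By [rep_trace] both representations have the same trace on the commutant, and the trace form of
    a matrix algebra is nondegenerate. *)
Lemma rep_kernel n n' (w : 'M[C]_m -> 'M[C]_n) (w' : 'M[C]_m -> 'M[C]_n') (i : sG) B :
    (0 < n)%N -> (0 < n')%N -> commutant_rep w -> commutant_rep w' ->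
    w (E i) = 1%:M -> w' (E i) = 1%:M -> Com B -> w B = 0 -> w' B = 0.
Proof.
move=> n0 n0' wr wr' wE wE' cB wB.
have tr0 X : \tr (w' B *m X) = 0.
  have [B' cB' <-] := rep_surj wr' X; rewrite -(rep_mul wr') //.
  have cBB : Com (B *m B') by exact: commutantM.
  have := rep_trace n0' wr' wE' cBB; rewrite (rep_trace n0 wr wE cBB) (rep_mul wr) //.
  rewrite wB mul0mx mxtrace0 mulr0 => /esym/eqP; rewrite mulf_eq0 pnatr_eq0.
  by rewrite eqn0Ngt irr_degree_gt0 => /eqP.
apply/matrixP => a b; rewrite mxE -[RHS](tr0 (delta_mx b a)) -(mul_delta_mx (0 : 'I_1)).
by rewrite mulmxA mxtrace_mulC -colE -rowE trace_mx11 !mxE.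
Qed.

End SchurWeyl.

(** * The central elements F(U) on the blocks *)

Section PowerElements.
Variables (C : numClosedFieldType) (d N : nat).
Hypotheses (N_gt0 : (0 < N)%N) (dN : (d <= N)%N).
Local Notation m := #|{: word d N}|.
Local Notation G := [set: 'S_d]%G.
Local Notation pelt := (regular_repr C G).
Local Notation R_G := (group_ring C G).
Local Notation rho := (@rho C d N).
Local Notation tens := (@tens C d N).
Local Notation dtens := (@dtens C d N).
Local Notation Com := (@commutant C d N).
Local Notation op := (gring_op (rho_repr C d N)).
Variable sG : irrType C G.
Local Notation n_ := (@irr_degree C _ G sG).
Local Notation e_ := (@Wedderburn_id C _ G sG).
Local Notation E := (@block_op C d N sG).

Lemma gring_sum (I : Type) (r : seq I) (P : pred I) (F : I -> 'M_#|G|) :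
  (forall i, P i -> (F i \in R_G)%MS) -> (\sum_(i <- r | P i) F i \in R_G)%MS.
Proof. by move=> h; rewrite linear_sum summx_sub. Qed.

Lemma gring_pelt s : (pelt s \in R_G)%MS.
Proof. by rewrite envelop_mx_id ?inE. Qed.

Lemma gring_scale a A : (A \in R_G)%MS -> (a *: A \in R_G)%MS.
Proof. by move=> h; rewrite linearZ scalemx_sub. Qed.

Definition power_elt (U : 'M[C]_N) : 'M[C]_#|G| := \sum_s cycle_trace U s *: pelt s.

Lemma power_elt_gring U : (power_elt U \in R_G)%MS.
Proof. by apply: gring_sum => s _; apply: gring_scale; exact: gring_pelt. Qed.

Lemma tr_tens_op U A : U \is unitarymx -> (A \in R_G)%MS ->
  \tr (tens U *m op A) = identity_coef (A *m power_elt U).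
Proof.
move=> UU /envelop_mxP[a ->]; rewrite linear_sum mulmx_sumr raddf_sum mulmx_suml identity_coef_sum.
apply: eq_big => [s|s _]; first by rewrite inE.
rewrite linearZ /= op_pelt -scalemxAr mxtraceZ -scalemxAl identity_coefZ; congr (_ * _).
rewrite tr_tens_rho // /power_elt mulmx_sumr identity_coef_sum (bigD1 s^-1%g) //= big1 => [|t ts].
  by rewrite addr0 -scalemxAr identity_coefZ -repr_mxM ?inE // mulgV identity_coef_pelt eqxx mulr1 cycle_traceV.
rewrite -scalemxAr identity_coefZ -repr_mxM ?inE // identity_coef_pelt.
by rewrite -eq_invg_mul eq_sym (negbTE ts) mulr0.
Qed.

Lemma power_elt_central U s : U \is unitarymx -> power_elt U *m pelt s = pelt s *m power_elt U.
Proof.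
move=> UU; rewrite mulmx_suml mulmx_sumr (reindex_inj (conjg_inj s^-1%g)) /=.
apply: eq_bigr => t _; rewrite -scalemxAl -scalemxAr -!repr_mxM ?inE //.
congr (_ *: pelt _); last by rewrite conjgE invgK -!mulgA mulVg mulg1.
rewrite -!tr_tens_rho // conjgE invgK !rhoM !mulmxA -rho_tens -!mulmxA mxtrace_mulC.
by rewrite -!mulmxA -rhoM mulVg rho1 mulmx1.
Qed.

Lemma block_coef_neq0 i : identity_coef (e_ i) != 0.
Proof.
have := block_id_coef i; apply: contra_eq_neq => ->.
by rewrite mulr0 eq_sym pnatr_eq0 expn_eq0 negb_and -lt0n irr_degree_gt0.
Qed.

(** The scalar by which F(U) acts on block [i]. *)
Definition power_weight (U : 'M[C]_N) (i : sG) : C := \tr (tens U *m E i) / identity_coef (e_ i).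

Lemma power_elt_block U i : U \is unitarymx -> power_elt U *m e_ i = power_weight U i *: e_ i.
Proof.
move=> UU; have [w we] := central_block i (power_elt_gring U) (fun s => power_elt_central s UU).
rewrite we; congr (_ *: _); rewrite /power_weight tr_tens_op ?block_id_mem //.
rewrite block_id_central ?power_elt_gring // we identity_coefZ mulfK //.
exact: block_coef_neq0.
Qed.

Lemma power_weight1_neq0 i : power_weight 1%:M i != 0.
Proof. by rewrite mulf_neq0 ?invr_eq0 ?block_coef_neq0 // tens1 mul1mx tr_block_op. Qed.

Lemma power_elt1 : power_elt 1%:M = cycle_weight d N%:R d.
Proof.
apply: eq_big => [s|s _]; first by apply/esym/fixes_fromP => j; rewrite leqNgt ltn_ord.
rewrite /cycle_trace; congr (_ *: _); rewrite (eq_bigr (fun=> N%:R)) => [|X _].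
  by rewrite prodr_const.
by rewrite expr1n mxtrace1.
Qed.

Lemma power_weight1_block i : e_ i *m cycle_weight d N%:R d = power_weight 1%:M i *: e_ i.
Proof.
rewrite -power_elt1 block_id_central ?power_elt_gring // power_elt_block //.
by apply/unitarymxP; rewrite mul1mx trmx1 map_mx1.
Qed.

Lemma power_elt3_block U1 U2 U3 i : U1 \is unitarymx -> U2 \is unitarymx -> U3 \is unitarymx ->
  identity_coef (power_elt U1 *m power_elt U2 *m power_elt U3 *m e_ i) =
  power_weight U1 i * power_weight U2 i * power_weight U3 i * identity_coef (e_ i).
Proof.
move=> h1 h2 h3; rewrite -!mulmxA power_elt_block // -!scalemxAr power_elt_block //.
rewrite -!scalemxAr power_elt_block // !scalerA identity_coefZ; congr (_ * _).
by ring.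
Qed.

End PowerElements.

(** * Weight spaces seen from the commutant *)

Section Weights.
Variables (C : numClosedFieldType) (d N : nat).
Local Notation word := (word d N).
Local Notation m := #|{: word}|.
Local Notation G := [set: 'S_d]%G.
Local Notation tens := (@tens C d N).
Local Notation dtens := (@dtens C d N).
Local Notation Com := (@commutant C d N).
Local Notation commutant_rep := (@commutant_rep C d N).

Definition weight_vector n (w : 'M[C]_m -> 'M[C]_n) (lam : 'I_N -> nat) (v : 'cV[C]_n) : Prop :=
  v != 0 /\ forall u : 'rV[C]_N, (forall i, `|u 0 i| = 1) ->
    w (tens (diag_mx u)) *m v = (\prod_i u 0 i ^+ lam i) *: v.

(** For |x| = 1 the matrix 1 + (x - 1) E_ii lies in the torus and acts on [v] by x^(lam i), so the
    interpolation formula gives the derivative of this power at 1; [lam i <= d] keeps the power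
    within its range. *)
Lemma dtens_weight n (w : 'M[C]_m -> 'M[C]_n) lam v i : commutant_rep w -> weight_vector w lam v ->
  (lam i <= d)%N -> w (dtens (delta_mx i i)) *m v = (lam i)%:R *: v.
Proof.
move=> wr [v0 vw] ld; have [s [/allP s1 sP]] := circle_deriv C d.
rewrite (dtens_proj _ sP) (rep_sum wr) mulmx_suml.
have := sP ('X^(lam i)); rewrite size_polyXn ltnS ld => /(_ isT).
rewrite derivXn hornerMn hornerXn expr1n => <-; rewrite scaler_suml.
apply: eq_big_seq => cx /s1/eqP x1; rewrite (rep_Z wr) hornerXn.
pose u : 'rV[C]_N := \row_j if j == i then cx.2 else 1.
have -> : 1%:M + (cx.2 - 1) *: delta_mx i i = diag_mx u.
  apply/matrixP => a b; rewrite !mxE; case: (eqVneq a b) => [<-|ab].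
    by rewrite andbb; case: eqP => _; rewrite ?mulr1 ?mulr0 ?addr0 // addrC subrK.
  rewrite mulr0n add0r; case: (eqVneq a i) => [ai|]; last by rewrite mulr0.
  by rewrite -ai eq_sym (negbTE ab) mulr0.
rewrite -scalemxAl vw => [|j]; last by rewrite mxE; case: ifP; rewrite ?normr1.
rewrite scalerA; congr (_ * _ *: _); rewrite (bigD1 i) //= mxE eqxx big1 ?mulr1 // => j ji.
by rewrite mxE (negbTE ji) expr1n.
Qed.

Definition content (x : word) (i : 'I_N) : nat := #|[pred k | x k == i]|.

Lemma content_le x i : (content x i < d.+1)%N.
Proof. by rewrite ltnS -[X in (_ <= X)%N](card_ord d) max_card. Qed.

Definition content_ffun (x : word) : {ffun 'I_N -> 'I_d.+1} := [ffun i => Ordinal (content_le x i)].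

(** The projection of X onto its weight space of weight [mu], spanned by the words in which the
    letter i occurs [mu i] times. *)
Definition content_proj (mu : {ffun 'I_N -> 'I_d.+1}) : 'M[C]_m :=
  wmx (fun x y => ((x == y) && (content_ffun x == mu))%:R).

Lemma content_proj_commutant mu : Com (content_proj mu).
Proof.
apply/commutantP => s x y; rewrite !wmxE; congr (nat_of_bool _)%:R; congr (_ && _).
  apply/eqP/eqP => [e|->//]; apply/ffunP => k; have := congr1 (fun f : word => f (s^-1 k)%g) e.
  by rewrite !ffunE permKV.
congr (_ == _); apply/ffunP => i; rewrite !ffunE; apply: val_inj => /=.
rewrite /content -!sum1_card (reindex_inj (@perm_inj _ s^-1%g)) /=.
by apply: eq_bigl => k; rewrite !inE ffunE permKV.
Qed.

Lemma sum_content_proj : \sum_mu content_proj mu = 1%:M.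
Proof.
apply/wmxP => x y; rewrite went_sum went1 (bigD1 (content_ffun x)) //= wmxE eqxx andbT big1 ?addr0 //.
by move=> mu h; rewrite wmxE [_ == mu]eq_sym (negbTE h) andbF.
Qed.

Lemma dtens_diagE i x y : went (dtens (delta_mx i i)) x y = (x == y)%:R * (content x i)%:R.
Proof.
rewrite /dtens went_sum; case: (eqVneq x y) => [<-|xy].
  rewrite mul1r /content -sum1_card natr_sum [RHS]big_mkcond /=; apply: eq_bigr => k _.
  rewrite slotE mxE big1 ?mulr1 => [|l _]; last by rewrite mxE eqxx.
  by rewrite andbb -[k \in _]/(x k == i); case: (x k == i).
rewrite mul0r big1 // => k _; rewrite slotE mxE.
have [l xl] : exists l, x l != y l.
  by apply/existsP; apply: contraNT xy => /existsPn h; apply/eqP/ffunP => l; apply/eqP; have := h l; rewrite negbK.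
case: (eqVneq l k) => [lk|lk].
  rewrite -lk; case: (eqVneq (x l) i) => [xi|]; rewrite ?mul0r //.
  by rewrite -xi eq_sym (negbTE xl) mul0r.
by rewrite (bigD1 l) //= mxE (negbTE xl) mul0r mulr0.
Qed.

Lemma dtens_content_proj i mu :
  dtens (delta_mx i i) *m content_proj mu = (mu i)%:R *: content_proj mu.
Proof.
apply/wmxP => x y; rewrite wentM wentZ wmxE (bigD1 x) //= big1 => [|z zx].
  rewrite addr0 dtens_diagE eqxx mul1r wmxE; case: (x == y); rewrite ?mulr0 //=.
  by case: eqP => [<-|_]; rewrite ?mulr0 // ffunE.
by rewrite dtens_diagE eq_sym (negbTE zx) !mul0r.
Qed.

Lemma tens_content_proj (u : 'rV[C]_N) mu :
  tens (diag_mx u) *m content_proj mu = (\prod_i u 0 i ^+ mu i) *: content_proj mu.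
Proof.
apply/wmxP => x y; rewrite wentM wentZ wmxE (bigD1 x) //= big1 => [|z zx].
  rewrite addr0 !wmxE; case: (x == y); rewrite ?mulr0 //=.
  case: eqP => [<-|_]; rewrite ?mulr0 // !mulr1.
  rewrite (partition_big x xpredT) //=; apply: eq_bigr => i _; rewrite ffunE /=.
  rewrite (eq_bigr (fun=> u 0 i)) => [|k /eqP <-]; last by rewrite mxE eqxx mulr1n.
  by rewrite prodr_const.
have [k zk] : exists k, x k != z k.
  by apply/existsP; apply: contraNT zx => /existsPn h; apply/eqP/ffunP => l; apply/eqP; have := h l; rewrite negbK eq_sym.
by rewrite (tenfE (fun=> diag_mx u)) (bigD1 k) //= mxE (negbTE zk) mulr0n !mul0r.
Qed.

(** The projections sum to 1, so one of them does not kill [v]; on the image of [v] the operator of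
    E_ii has eigenvalue [mu i] as well as [lam i]. *)
Lemma weight_content n (w : 'M[C]_m -> 'M[C]_n) lam v : commutant_rep w -> weight_vector w lam v ->
  (forall i, lam i <= d)%N ->
  exists2 mu : {ffun 'I_N -> 'I_d.+1}, (forall i, lam i = mu i) & w (content_proj mu) != 0.
Proof.
move=> wr vw ld; have [v0 _] := vw.
have [mu vmu] : exists mu, w (content_proj mu) *m v != 0.
  apply/existsP; apply: contraNT v0 => /existsPn h; apply/eqP.
  rewrite -[v]mul1mx -(rep_1 wr) -sum_content_proj (rep_sum wr) mulmx_suml big1 // => mu _.
  by apply/eqP; have := h mu; rewrite negbK.
exists mu => [i|]; last by apply: contraNneq vmu => ->; rewrite mul0mx.
have cD := dtens_commutant (delta_mx i i : 'M[C]_N) (d := d).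
have cP := content_proj_commutant mu.
have e : w (dtens (delta_mx i i)) *m w (content_proj mu) = w (content_proj mu) *m w (dtens (delta_mx i i)).
  rewrite -!(rep_mul wr) //; congr w; apply/wmxP => x y; rewrite !wentM.
  rewrite (bigD1 x) //= [RHS](bigD1 y) //= !big1 => [|z zy|z zx].
  - rewrite !addr0 !wmxE !dtens_diagE !eqxx !mul1r; case: (eqVneq x y) => [<-|]; last by rewrite mulr0 mul0r.
    by rewrite mulrC.
  - by rewrite dtens_diagE (negbTE zy) mul0r mulr0.
  - by rewrite dtens_diagE eq_sym (negbTE zx) !mul0r.
have := congr1 (mulmx^~ v) e; rewrite /= -(rep_mul wr) // dtens_content_proj (rep_Z wr).
rewrite -[in RHS]mulmxA (dtens_weight wr vw (ld i)) -scalemxAl -scalemxAr => /eqP.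
rewrite -subr_eq0 -scalerBl scaler_eq0 (negbTE vmu) orbF subr_eq0 eqr_nat => /eqP ->.
by [].
Qed.

(** A weight occurs when the representation does not kill [content_proj mu], an element of the
    commutant, and representations in one block have the same kernel there. *)
Lemma weight_transfer (sG : irrType C G) n n' (w : 'M[C]_m -> 'M[C]_n) (w' : 'M[C]_m -> 'M[C]_n')
    (i : sG) lam v :
  (0 < n)%N -> (0 < n')%N -> commutant_rep w -> commutant_rep w' ->
  w (block_op N i) = 1%:M -> w' (block_op N i) = 1%:M ->
  (forall i, lam i <= d)%N -> weight_vector w lam v -> exists v', weight_vector w' lam v'.
Proof.
move=> n0 n0' wr wr' wi wi' ld vw; have [mu lm] := weight_content wr vw ld.
have cP := content_proj_commutant mu.
move=> wP; have /matrix0Pn[a [b wab]] : w' (content_proj mu) != 0.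
  apply: contraNneq wP => h; apply/eqP; exact: (rep_kernel n0' n0 wr' wr wi' wi cP h).
exists (col b (w' (content_proj mu))); split.
  by apply: contraNneq wab => /matrixP/(_ a 0); rewrite !mxE => ->.
move=> u _; rewrite -mulmx_col -(rep_mul wr') //; last exact: commutant_tens.
rewrite tens_content_proj (rep_Z wr'); apply/matrixP => x y; rewrite !mxE; congr (_ * _).
by apply: eq_bigr => j _; rewrite lm.
Qed.

End Weights.

(** * The Casimir operator and the sum of transpositions *)

Section Casimir.
Variables (C : numClosedFieldType) (d N : nat).
Local Notation word := (word d N).
Local Notation m := #|{: word}|.
Local Notation G := [set: 'S_d]%G.
Local Notation pelt := (regular_repr C G).
Local Notation R_G := (group_ring C G).
Local Notation rho := (@rho C d N).
Local Notation tens := (@tens C d N).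
Local Notation dtens := (@dtens C d N).
Local Notation Com := (@commutant C d N).
Local Notation op := (gring_op (rho_repr C d N)).

Lemma dtens_bracket (X Y : 'M[C]_N) :
  dtens X *m dtens Y = dtens Y *m dtens X + dtens (X *m Y - Y *m X).
Proof.
apply/eqP; rewrite addrC -subr_eq; apply/eqP; rewrite dtens_sub /dtens.
rewrite [X in _ - X]mulmx_suml [X in X - _]mulmx_suml.
under [X in X - _]eq_bigr do rewrite mulmx_sumr.
under [X in _ - X]eq_bigr do rewrite mulmx_sumr.
rewrite [X in _ - X]exchange_big -!sumrB; apply: eq_bigr => k _.
rewrite -sumrB (bigD1 k) //= big1 => [|l lk]; first by rewrite addr0 !slotM.
by rewrite slotC 1?eq_sym // subrr.
Qed.

Lemma sum_ordered_pairs (V : nmodType) (F : 'I_d -> 'I_d -> V) : (forall k l, F k l = F l k) ->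
  \sum_k \sum_(l | l != k) F k l = (\sum_(k < d) \sum_(l < d | (l < k)%N) F l k) *+ 2.
Proof.
move=> Fs; have -> : \sum_(k < d) \sum_(l | l != k) F k l =
    \sum_(k < d) (\sum_(l < d | (l < k)%N) F l k + \sum_(l < d | (k < l)%N) F k l).
  apply: eq_bigr => k _; rewrite (bigID (fun l : 'I_d => (l < k)%N)) /=; congr (_ + _).
    by apply: eq_big => [l|l _ //]; rewrite -val_eqE /=; case: ltngtP.
  by apply: eq_bigl => l; rewrite -val_eqE /=; case: ltngtP.
rewrite big_split mulr2n; congr (_ + _).
by rewrite (exchange_big_dep xpredT).
Qed.

Definition jm_total : 'M[C]_#|G| := \sum_j jm C j.

Lemma jm_total2 : jm_total *+ 2 = \sum_k \sum_(l | l != k) pelt (tperm k l).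
Proof. by rewrite (@sum_ordered_pairs _ (fun k l => pelt (tperm k l))) // => k l; rewrite tpermC. Qed.

Lemma jm_total_gring : (jm_total \in R_G)%MS.
Proof. by do 2 (apply: gring_sum => ? _); exact: gring_pelt. Qed.

Lemma jm_total_central s : jm_total *m pelt s = pelt s *m jm_total.
Proof.
have n2 : (2%:R : C) != 0 by rewrite pnatr_eq0.
apply: (scalerI n2); rewrite scalemxAl scalemxAr !scaler_nat jm_total2.
rewrite mulmx_suml mulmx_sumr [RHS](reindex_inj (@perm_inj _ s)) /=; apply: eq_bigr => k _.
rewrite mulmx_suml mulmx_sumr [RHS](reindex_inj (@perm_inj _ s)) /=; apply: eq_big => [l|l _].
  by rewrite (inj_eq perm_inj).
by rewrite -!repr_mxM ?inE // -tpermJ conjgE mulKVg.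
Qed.

Lemma op_jm_total2 : op jm_total *+ 2 = \sum_k \sum_(l | l != k) rho (tperm k l).
Proof.
rewrite -linearMn jm_total2 linear_sum; apply: eq_bigr => k _; rewrite linear_sum.
by apply: eq_bigr => l _; rewrite /= op_pelt.
Qed.

Lemma op_jm_total_commutant : Com (op jm_total).
Proof.
move=> s; rewrite -op_pelt -!gring_opM ?jm_total_gring ?gring_pelt //.
by rewrite jm_total_central.
Qed.

(** The Casimir eigenvalue over [C] for an arbitrary weight; row lengths give [casimir]. *)
Definition content_sum (lam : 'I_N -> nat) : C :=
  \sum_i (lam i)%:R * ((lam i)%:R + N%:R - 1 - i.*2%:R).

(** N - 1 - 2 i is the number of j > i minus the number of j < i. The eigenvalue becomes a sum over
    pairs that matches the operators E_ij E_ji term by term. *)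
Lemma content_sumE lam : content_sum lam = \sum_i \sum_j
  (if i == j then (lam i)%:R ^+ 2 else if (i < j)%N then (lam i)%:R - (lam j)%:R else 0).
Proof.
have cnt (i : 'I_N) : \sum_(j < N | (i < j)%N) (1 : C) = N%:R - 1 - i%:R.
  have : \sum_(j < N) (1 : C) = N%:R by rewrite sumr_const card_ord.
  rewrite (bigID (fun j : 'I_N => (j < i.+1)%N)) /= -(big_ord_widen N (fun=> 1 : C) (ltn_ord i)).
  rewrite sumr_const card_ord => <-; rewrite [in RHS](eq_bigl (fun j : 'I_N => (i < j)%N)) => [|j].
    by rewrite -natr1 -[RHS]addrA -opprD [1 + _]addrC [RHS]addrC addKr.
  by rewrite -leqNgt.
have cnt' (i : 'I_N) : \sum_(j < N | (j < i)%N) (1 : C) = i%:R.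
  by rewrite -(big_ord_widen N (fun=> 1 : C) (ltnW (ltn_ord i))) sumr_const card_ord.
transitivity (\sum_i ((lam i)%:R ^+ 2 + \sum_(j < N | (i < j)%N) (lam i)%:R - \sum_(j < N | (j < i)%N) (lam i)%:R : C)).
  have cst (c : C) (P : pred 'I_N) : \sum_(j < N | P j) c = c * \sum_(j < N | P j) 1.
    by rewrite mulr_sumr; apply: eq_bigr => j _; rewrite mulr1.
  by apply: eq_bigr => i _; rewrite !(cst (lam i)%:R) cnt cnt' -addnn natrD; ring.
rewrite sumrB [X in _ - X](exchange_big_dep xpredT) //= -sumrB; apply: eq_bigr => i _.
rewrite [RHS](bigD1 i) //= eqxx -addrA; congr (_ + _).
rewrite -sumrB [LHS]big_mkcond [RHS]big_mkcond /=; apply: eq_bigr => j _.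
by rewrite -!val_eqE /= eq_sym; case: ltngtP.
Qed.

(** For i < j the product E_ji E_ij kills [v], and the commutator E_ii - E_jj leaves lam i - lam j;
    for i > j the factor E_ji already kills [v]. *)
Lemma highest_weight_casimir n (w : 'M[C]_m -> 'M[C]_n) lam v :
    commutant_rep w -> weight_vector w lam v -> (forall i, lam i <= d)%N ->
    (forall i j : 'I_N, (i < j)%N -> w (dtens (delta_mx i j)) *m v = 0) ->
  w (\sum_i \sum_j dtens (delta_mx i j) *m dtens (delta_mx j i)) *m v = content_sum lam *: v.
Proof.
move=> wr vw ld hv; rewrite (rep_sum wr) mulmx_suml content_sumE scaler_suml.
apply: eq_bigr => i _; rewrite (rep_sum wr) mulmx_suml scaler_suml; apply: eq_bigr => j _.
have cD := dtens_commutant; have D i' j' : Com (dtens (delta_mx i' j')) by exact: dtens_commutant.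
have wt i' := dtens_weight wr vw (ld i').
case: (eqVneq i j) => [<-|ij].
  by rewrite (rep_mul wr) // -mulmxA wt -scalemxAr wt scalerA.
case: ltngtP => [lij|lij|/val_inj e]; last by rewrite e eqxx in ij.
  rewrite dtens_bracket (rep_D wr) (rep_mul wr) // mulmxDl -mulmxA hv // mulmx0 add0r.
  by rewrite !mul_delta_mx dtens_sub -scaleN1r addrC (rep_linear wr) mulmxDl -scalemxAl !wt scaleN1r -scaleNr -scalerDl addrC.
by rewrite (rep_mul wr) // -mulmxA hv // mulmx0 scale0r.
Qed.

Variable sG : irrType C G.
Local Notation e_ := (@Wedderburn_id C _ G sG).

Lemma casimir_block n (w : 'M[C]_m -> 'M[C]_n) lam v (i : sG) :
    commutant_rep w -> w (block_op N i) = 1%:M -> weight_vector w lam v ->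
    (forall i, lam i <= d)%N ->
    (forall i j : 'I_N, (i < j)%N -> w (dtens (delta_mx i j)) *m v = 0) ->
  jm_total *m e_ i = ((content_sum lam - (N * d)%:R) / 2%:R) *: e_ i.
Proof.
move=> wr wi vw ld hv; have [k kE] := central_block i jm_total_gring jm_total_central.
rewrite kE; congr (_ *: _).
have wk : w (op jm_total) = k%:M.
  rewrite -[LHS]mulmx1 -wi -(rep_mul wr); [|exact: op_jm_total_commutant|exact: block_op_commutant].
  by rewrite /block_op -gring_opM ?block_id_mem // kE linearZ (rep_Z wr) /= wi scalemx1.
have := highest_weight_casimir wr vw ld hv.
rewrite dtens_casimir -op_jm_total2 (rep_D wr) mulmxDl -[_ *+ 2]scaler_nat (rep_Z wr) wk.
rewrite -[_%:M]scalemx1 (rep_Z wr) (rep_1 wr) -scalemxAl mul1mx -scalemxAl mul_scalar_mx scalerA -scalerDl.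
move/eqP; rewrite -subr_eq0 -scalerBl scaler_eq0; case: vw => /negbTE -> _; rewrite orbF subr_eq0.
by move/eqP => <-; rewrite addrC addKr mulrC mulKf // pnatr_eq0.
Qed.

End Casimir.

(** * Counting the blocks *)

Section CountBlocks.
Variables (C : numClosedFieldType) (d N : nat).
Hypotheses (N_gt0 : (0 < N)%N) (dN : (d <= N)%N).
Local Notation G := [set: 'S_d]%G.
Local Notation pelt := (regular_repr C G).
Variable sG : irrType C G.
Local Notation e_ := (@Wedderburn_id C _ G sG).
Local Notation E := (@block_op C d N sG).
Variables (Y : finType) (cl : 'S_d -> Y) (p : Y -> 'M[C]_N -> C).
Hypothesis clP : forall U s, cycle_trace U s = p (cl s) U.

Lemma power_elt_classes U : power_elt d U = \sum_y p y U *: \sum_(s | cl s == y) pelt s.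
Proof.
rewrite /power_elt (partition_big cl xpredT) //=; apply: eq_bigr => y _.
by rewrite scaler_sumr; apply: eq_bigr => s /eqP <-; rewrite clP.
Qed.

(* The functions U |-> tr (tens U E_i) are linearly independent combinations of
   the p y. *)
Lemma card_blocks : (#|sG| <= #|Y|)%N.
Proof.
pose M : 'M[C]_(#|sG|, #|Y|) := \matrix_(i, y)
  identity_coef (e_ (enum_val i) *m \sum_(s | cl s == enum_val y) pelt s).
suff /eqP <- : row_free M by exact: rank_leq_col.
apply: inj_row_free => v vM; apply/rowP => k; rewrite [RHS]mxE.
have z U : U \is unitarymx -> \sum_i v 0 (enum_rank i) * \tr (tens d U *m E i) = 0.
  move=> UU; have := congr1 (fun r : 'rV_#|Y| => \sum_y p y U * r 0 (enum_rank y)) vM.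
  rewrite [X in _ = X -> _]big1 => [|y _]; last by rewrite mxE mulr0.
  apply: etrans.
  transitivity (\sum_i \sum_y p y U * (v 0 (enum_rank i) *
      identity_coef (e_ i *m \sum_(s | cl s == y) pelt s))).
    apply: eq_bigr => i _; rewrite tr_tens_op ?block_id_mem // power_elt_classes.
    rewrite mulmx_sumr identity_coef_sum mulr_sumr; apply: eq_bigr => y _.
    by rewrite -scalemxAr identity_coefZ mulrCA.
  rewrite exchange_big; apply: eq_bigr => y _; rewrite -mulr_sumr; congr (_ * _).
  rewrite mxE [RHS](reindex (@enum_rank sG)) /=; last exact: onW_bij (enum_rank_bij sG).
  by apply: eq_bigr => i _; rewrite mxE !enum_rankK.
(* The relation extends by linearity from unitary tensor powers to the commutant, which contains
   each [E k]; there only the k-th term survives, and [tr (E k)] is nonzero. *)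
have zB B : commutant B -> \tr (B *m \sum_i v 0 (enum_rank i) *: E i) = 0.
  case/commutant_unitary_span => s [/allP sU ->]; rewrite mulmx_suml raddf_sum big1_seq // => q /= qs.
  rewrite -scalemxAl mxtraceZ mulmx_sumr raddf_sum (_ : \sum_(i <- _) _ = 0) ?mulr0 // -[RHS](z q.2) ?sU //.
  by apply: eq_bigr => i _; rewrite -scalemxAr /= mxtraceZ.
have := zB _ (block_op_commutant N (enum_val k)).
rewrite mulmx_sumr (bigD1 (enum_val k)) //= big1 => [|i ik].
  rewrite addr0 -scalemxAr block_opM eqxx mxtraceZ enum_valK => /eqP.
  by rewrite mulf_eq0 (negbTE (tr_block_op dN _)) orbF => /eqP.
by rewrite -scalemxAr block_opM eq_sym (negbTE ik) scaler0.
Qed.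

End CountBlocks.

Lemma triple_expansion (C : numClosedFieldType) d (Y : finType) (p1 p2 p3 : Y -> C)
    (K : Y -> 'M[C]_#|[set: 'S_d]%G|) e :
  identity_coef ((\sum_y p1 y *: K y) *m (\sum_y p2 y *: K y) *m (\sum_y p3 y *: K y) *m e) =
  \sum_a \sum_b \sum_c p1 a * p2 b * p3 c * identity_coef (K a * K b * K c * e).
Proof.
rewrite -!mulmxA mulmx_suml identity_coef_sum; apply: eq_bigr => a _.
rewrite mulmx_suml mulmx_sumr identity_coef_sum; apply: eq_bigr => b _.
rewrite mulmx_suml 2!mulmx_sumr identity_coef_sum; apply: eq_bigr => c _.
rewrite -!scalemxAl -!scalemxAr !identity_coefZ !mulrA; congr (_ * _).
by rewrite -!mulmxE -!mulmxA.
Qed.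

(** * Continuous representations of the unitary group *)

Local Open Scope complex_scope.

Section UnitCircle.
Variable R : realType.
Local Notation C := R[i].

Definition cis (x : R) : C := cos x +i* sin x.

Lemma cis0 : cis 0 = 1. Proof. by rewrite /cis cos0 sin0. Qed.

Lemma cisD x y : cis (x + y) = cis x * cis y.
Proof. by rewrite /cis cosD sinD; apply/eqP; rewrite eq_complex /= eqxx addrC mulrC eqxx. Qed.

Lemma cisN x : cis x * cis (- x) = 1.
Proof. by rewrite -cisD subrr cis0. Qed.

Lemma cis_neq0 x : cis x != 0.
Proof. by apply/eqP => x0; have := cisN x; rewrite x0 mul0r => /eqP; rewrite eq_sym oner_eq0. Qed.

Lemma cisMn x n : cis (x *+ n) = cis x ^+ n.
Proof. by elim: n => [|n IH]; rewrite ?mulr0n ?cis0 // mulrS exprS cisD IH. Qed.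

Lemma cis_norm x : `|cis x| = 1.
Proof. by rewrite normc_def /= cos2Dsin2 sqrtr1. Qed.

Lemma cis2pi : cis (pi *+ 2) = 1. Proof. by rewrite /cis cos2pi sin2pi. Qed.

Lemma norm_realC (x : R) : `|x%:C| = `|x|%:C.
Proof. by rewrite normc_def /= expr0n addr0 sqrtr_sqr. Qed.

Lemma cis_surj z : `|z| = 1 -> exists x, z = cis x.
Proof.
case: z => a b; rewrite normc_def /= => -[/(congr1 (fun x => x ^+ 2))].
rewrite sqr_sqrtr ?addr_ge0 ?sqr_ge0 // expr1n => ab.
have a1 : -1 <= a <= 1.
  rewrite -ler_norml -(@ler_pXn2r _ 2) ?nnegrE ?normr_ge0 // expr1n real_normK ?num_real //.
  by rewrite -ab lerDl sqr_ge0.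
have s : sin (acos a) = `|b|.
  by rewrite sin_acos // -ab [_ + b ^+ 2]addrC addrK sqrtr_sqr.
have c : cos (acos a) = a by apply: acosK; rewrite in_itv.
have [b0|b0] := leP 0 b.
  by exists (acos a); rewrite /cis c s ger0_norm.
by exists (- acos a); rewrite /cis cosN sinN c s ltr0_norm // opprK.
Qed.

Lemma cis_eq1 x : cis x = 1 -> exists m : int, x = (pi *+ 2) * m%:~R.
Proof.
move=> x1; have p0 : 0 < pi *+ 2 :> R by rewrite mulrn_wgt0 // pi_gt0.
pose m := Num.floor (x / (pi *+ 2)); exists m.
pose y := x - (pi *+ 2) * m%:~R.
have period (k : int) : cis ((pi *+ 2) * k%:~R) = 1.
  case: k => k; first by rewrite -pmulrn mulr_natr cisMn cis2pi expr1n.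
  have := cisN ((pi *+ 2) * k.+1%:R); rewrite mulr_natr cisMn cis2pi expr1n mul1r.
  by rewrite NegzE mulrNz mulrN -pmulrn mulr_natr.
have cy : cis y = 1.
  by rewrite /y cisD x1 mul1r -mulrN -mulrNz period.
have y0 : 0 <= y by rewrite subr_ge0 mulrC -ler_pdivlMr // floor_le.
have y1 : y < pi *+ 2.
  rewrite ltrBlDr; have := floorD1_gt (x / (pi *+ 2)); rewrite ltr_pdivrMr // intrD mulrDl mul1r.
  by rewrite -/m mulrC addrC.
have [cy1 _] : cos y = 1 /\ sin y = 0 by move: cy => /eqP; rewrite eq_complex /= => /andP[/eqP -> /eqP ->].
suff : y = 0 by move/eqP; rewrite subr_eq0 => /eqP.
have [yp|yp] := leP y pi.
  by apply: cos_inj; rewrite ?in_itv /= ?y0 ?yp ?lexx ?pi_ge0 // cos0.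
have : pi *+ 2 - y = 0.
  apply: cos_inj; rewrite ?in_itv /= ?lexx ?pi_ge0 ?cos0 //.
    by rewrite subr_ge0 (ltW y1) /= lerBlDr mulr2n lerD2l ltW.
  by rewrite cosB cos2pi sin2pi cy1 mul0r addr0 mul1r.
by move/eqP; rewrite subr_eq0 => /eqP e; rewrite e ltxx in y1.
Qed.

Lemma cisMz x (m : int) : cis (x * m%:~R) = cis x ^ m.
Proof.
case: m => m; first by rewrite -pmulrn mulr_natr cisMn.
rewrite NegzE -exprz_inv mulrNz mulrN; apply: (mulfI (cis_neq0 (x * m.+1%:R))).
rewrite -pmulrn cisN mulr_natr cisMn -[_^-1 ^ _]/(_^-1 ^+ _) exprVn mulfV //.
by rewrite expf_neq0 // cis_neq0.
Qed.

Lemma cis_near0 (e : R) : 0 < e -> exists2 dl : R, 0 < dl &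
  forall x, `|x| < dl -> `|cis x - 1| < e%:C.
Proof.
move=> e0; have e2 : 0 < e / 2 by rewrite divr_gt0.
have /(_ 0)/cvgrPdist_lt/(_ _ e2) := @continuous_cos R.
have /(_ 0)/cvgrPdist_lt/(_ _ e2) := @continuous_sin R.
rewrite -!nearE => /nbhs_ballP[d1 /= d10 h1] /nbhs_ballP[d2 /= d20 h2].
exists (Num.min d1 d2); first by rewrite lt_min d10 d20.
move=> x; rewrite lt_min => /andP[x1 x2].
have /= := h1 x; rewrite -ball_normE /= sub0r normrN => /(_ x1); rewrite sin0 sub0r normrN => s1.
have /= := h2 x; rewrite -ball_normE /= sub0r normrN => /(_ x2); rewrite cos0 distrC => c1.
have -> : cis x - 1 = (cos x - 1)%:C + 'i%C * (sin x)%:C.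
  by apply/eqP; rewrite eq_complex /= !(mul0r, mul1r, subr0, add0r, addr0, oppr0) !eqxx.
apply: (le_lt_trans (ler_normD _ _)); rewrite normrM !norm_realC.
have -> : `|'i%C : C| = 1 by rewrite normc_def /= expr0n expr1n add0r sqrtr1.
by rewrite mul1r -raddfD /= ltcR (splitr e) ltrD.
Qed.

End UnitCircle.

Section ContinuityAtOne.
Variables (R : realType) (N : nat) (W : unitary_rep R N).
Local Notation C := R[i].

Lemma unitary1 : (1%:M : 'M[C]_N) \is unitarymx.
Proof. by apply/unitarymxP; rewrite mul1mx trmx1 map_mx1. Qed.

Lemma rep_near1 (e : R) : 0 < e -> exists2 dl : R, 0 < dl &
  forall U : 'M[C]_N, U \is unitarymx -> (forall i j, `|(U - 1%:M) i j| < dl%:C) ->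
  forall i j, `|(W U - 1%:M) i j| < e%:C.
Proof.
move=> e0; have := @rep_continuous R N W.
move/subspace_continuousP => /(_ 1%:M unitary1).
move=> /cvg_ballP /(_ e%:C); rewrite ltcR => /(_ e0).
rewrite near_withinE => /nbhs_ballP[d0 /= d00 h].
(* Radii in [C^o] are complex numbers; a positive one is real. *)
have [dr dE] : exists dr : R, d0 = dr%:C.
  by exists (complex.Re d0); rewrite RRe_real // gtr0_real.
rewrite dE in d00 h.
exists dr; first by rewrite -ltcR.
move=> U uU hU i j; have [|_ /(_ i j)] := h U _ uU.
  split=> // k l; rewrite -ball_normE /=; have := hU k l.
  by rewrite mxE mxE distrC.
rewrite -ball_normE /= /from_subspace rep_mx1 distrC.
by rewrite [X in _ -> `|X| < _]mxE [X in _ -> `|_ + X| < _]mxE.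
Qed.

End ContinuityAtOne.

(** * Eigenvectors along a circle subgroup *)

Section OneParameter.
Variables (R : realType) (n : nat).
Local Notation C := R[i].

(** Entries below 1 / (n + 1) give [A - 1] an operator norm at most n / (n + 1) for the l1 norm, so
    [a] is at distance less than 1 from 1. *)
Lemma eigenvalue_near1 (A : 'M[C]_n) (v : 'cV[C]_n) a :
  (forall i j, `|(A - 1%:M) i j| < (n.+1%:R^-1)%:C) -> v != 0 ->
  A *m v = a *: v -> 0 < complex.Re a.
Proof.
move=> near1 v0 Av; pose S := \sum_i `|v i 0|.
have S0 : 0 < S.
  have [i vi] : exists i, v i 0 != 0.
    apply/existsP; apply: contraNT v0; rewrite negb_exists => /forallP h.
    by apply/eqP/colP => i; rewrite mxE; apply/eqP; have := h i; rewrite negbK.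
  by rewrite /S (bigD1 i) //= ltr_pwDl ?normr_gt0 // sumr_ge0.
have : `|a - 1| * S < S.
  have le1 i : `|a - 1| * `|v i 0| <= (n.+1%:R^-1)%:C * S.
    have <- : `|((A - 1%:M) *m v) i 0| = `|a - 1| * `|v i 0|.
      by rewrite mulmxBl mul1mx Av -normrM; congr `|_|; rewrite !mxE; ring.
    rewrite mxE (le_trans (ler_norm_sum _ _ _)) // /S mulr_sumr ler_sum // => j _.
    by rewrite normrM ler_wpM2r ?normr_ge0 // ltW.
  rewrite {1}/S mulr_sumr (le_lt_trans (ler_sum _ (fun i _ => le1 i))) //.
  rewrite sumr_const card_ord -mulrnAl gtr_pMl //.
  have -> : 1 = (1 : R)%:C :> C by [].
  by rewrite -raddfMn ltcR -[_ *+ n]mulr_natl ltr_pdivrMr ?ltr0n // mul1r ltr_nat.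
rewrite gtr_pMl // => a1.
have := le_lt_trans (normc_ge_Re (a - 1)) a1; rewrite ltcR ltr_norml => /andP[+ _].
by rewrite raddfB /= ltrBrDr addNr.
Qed.

Variable H : R -> 'M[C]_n.
Hypothesis HD : forall x y, H (x + y) = H x *m H y.
Hypothesis H2pi : H (pi *+ 2) = 1%:M.
Hypothesis H0 : H 0 = 1%:M.
Hypothesis Hnear : forall e : R, 0 < e -> exists2 dl : R, 0 < dl &
  forall x, `|x| < dl -> forall i j, `|(H x - 1%:M) i j| < e%:C.
Variable dl : R.
Hypothesis Hdl : forall x, `|x| < dl ->
  forall i j, `|(H x - 1%:M) i j| < (n.+1%:R^-1)%:C.

Lemma HMn x k : H (x *+ k) = H x ^+ k.
Proof. by elim: k => [|k IH]; rewrite ?mulr0n ?H0 // mulrS exprS HD IH. Qed.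

Lemma exp_eigen (A : 'M[C]_n) (v : 'cV_n) a k : A *m v = a *: v ->
  A ^+ k *m v = a ^+ k *: v.
Proof.
move=> Av; elim: k => [|k IH]; first by rewrite !expr0 mul1mx scale1r.
by rewrite !exprSr -[_ * _ in LHS]/(_ *m _) -mulmxA Av -scalemxAr IH scalerA mulrC.
Qed.

(* Halving the angle selects the square root with positive real part, so the
   eigenvalue at x0 determines those at all dyadic multiples of x0; continuity
   does the rest. *)
Lemma one_parameter_weight k0 (v : 'cV[C]_n) a :
  (pi *+ 2) / 2 ^+ k0 < dl -> v != 0 -> H ((pi *+ 2) / 2 ^+ k0) *m v = a *: v ->
  exists m : int, forall x, H x *m v = cis x ^ m *: v.
Proof.
set x0 := _ / _ => x0dl v0 Hv.
have x00 : 0 < x0 by rewrite divr_gt0 ?exprn_gt0 // mulrn_wgt0 // pi_gt0.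
(* [x0] is the fraction 1 / 2^k0 of a full turn, so [a] is a root of unity. *)
have a1 : a ^+ (2 ^ k0) = 1.
  have := exp_eigen (2 ^ k0)%N Hv; rewrite -HMn -mulr_natr natrX divfK ?expf_neq0 ?pnatr_eq0 //.
  rewrite H2pi mul1mx => /esym/eqP; rewrite -subr_eq0 -{2}[v]scale1r -scalerBl.
  by rewrite scaler_eq0 (negbTE v0) orbF subr_eq0 => /eqP.
have na : `|a| = 1.
  apply/eqP; have := congr1 Num.norm a1; rewrite normrX normr1 => /eqP.
  by rewrite pexpr_eq1 // expn_gt0.
have ra : 0 < complex.Re a.
  by apply: (eigenvalue_near1 (Hdl _) v0 Hv); rewrite gtr0_norm.
(* [f] is the argument of [a], in the open interval from - pi / 2 to pi / 2 because [Re a] is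
   positive. *)
have [f af fb] : exists2 f : R, a = cis f & `|f| < pi / 2.
  case: a na ra {Hv a1} => p q; rewrite normc_def /= => -[/(congr1 (fun x => x ^+ 2))].
  rewrite sqr_sqrtr ?addr_ge0 ?sqr_ge0 // expr1n => pq p0.
  have q1 : -1 < q < 1.
    rewrite -ltr_norml -(@ltr_pXn2r _ 2) ?nnegrE ?normr_ge0 // expr1n real_normK ?num_real //.
    by rewrite -pq ltrDr exprn_gt0.
  have q1' : -1 <= q <= 1 by case/andP: q1 => /ltW -> /ltW ->.
  exists (asin q).
    rewrite /cis cos_asin // asinK ?in_itv //= -pq addrK sqrtr_sqr gtr0_norm //.
  case/andP: q1 => qa qb; case/andP: q1' => qa' qb'.
  by rewrite ltr_norml asin_gtNpi2 ?qa ?qb' // asin_ltpi2 // qa' qb.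
have half j : `|f / 2 ^+ j| < pi / 2.
  rewrite normrM (le_lt_trans _ fb) // ler_piMr ?normr_ge0 //.
  by rewrite normfV ger0_norm ?exprn_ge0 // invf_le1 ?exprn_gt0 // exprn_ege1 // ler1n.
have dyadic j : H (x0 / 2 ^+ j) *m v = cis (f / 2 ^+ j) *: v.
  elim: j => [|j IH]; first by rewrite !expr0 !divr1 Hv af.
  set y := x0 / 2 ^+ j.+1; set g := f / 2 ^+ j.+1.
  have h2 (z : R) : z / 2 ^+ j = z / 2 ^+ j.+1 + z / 2 ^+ j.+1.
    by rewrite exprS invfM; field; rewrite expf_neq0 // pnatr_eq0.
  rewrite (h2 x0) (h2 f) -/y -/g HD cisD in IH.
  (* The square of [H y] multiplies [v] by the square of [cis g], so the defect [u] satisfies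
     [H y u = - cis g u]. The real part of [- cis g] is at most 0, which is impossible for an
     eigenvalue so near 1; hence [u = 0]. *)
  pose u := H y *m v - cis g *: v.
  have Hu : H y *m u = - cis g *: u.
    by rewrite mulmxBr mulmxA IH -scalemxAr scalerBr !scaleNr opprK scalerA addrC.
  have [u0|u0] := eqVneq u 0; first by apply/eqP; rewrite -subr_eq0 -/u u0.
  have small_y : `|y| < dl.
    have y0 : 0 < y by rewrite divr_gt0 ?exprn_gt0.
    rewrite gtr0_norm //; apply: le_lt_trans x0dl.
    by rewrite /y ler_piMr ?(ltW x00) // invf_le1 ?exprn_gt0 // exprn_ege1 // ler1n.
  have := eigenvalue_near1 (Hdl small_y) u0 Hu.
  rewrite /= oppr_gt0 ltNge cos_ge0_pihalf //.
  by have := half j.+1; rewrite ltr_norml -/g => /andP[/ltW -> /ltW ->].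
pose c := f / x0.
have dyadicn j p : H (x0 / 2 ^+ j *+ p) *m v = cis (c * (x0 / 2 ^+ j *+ p)) *: v.
  rewrite HMn (exp_eigen p (dyadic j)) -cisMn; congr (cis _ *: _).
  by rewrite -mulrnAr /c -mulrnAr; field; rewrite expf_neq0 ?pnatr_eq0 //= gt_eqF.
have nonneg x : 0 <= x -> H x *m v = cis (c * x) *: v.
  move=> x_ge0; apply/colP => i.
  pose M := 1 + \sum_j complex.Re `|v j 0|.
  have nv j : `|v j 0| = (complex.Re `|v j 0|)%:C by rewrite RRe_real ?normr_real.
  have nv0 j : 0 <= complex.Re `|v j 0| by rewrite -ler0c -nv normr_ge0.
  have M0 : 0 < M by rewrite ltr_pwDl // sumr_ge0.
  (* Round [x] down to a multiple [q *+ p] of a fine dyadic angle; [dd] is small enough that the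
     remainder [t] and [c * t] are within the two moduli of continuity. *)
  have close (e : R) : 0 < e -> `|(H x *m v - cis (c * x) *: v) i 0| <= (e * M)%:C.
    move=> e0; have e2 : 0 < e / 2 by rewrite divr_gt0.
    have [d1 d10 h1] := Hnear e2; have [d2 d20 h2] := cis_near0 e2.
    have c1 : 0 < 1 + `|c| by rewrite ltr_pwDl // normr_ge0.
    pose dd := Num.min d1 (d2 / (1 + `|c|)).
    have dd0 : 0 < dd by rewrite lt_min d10 divr_gt0.
    have [j xj] : exists j, x0 / 2 ^+ j < dd.
      exists (Num.truncn (x0 / dd)).+1; rewrite ltr_pdivrMr ?exprn_gt0 // mulrC -ltr_pdivrMr //.
      have /andP[_ lt] := truncn_itv (divr_ge0 (ltW x00) (ltW dd0)).
      by rewrite (lt_le_trans lt) // -natrX ler_nat ltnW // ltn_expl.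
    pose q := x0 / 2 ^+ j; have q0 : 0 < q by rewrite divr_gt0 ?exprn_gt0.
    pose p := Num.truncn (x / q); pose t := x - q *+ p.
    have /andP[px xp] := truncn_itv (divr_ge0 x_ge0 (ltW q0)).
    have t0 : 0 <= t by rewrite subr_ge0 -mulr_natl -ler_pdivlMr.
    have tq : t < dd.
      rewrite (lt_trans _ xj) // ltrBlDr -/q -mulrS -mulr_natl -ltr_pdivrMr //.
    have xE : x = t + q *+ p by rewrite subrK.
    have Hx : H x *m v = cis (c * (q *+ p)) *: (H t *m v).
      by rewrite {1}xE HD -mulmxA dyadicn scalemxAr.
    have -> : (H x *m v - cis (c * x) *: v) i 0 =
        cis (c * (q *+ p)) * (((H t - 1%:M) *m v) i 0 + (1 - cis (c * t)) * v i 0).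
      rewrite Hx {1}xE mulrDr cisD mulmxBl mul1mx !mxE; ring.
    rewrite normrM cis_norm mul1r (le_trans (ler_normD _ _)) //.
    have -> : (e * M)%:C = (e / 2 * M)%:C + (e / 2 * M)%:C.
      by rewrite -raddfD /= -mulrDl -splitr.
    have vM j' : `|v j' 0| <= M%:C.
      rewrite nv lecR /M (bigD1 j') //= addrCA lerDl addr_ge0 // sumr_ge0 // => k _; exact: nv0.
    have sM : \sum_j' `|v j' 0| <= M%:C.
      under eq_bigr do rewrite nv.
      by rewrite -raddf_sum lecR /= /M lerDr.
    have tn : `|t| = t by rewrite ger0_norm.
    have eM : (e / 2 * M)%:C = (e / 2)%:C * M%:C := rmorphM _ _ _.
    apply: lerD.
      rewrite mxE (le_trans (ler_norm_sum _ _ _)) //.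
      apply: (@le_trans _ _ (\sum_j' (e / 2)%:C * `|v j' 0|)).
        apply: ler_sum => j' _; rewrite normrM ler_wpM2r ?normr_ge0 // ltW //.
        by apply: h1; rewrite tn (lt_le_trans tq) // ge_min lexx.
      by rewrite -mulr_sumr eM ler_wpM2l // ler0c ltW.
    rewrite normrM eM ler_pM ?normr_ge0 // distrC ltW //.
    apply: h2; rewrite normrM tn (@le_lt_trans _ _ ((1 + `|c|) * t)) //.
      by rewrite ler_wpM2r // lerDr.
    by rewrite mulrC -ltr_pdivlMr // (lt_le_trans tq) // ge_min lexx orbT.
  apply/eqP; rewrite -subr_eq0.
  have -> : (H x *m v) i 0 - (cis (c * x) *: v) i 0 = (H x *m v - cis (c * x) *: v) i 0.
    by rewrite [in RHS]mxE [X in _ = _ + X]mxE.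
  set z := _ i 0 in close *; apply/negPn/negP => z0.
  have [r zE] : exists r : R, `|z| = r%:C by exists (Normc.normc z).
  have r0 : 0 < r by rewrite -(ltcR 0 r) -zE; exact: (etrans (normr_gt0 z) z0).
  have rM : 0 < r / 2 / M by rewrite !divr_gt0.
  have := close _ rM; rewrite divfK ?gt_eqF // zE lecR ler_pdivlMr //.
  by rewrite ger_pMr // lern1.
(* A full turn acts trivially, so [cis (2 pi c) = 1] and [c] is an integer. *)
have [m cm] : exists m : int, c = m%:~R.
  have p0 : (pi *+ 2 : R) != 0 by rewrite gt_eqF // mulrn_wgt0 // pi_gt0.
  have := nonneg (pi *+ 2); rewrite mulrn_wge0 ?pi_ge0 // => /(_ isT).
  rewrite H2pi mul1mx => /esym/eqP; rewrite -subr_eq0 -{2}[v]scale1r -scalerBl.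
  rewrite scaler_eq0 (negbTE v0) orbF subr_eq0 => /eqP /cis_eq1[m].
  by rewrite mulrC => /(mulfI p0) ->; exists m.
have nonnegm x : 0 <= x -> H x *m v = cis x ^ m *: v.
  by move=> x_ge0; rewrite nonneg // cm mulrC cisMz.
exists m => x; have [x_ge0|x_lt0] := leP 0 x; first exact: nonnegm.
have Nx : 0 <= - x by rewrite oppr_ge0 ltW.
have := congr1 (mulmx (H x)) (nonnegm _ Nx).
rewrite mulmxA -HD subrr H0 mul1mx -scalemxAr => vE.
by rewrite [in RHS]vE scalerA -!cisMz -cisD mulNr subrr cis0 scale1r.
Qed.

End OneParameter.

(** X^k - 1 annihilates [A] and is separable in characteristic 0. *)
Lemma finite_order_diagonalizable (C : numClosedFieldType) n (A : 'M[C]_n) k :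
  (0 < k)%N -> A ^+ k = 1%:M -> diagonalizable A.
Proof.
case: n A => [|n] A k0 Ak.
  by exists 1%:M; rewrite ?unitmx1 //; apply/is_diag_mxP => -[].
have [rs pE] := closed_field_poly_normal ('X^k - 1 : {poly C}).
rewrite (monicP (monic_Xn_sub_1 C k0)) scale1r in pE.
apply/diagonalizableP; exists rs.
  by rewrite -separable_prod_XsubC -pE separable_Xn_sub_1 // pnatr_eq0 -lt0n.
by rewrite -pE mxminpoly_min // rmorphB rmorphXn /= horner_mx_X rmorph1 Ak subrr.
Qed.

Lemma diag_unitary (C : numClosedFieldType) n (u : 'rV[C]_n) :
  (forall i, `|u 0 i| = 1) -> diag_mx u \is unitarymx.
Proof.
move=> u1; apply/unitarymxP; rewrite tr_diag_mx map_diag_mx mulmx_diag -diag_const_mx.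
by congr diag_mx; apply/rowP => i; rewrite !mxE -normCK u1 expr1n.
Qed.

Section TorusWeights.
Variables (R : realType) (N : nat) (W : unitary_rep R N).
Local Notation C := R[i].
Local Notation n := (rep_dim W).

Let coord (i : 'I_N) (z : C) : 'rV[C]_N := \row_k (if k == i then z else 1).

Let coord_norm i z : `|z| = 1 -> forall k, `|coord i z 0 k| = 1.
Proof. by move=> z1 k; rewrite mxE; case: eqP; rewrite ?normr1. Qed.

Let H i (x : R) : 'M[C]_n := W (diag_mx (coord i (cis x))).

Let H0 i : H i 0 = 1%:M.
Proof.
rewrite /H -(rep_mx1 W) -diag_const_mx; congr (W (diag_mx _)).
by apply/rowP => k; rewrite !mxE cis0 if_same.
Qed.

Let WM (u v : 'rV[C]_N) : (forall i, `|u 0 i| = 1) -> (forall i, `|v 0 i| = 1) ->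
  W (diag_mx u) *m W (diag_mx v) = W (diag_mx (\row_i (u 0 i * v 0 i))).
Proof.
by move=> u1 v1; rewrite -rep_mxM ?diag_unitary // mulmx_diag.
Qed.

Let HD i x y : H i (x + y) = H i x *m H i y.
Proof.
rewrite /H WM; try by apply: coord_norm; rewrite cis_norm.
congr (W (diag_mx _)); apply/rowP => k; rewrite !mxE cisD.
by case: eqP; rewrite ?mul1r.
Qed.

Let Hcomm i j x y : H i x *m H j y = H j y *m H i x.
Proof.
rewrite /H !WM; try by apply: coord_norm; rewrite cis_norm.
by congr (W (diag_mx _)); apply/rowP => k; rewrite !mxE mulrC.
Qed.

Let H2pi i : H i (pi *+ 2) = 1%:M.
Proof. by rewrite -(H0 i) /H cis2pi cis0. Qed.

Let Hnear (e : R) : 0 < e -> exists2 dl : R, 0 < dl & forall i,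
  forall x, `|x| < dl -> forall k l, `|(H i x - 1%:M) k l| < e%:C.
Proof.
move=> e0; have [d1 d10 h1] := rep_near1 W e0; have [dl dl0 h2] := cis_near0 d10.
exists dl => // i x xdl; apply: h1.
  by apply: diag_unitary; apply: coord_norm; rewrite cis_norm.
move=> k l; rewrite !mxE; case: (k == l); last by rewrite !mulr0n subrr normr0 ltcR.
by rewrite !mulr1n; case: eqP => _; rewrite ?h2 // subrr normr0 ltcR.
Qed.

(** It suffices to diagonalize the finite commuting family of the [H i x0], which have finite order:
    [one_parameter_weight] makes each common eigenvector an eigenvector of every coordinate circle,
    and these circles generate the torus. *)
Lemma torus_weights : exists Q : 'M[C]_n, exists m : 'I_n -> 'I_N -> int,
  Q \in unitmx /\ forall u : 'rV[C]_N, (forall i, `|u 0 i| = 1) ->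
    W (diag_mx u) = Q *m diag_mx (\row_j \prod_i u 0 i ^ m j i) *m invmx Q.
Proof.
have e0 : 0 < (n.+1%:R^-1 : R) by rewrite invr_gt0 ltr0n.
have [dl dl0 Hdl] := Hnear e0.
have [k0 k0P] : exists k0, (pi *+ 2) / 2 ^+ k0 < dl.
  exists (Num.truncn ((pi *+ 2) / dl)).+1.
  rewrite ltr_pdivrMr ?exprn_gt0 // mulrC -ltr_pdivrMr //.
  have /andP[_ lt] := truncn_itv (divr_ge0 (mulrn_wge0 2 (pi_ge0 R)) (ltW dl0)).
  by rewrite (lt_le_trans lt) // -natrX ler_nat ltnW // ltn_expl.
pose x0 : R := (pi *+ 2) / 2 ^+ k0.
have HMn i x k : H i (x *+ k) = H i x ^+ k.
  by elim: k => [|k IH]; rewrite ?mulr0n ?H0 // mulrS exprS HD IH.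
pose As := [seq H i x0 | i <- enum 'I_N].
have : codiagonalizable As.
  apply/codiagonalizableP; split.
    by move=> _ _ /mapP[i _ ->] /mapP[j _ ->]; exact: Hcomm.
  move=> _ /mapP[i _ ->]; apply: (@finite_order_diagonalizable _ _ _ (2 ^ k0)).
    by rewrite expn_gt0.
  by rewrite -HMn -mulr_natr natrX divfK ?expf_neq0 ?pnatr_eq0.
case=> P uP /allP diagP; pose Q := invmx P.
have uQ : Q \in unitmx by rewrite unitmx_inv.
have colQ0 j : col j Q != 0.
  apply/eqP => c0; have := congr1 (mulmx P) c0; rewrite mulmx0 colE mulmxA mulmxV // mul1mx.
  by move/colP/(_ j); rewrite !mxE !eqxx => /eqP; rewrite oner_eq0.
have eig i j : exists a, H i x0 *m col j Q = a *: col j Q.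
  have /diagP : H i x0 \in As by apply: map_f; rewrite mem_enum.
  case/(similar_diagLR uP) => D ->; exists (D 0 j).
  rewrite conjVmx // !colE !mulmxA mulmxK // -!mulmxA scalemxAr; congr (Q *m _).
  apply/colP => k; rewrite mul_diag_mx !mxE.
  by case: eqP => [->|]; rewrite ?mulr1 ?mulr0.
have wt j : exists m : 'I_N -> int, forall i x, H i x *m col j Q = cis x ^ m i *: col j Q.
  have [i|m mP] := @choice _ _ (fun i m => forall x, H i x *m col j Q = cis x ^ m *: col j Q);
    last by exists m.
  have [a Ha] := eig i j.
  apply: (one_parameter_weight (HD i) (H2pi i) (H0 i) _ (Hdl i) k0P (colQ0 j) Ha).
  by move=> e /Hnear[dl' dl'0 h]; exists dl' => //; exact: h.
have [m mP] := choice wt; exists Q, m; split=> // u u1.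
have [th uth] : exists th : 'I_N -> R, forall i, u 0 i = cis (th i).
  have [i|th thP] := @choice _ _ (fun i x => u 0 i = cis x); first exact: cis_surj.
  by exists th.
have part (r : seq 'I_N) j : uniq r -> W (diag_mx (\row_k (if k \in r then u 0 k else 1))) *m col j Q =
    \prod_(i <- r) u 0 i ^ m j i *: col j Q.
  elim: r => [_|i r IH /= /andP[ir ur]].
    rewrite big_nil scale1r -[RHS]mul1mx -(rep_mx1 W) -diag_const_mx.
    by congr (W (diag_mx _) *m _); apply/rowP => k; rewrite !mxE.
  have -> : diag_mx (\row_k (if k \in i :: r then u 0 k else 1)) =
      diag_mx (\row_k (coord i (cis (th i)) 0 k * (\row_k (if k \in r then u 0 k else 1)) 0 k)).
    congr diag_mx; apply/rowP => k; rewrite !mxE inE.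
    by case: eqP => [->|]; rewrite ?mul1r // (negbTE ir) mulr1 uth.
  rewrite -WM; last first.
  - by move=> k; rewrite mxE; case: ifP; rewrite ?normr1.
  - by apply: coord_norm; rewrite cis_norm.
  rewrite -mulmxA IH // -scalemxAr -/(H i (th i)) mP scalerA big_cons -uth.
  by rewrite mulrC.
have WQ : W (diag_mx u) *m Q = Q *m diag_mx (\row_j \prod_i u 0 i ^ m j i).
  apply/matrixP => k j; have := part (enum 'I_N) j (enum_uniq _).
  have -> : (\row_k (if k \in enum 'I_N then u 0 k else 1)) = u.
    by apply/rowP => l; rewrite mxE mem_enum.
  rewrite big_enum /= => /colP/(_ k); rewrite colE mulmxA -colE mxE => ->.
  by rewrite -colE mul_mx_diag !mxE mulrC.
by rewrite -WQ mulmxK.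
Qed.

End TorusWeights.

(** * Characters and weights *)

Section YoungRows.
Variable d : nat.
Implicit Type lam : young d.

Lemma sumn_rows lam : sumn (rows lam) = d.
Proof.
case: lam => a ha; have /andP[_ /eqP sa] := ha; rewrite /rows /=; apply: etrans sa.
by elim: (map val a) => //= x s IH; case: posnP => [->|_] /=; rewrite IH.
Qed.

Lemma size_rows lam : (size (rows lam) <= d)%N.
Proof.
by rewrite size_filter (leq_trans (count_size _ _)) // size_map size_tuple.
Qed.

Lemma sum_rowlen lam N : (d <= N)%N -> \sum_(i < N) rowlen lam i = d.
Proof.
move=> dN; apply: etrans (sumn_rows lam); rewrite sumnE (big_nth 0%N) big_mkord /rowlen.
rewrite (big_ord_widen N (fun i => nth 0%N (rows lam) i)) ?(leq_trans (size_rows _)) //.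
rewrite [RHS]big_mkcond; apply: eq_bigr => i _; case: ltnP => // h.
by rewrite nth_default.
Qed.

Lemma rows_inj : injective (@rows d).
Proof.
have split_zeros (s : seq nat) : sorted geq s ->
    s = [seq x <- s | (0 < x)%N] ++ nseq (size s - size [seq x <- s | (0 < x)%N]) 0%N.
  elim: s => //= x s IH ps; case: posnP => [x0|x0] /=; last first.
    by rewrite subSS -IH // (path_sorted ps).
  have s0 : all (pred1 0%N) s.
    have := order_path_min _ ps; rewrite x0 => H.
    apply: sub_all (H _) => [y /=|y z w /= h1 h2]; last exact: leq_trans h2 h1.
    by rewrite leqn0.
  have -> : [seq y <- s | (0 < y)%N] = [::].
    by elim: s s0 {IH ps} => //= y s IH /andP[/eqP -> /IH ->].
  by rewrite /= x0; congr (_ :: _); apply/all_pred1P.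
move=> l1 l2 e; apply: val_inj; apply: val_inj => /=.
apply: (inj_map val_inj); case: l1 l2 e => a ha [b hb]; have /andP[sa _] := ha; have /andP[sb _] := hb.
rewrite /rows /= => e; rewrite (split_zeros _ sa) (split_zeros _ sb) e.
by rewrite !size_map !size_tuple.
Qed.

End YoungRows.

Section WeightOrder.
Variable N : nat.
Implicit Types mu lam : 'I_N -> int.

(** A positive root e_i - e_j, i < j, has a nonnegative sum over any initial segment of indices. *)
Lemma weight_le_partial mu lam (P : pred 'I_N) :
    (forall i j : 'I_N, (i <= j)%N -> P j -> P i) -> weight_le mu lam ->
  \sum_(i | P i) mu i <= \sum_(i | P i) lam i.
Proof.
move=> dP [c hc]; rewrite -subr_ge0 -sumrB (eq_bigr _ (fun k _ => hc k)).
rewrite exchange_big sumr_ge0 //= => i _; rewrite exchange_big sumr_ge0 //= => j ij.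
rewrite -mulr_sumr mulr_ge0 // sumrB subr_ge0.
have e l : \sum_(k | P k) (k == l)%:Z = (P l : nat)%:Z.
  have [Pl|Pl] := boolP (P l).
    rewrite (bigD1 l) //= eqxx big1 ?addr0 // => k /andP[_ /negbTE ->] //.
  by rewrite big1 // => k Pk; case: eqP => // kl; rewrite -kl Pk in Pl.
rewrite !e lez_nat; case: (boolP (P j)) => // Pj.
by rewrite (dP i j) // ltnW.
Qed.

Lemma weight_le_sum mu lam : weight_le mu lam -> \sum_i mu i = \sum_i lam i.
Proof.
move=> [c hc]; apply/eqP; rewrite eq_sym -subr_eq0 -sumrB (eq_bigr _ (fun k _ => hc k)).
rewrite exchange_big big1 //= => i _; rewrite exchange_big big1 //= => j ij.
have e l : \sum_k (k == l)%:Z = 1 :> int.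
  by rewrite (bigD1 l) //= eqxx big1 ?addr0 // => k /negbTE ->.
by rewrite -mulr_sumr sumrB !e subrr mulr0.
Qed.

(** The sums over all initial segments agree, and entries are differences of consecutive such
    sums. *)
Lemma weight_le_anti mu lam : weight_le mu lam -> weight_le lam mu -> mu =1 lam.
Proof.
move=> h1 h2 i.
have e (P : pred 'I_N) : (forall i j : 'I_N, (i <= j)%N -> P j -> P i) ->
    \sum_(i | P i) mu i = \sum_(i | P i) lam i.
  by move=> dP; apply/eqP; rewrite eq_le !weight_le_partial.
have h (Q : 'I_N -> int) : \sum_(k : 'I_N | (k <= i)%N) Q k = Q i + \sum_(k : 'I_N | (k < i)%N) Q k.
  rewrite (bigD1 i) //=; congr (_ + _); apply: eq_bigl => k.
  by rewrite ltn_neqAle andbC.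
have := e (fun k : 'I_N => (k <= i)%N) (fun a b ab bi => leq_trans ab bi).
have := e (fun k : 'I_N => (k < i)%N) (fun a b ab bi => leq_ltn_trans ab bi).
by rewrite !h => ->; apply: addIr.
Qed.

(** The sum over the indices up to [i] would exceed that of [lam] by 1. *)
Lemma weight_le_raise lam (i j : 'I_N) : (i < j)%N ->
  ~ weight_le (fun k => lam k + (k == i)%:Z - (k == j)%:Z) lam.
Proof.
move=> ij /(weight_le_partial (P := fun k : 'I_N => (k <= i)%N)).
move=> /(_ (fun a b ab bi => leq_trans ab bi)); rewrite sumrB big_split /=.
rewrite [X in (_ + X) - _](bigD1 i) //= eqxx.
rewrite [X in (_ + (_ + X)) - _]big1 => [|k /andP[_ /negbTE -> //]].
rewrite [X in _ - X]big1 => [|k ki]; last first.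
  by case: eqP => // kj; move: ki; rewrite kj leqNgt ij.
by rewrite addr0 subr0 gerDl.
Qed.

End WeightOrder.

Section UnitaryMatrices.
Variables (C : numClosedFieldType) (N : nat).
Implicit Types (U : 'M[C]_N) (s : 'S_N).

Lemma invmx_unitarymx U : U \is unitarymx -> invmx U \is unitarymx.
Proof. by move=> uU; rewrite invmx_unitary ?trmxC_unitary. Qed.

Lemma mulmxV_unitary U : U \is unitarymx -> U *m invmx U = 1%:M.
Proof. by move=> uU; rewrite mulmxV ?unitarymx_unit. Qed.

Lemma mulVmx_unitary U : U \is unitarymx -> invmx U *m U = 1%:M.
Proof. by move=> uU; rewrite mulVmx ?unitarymx_unit. Qed.

Lemma perm_unitarymx s : (perm_mx s : 'M[C]_N) \is unitarymx.
Proof. by apply/unitarymxP; rewrite tr_perm_mx map_perm_mx -perm_mxM mulgV perm_mx1. Qed.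

Lemma diag_perm (u : 'rV[C]_N) s : diag_mx (col_perm s u) *m perm_mx s = perm_mx s *m diag_mx u.
Proof.
apply/matrixP => i j; rewrite mul_diag_mx mul_mx_diag !mxE.
by case: eqP => [<-|]; rewrite ?mulr1 ?mul1r // mulr0 mul0r.
Qed.

Lemma diag_col_perm (u : 'rV[C]_N) s :
  diag_mx (col_perm s u) = invmx (invmx (perm_mx s)) *m diag_mx u *m invmx (perm_mx s).
Proof. by rewrite invmxK -diag_perm mulmxK // unitarymx_unit // perm_unitarymx. Qed.

Lemma trace_conj1 n (X Y Z : 'M[C]_n) : Z *m X = 1%:M -> \tr (X *m Y *m Z) = \tr Y.
Proof. by move=> ZX; rewrite mxtrace_mulC mulmxA ZX mul1mx. Qed.

End UnitaryMatrices.

Section IrreducibleCharacter.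
Variables (R : realType) (d N : nat).
Hypotheses (d_gt0 : (1 <= d)%N) (dN : (d <= N)%N).
Local Notation C := R[i].
Variables (W : unitary_rep R N) (lam : young d).
Hypothesis hW : is_irrep lam W.
Local Notation n := (rep_dim W).

Lemma is_weight_perm (mu : 'I_N -> int) (s : 'S_N) :
  is_weight W mu -> is_weight W (mu \o s).
Proof.
case=> v v0 hv; have uP := perm_unitarymx C s.
exists (W (perm_mx s) *m v).
  apply: contraNneq v0 => /(congr1 (mulmx (W (invmx (perm_mx s))))).
  rewrite mulmx0 mulmxA -(rep_mxM W (invmx_unitarymx uP) uP) mulVmx_unitary //.
  by rewrite rep_mx1 mul1mx => ->.
move=> u u1; pose u' : 'rV[C]_N := \row_j u 0 ((s^-1)%g j).
have u'1 i : `|u' 0 i| = 1 by rewrite mxE u1.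
have uE : u = col_perm s u' by apply/rowP => i; rewrite !mxE permK.
rewrite mulmxA -(rep_mxM W (diag_unitary u1) uP) {1}uE diag_perm.
rewrite (rep_mxM W uP (diag_unitary u'1)) -mulmxA hv // -scalemxAr; congr (_ *: _).
rewrite (reindex_inj (@perm_inj _ s)) /=; apply: eq_bigr => i _.
by rewrite mxE permK.
Qed.

(** Permutation matrices permute the weights, so [mu i] can be moved to the last place. The other
    entries then sum to at most the corresponding sum for [lam], with equal totals, so [mu i] is at
    least the last row length of [lam]. *)
Lemma weight_partition (mu : 'I_N -> int) : is_weight W mu ->
  (forall i, 0 <= mu i) /\ \sum_i mu i = d%:Z.
Proof.
have [_ [_ hw]] := hW.
have slam : \sum_(i < N) (rowlen lam i)%:Z = d%:Z :> int.
  by rewrite -(big_morph Posz PoszD (erefl _)) sum_rowlen.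
move=> hmu; split=> [i|]; last by rewrite (weight_le_sum (hw _ hmu)).
have lastP : (N.-1 < N)%N by rewrite prednK // (leq_trans d_gt0).
pose l := Ordinal lastP; have hs := is_weight_perm (tperm i l) hmu.
have e (Q : 'I_N -> int) : \sum_k Q k = Q l + \sum_(k : 'I_N | (k < l)%N) Q k.
  rewrite (bigD1 l) //=; congr (_ + _); apply: eq_bigl => k.
  rewrite ltn_neqAle -val_eqE /=; case: eqP => //= _.
  by rewrite -ltnS prednK ?ltn_ord // (leq_trans d_gt0).
have h1 := weight_le_sum (hw _ hs).
have h2 := weight_le_partial (P := fun k : 'I_N => (k < l)%N)
  (fun a b ab bi => leq_ltn_trans ab bi) (hw _ hs).
rewrite !e /= tpermR in h1.
have : (rowlen lam l)%:Z <= mu i.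
  have := lexx ((mu i) + \sum_(k < N | (k < N.-1)%N) mu (tperm i l k)).
  rewrite {1}h1 => h3; rewrite -(lerD2r (\sum_(k < N | (k < N.-1)%N) mu (tperm i l k))).
  by apply: le_trans h3; rewrite lerD2l.
exact: le_trans.
Qed.

Lemma rep_trace_conj (U A : 'M[C]_N) : U \is unitarymx -> A \is unitarymx ->
  \tr (W (invmx U *m A *m U)) = \tr (W A).
Proof.
move=> uU uA; have uUi := invmx_unitarymx uU.
rewrite (rep_mxM W (mul_unitarymx uUi uA) uU) (rep_mxM W uUi uA).
have e : W (U *m invmx U) = 1%:M by rewrite (mulmxV_unitary uU) rep_mx1.
exact: (trace_conj1 (W A) (etrans (esym (rep_mxM W uU uUi)) e)).
Qed.

Lemma irrep_character : exists Phi : 'M[C]_#|{: word d N}|,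
  forall U, U \is unitarymx -> \tr (W U) = \tr (Phi *m tens d U).
Proof.
have [Q [m [uQ hQ]]] := torus_weights W.
have wm j : is_weight W (m j).
  exists (col j Q).
    apply/eqP => c0; have := congr1 (mulmx (invmx Q)) c0.
    rewrite mulmx0 colE mulmxA mulVmx // mul1mx => /colP/(_ j).
    by rewrite !mxE !eqxx => /eqP; rewrite oner_eq0.
  move=> u u1; rewrite hQ // -!mulmxA; have -> : invmx Q *m col j Q = delta_mx j 0.
    by rewrite colE mulmxA mulVmx // mul1mx.
  rewrite colE scalemxAr; congr (Q *m _); apply/colP => k.
  by rewrite mul_diag_mx !mxE; case: eqP => [->|]; rewrite ?mulr0.
pose ms := [seq [seq absz (m j i) | i <- enum 'I_N] | j <- enum 'I_n].
have msP : all (fun L => (size L == N) && (sumn L == d)) ms.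
  apply/allP => _ /mapP[j _ ->]; rewrite size_map size_enum_ord eqxx /=.
  have [ge0 sm] := weight_partition (wm j).
  rewrite -eqz_nat -sm sumnE big_map big_enum /= (big_morph Posz PoszD (erefl _)).
  by apply/eqP; apply: eq_bigr => i _; rewrite gez0_abs.
have trD (u : 'rV[C]_N) : (forall i, `|u 0 i| = 1) -> \tr (W (diag_mx u)) = monomial_sum ms u.
  move=> u1; rewrite hQ // mxtrace_mulC mulmxA mulVmx // mul1mx mxtrace_diag.
  rewrite /monomial_sum big_map big_enum; apply: eq_bigr => j _; rewrite mxE.
  apply: eq_bigr => i _; rewrite (nth_map i) ?size_enum_ord // nth_ord_enum.
  have [ge0 _] := weight_partition (wm j).
  by rewrite -{1}(gez0_abs (ge0 i)).
have [Phi hPhi] := symmetric_eigenvalue_function C msP.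
exists Phi => U /unitary_diag[u [V [uV u1 ->]]].
have uV' := unitarymx_unit uV.
rewrite -hPhi //; last first.
  move=> s; rewrite -!trD //; last by move=> i; rewrite mxE.
  have uP := perm_unitarymx C s; rewrite diag_col_perm.
  exact: (rep_trace_conj (invmx_unitarymx uP) (diag_unitary u1)).
by rewrite -trD //; exact: (rep_trace_conj uV (diag_unitary u1)).
Qed.

Definition rep_span (X : 'M[C]_n) : Prop := exists s : seq (C * 'M[C]_N),
  all (fun cU => cU.2 \is unitarymx) s /\ X = \sum_(cU <- s) cU.1 *: W cU.2.

Lemma rep_spanW U : U \is unitarymx -> rep_span (W U).
Proof. by move=> uU; exists [:: (1, U)]; rewrite /= uU big_seq1 scale1r. Qed.

Lemma rep_span_subspace : is_subspace rep_span.
Proof.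
split; first by exists [::]; rewrite big_nil.
move=> a _ _ [s [us ->]] [t [ut ->]].
exists ([seq (a * cU.1, cU.2) | cU <- s] ++ t); rewrite all_cat all_map us ut.
split=> //; rewrite big_cat big_map scaler_sumr; congr (_ + _).
by apply: eq_bigr => cU _; rewrite scalerA.
Qed.

Lemma irrep_span X : rep_span X.
Proof.
have [[n0 irr] _] := hW; have sP := rep_span_subspace; have PW := rep_spanW.
apply: (Burnside n0 sP).
- by rewrite -(rep_mx1 W); apply: PW; exact: unitary1.
- move=> _ _ [s [us ->]] [t [ut ->]].
  rewrite mulmx_suml big_seq; apply: (subspace_sum sP) => p ps.
  rewrite mulmx_sumr big_seq; apply: (subspace_sum sP) => q qt.
  have up := allP us _ ps; have uq := allP ut _ qt.
  rewrite -scalemxAl -scalemxAr -(rep_mxM W up uq); do 2 apply: (subspaceZ sP).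
  exact: (PW _ (mul_unitarymx up uq)).
- by move=> V hV; apply: irr => U v uU vV; apply: hV => //; exact: PW.
Qed.

(** Extending [tens d U |-> W U] by linearity requires every linear relation among tensor powers to
    hold among the [W U]. A formula makes this automatic: the entry (a, b) of [W U] is
    [tr (W U E_ba)], the matrix E_ba is a combination of unitary values of [W], and the character is
    a linear form in the tensor power. *)
Lemma irrep_commutant_morphism : exists w : 'M[C]_#|{: word d N}| -> 'M[C]_n,
  (forall a A B, w (a *: A + B) = a *: w A + w B) /\
  forall U, U \is unitarymx -> w (tens d U) = W U.
Proof.
have [Phi hPhi] := irrep_character.
have [//|s sP] := @choice _ _ (fun (ab : 'I_n * 'I_n) (s : seq (C * 'M[C]_N)) =>
  all (fun cU => cU.2 \is unitarymx) s /\
  delta_mx ab.2 ab.1 = \sum_(cU <- s) cU.1 *: W cU.2).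
  by move=> ab; have [s ?] := irrep_span (delta_mx ab.2 ab.1); exists s.
pose D ab := \sum_(cU <- s ab) cU.1 *: tens d cU.2.
exists (fun B => \matrix_(a, b) \tr (Phi *m B *m D (a, b))); split.
  move=> a A B; apply/matrixP => i j; rewrite !mxE.
  by rewrite mulmxDr mulmxDl mxtraceD -scalemxAr -scalemxAl mxtraceZ.
move=> U uU; apply/matrixP => a b; rewrite mxE.
have [us dE] := sP (a, b).
transitivity (\tr (W U *m delta_mx b a)); last first.
  rewrite /mxtrace (bigD1 a) //= big1 => [|k ka].
    rewrite addr0 mxE (bigD1 b) //= big1 => [|k kb]; first by rewrite addr0 mxE !eqxx mulr1.
    by rewrite mxE (negbTE kb) mulr0.
  by rewrite mxE big1 // => l _; rewrite mxE (negbTE ka) andbF mulr0.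
rewrite dE /D !mulmx_sumr !raddf_sum /=; apply: eq_big_seq => cU cUs.
have ucU := allP us _ cUs.
have ucUU := mul_unitarymx uU ucU.
have e : \tr (W U *m W cU.2) = \tr (Phi *m (tens d U *m tens d cU.2)).
  by rewrite -(rep_mxM W uU ucU) (hPhi _ ucUU) tensM.
rewrite -[in RHS]scalemxAr -[in LHS]scalemxAr [RHS]mxtraceZ e [LHS]mxtraceZ.
by rewrite [in RHS]mulmxA.
Qed.

End IrreducibleCharacter.

(** * Cycle types as diagrams *)

Section CycleTypes.
Variable d : nat.

Lemma young_of_seq (l : seq nat) : sorted geq l -> all (leq 1) l -> sumn l = d ->
  exists a : young d, rows a = l.
Proof.
move=> sl pl suml; have szl : (size l <= d)%N.
  by rewrite -suml; elim: l pl {sl suml} => //= x l IH /andP[x0 /IH h]; rewrite -add1n leq_add.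
have ld k : (nth 0%N l k < d.+1)%N.
  rewrite ltnS -suml; elim: l k {sl pl suml szl} => [|x l IH] [|k] //=; first exact: leq_addr.
  exact: leq_trans (IH k) (leq_addl _ _).
pose a : d.-tuple 'I_d.+1 := [tuple Ordinal (ld k) | k < d].
have aE : map val a = l ++ nseq (d - size l) 0%N.
  apply: (@eq_from_nth _ 0%N) => [|k].
    by rewrite size_map size_tuple size_cat size_nseq subnKC.
  rewrite size_map size_tuple => kd; rewrite (nth_map ord0) ?size_tuple //.
  rewrite -[X in nth ord0 a X]/(val (Ordinal kd)) -tnth_nth tnth_mktuple /= nth_cat.
  by case: ltnP => // h; rewrite nth_default // nth_nseq if_same.
have ha : sorted geq (map val a) && (sumn (map val a) == d).
  rewrite aE sumn_cat sumn_nseq mul0n addn0 suml eqxx andbT.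
  rewrite sorted_pairwise => [|x y z /= h1 h2]; last exact: leq_trans h2 h1.
  rewrite pairwise_cat -sorted_pairwise => [|x y z /= h1 h2]; last exact: leq_trans h2 h1.
  rewrite sl /=; apply/andP; split; first by apply/allrelP => x y _ /nseqP[-> _].
  by elim: (d - size l)%N => //= k ->; rewrite andbT; apply/allP => x /nseqP[-> _].
exists (exist _ a ha); rewrite /rows /= aE filter_cat -[RHS]cats0; congr (_ ++ _).
  by apply/all_filterP.
by elim: (d - size l)%N.
Qed.

Lemma cycle_type_young (s : 'S_d) : exists a : young d, rows a == cycle_type s.
Proof.
have [||| a ea] := @young_of_seq (cycle_type s); last by exists a; rewrite ea.
- by apply: sort_sorted => x y; exact: leq_total.
- rewrite /cycle_type all_sort all_map; apply/allP => X; rewrite mem_enum => /imsetP[x _ ->].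
  by rewrite /= card_gt0; apply/set0Pn; exists x; exact: porbit_id.
rewrite /cycle_type sumnE (perm_big _ (permEl (perm_sort _ _))) big_map big_enum /=.
rewrite -[RHS](card_ord d) -sum1_card (partition_big (porbit s) (mem (porbits s))) /=; last first.
  by move=> k _; exact: imset_f.
apply: eq_bigr => X /imsetP[x _ ->]; rewrite -sum1_card; apply: eq_bigl => k.
by rewrite eq_porbit_mem.
Qed.

Definition cycle_young (s : 'S_d) : young d := xchoose (cycle_type_young s).

Lemma rows_cycle_young s : rows (cycle_young s) = cycle_type s.
Proof. exact/eqP/(xchooseP (cycle_type_young s)). Qed.

Lemma cycle_youngE s a : (cycle_young s == a) = (s \in cycle_class a).
Proof.
rewrite inE -rows_cycle_young; apply/eqP/eqP => [->//|]; exact: rows_inj.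
Qed.

Lemma cycle_trace_young (R : realType) N (U : 'M[R[i]]_N) s :
  cycle_trace U s = powersum (cycle_young s) U.
Proof.
rewrite /powersum rows_cycle_young /cycle_type (perm_big _ (permEl (perm_sort _ _))).
by rewrite big_map big_enum.
Qed.

Lemma rowlen_inj N (a b : young d) : (d <= N)%N ->
  (forall i : 'I_N, rowlen a i = rowlen b i) -> a = b.
Proof.
move=> dN ab; apply: rows_inj.
have abn k : nth 0%N (rows a) k = nth 0%N (rows b) k.
  case: (ltnP k N) => [kN|Nk]; first exact: (ab (Ordinal kN)).
  by rewrite !nth_default // (leq_trans (size_rows _)) // (leq_trans dN).
have pos (c : young d) k : (k < size (rows c))%N -> (0 < nth 0%N (rows c) k)%N.
  by move=> kc; have := mem_nth 0%N kc; rewrite mem_filter => /andP[].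
apply: (@eq_from_nth _ 0%N) => // ; case: (ltngtP (size (rows a)) (size (rows b))) => // h.
  by have := pos b _ h; rewrite -abn nth_default.
by have := pos a _ h; rewrite abn nth_default.
Qed.

Lemma rowlen_le (a : young d) k : (rowlen a k <= d)%N.
Proof.
case: (ltnP k d) => [kd|dk]; last by rewrite /rowlen nth_default // (leq_trans (size_rows _)).
by have := sum_rowlen a (leqnn d); rewrite (bigD1 (Ordinal kd)) //= => {2}<-; exact: leq_addr.
Qed.

End CycleTypes.

Section GenericMaps.
Variables (C : numClosedFieldType) (d N : nat).
Local Notation tens := (@tens C d N).
Local Notation dtens := (@dtens C d N).
Local Notation m := #|{: word d N}|.

Lemma linear_map_sum (U V : lmodType C) (f : U -> V) (I : Type) (s : seq I) (c : I -> C) (F : I -> U) :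
  (forall a x y, f (a *: x + y) = a *: f x + f y) ->
  f (\sum_(i <- s) c i *: F i) = \sum_(i <- s) c i *: f (F i).
Proof.
move=> fl; elim: s => [|i s IH]; first by rewrite !big_nil (linear_map0 fl).
by rewrite !big_cons fl IH.
Qed.

Lemma raise_weight n (w : 'M[C]_m -> 'M[C]_n) (lam : 'I_N -> nat) v (i j : 'I_N) (u : 'rV[C]_N) :
  commutant_rep w -> weight_vector w lam v -> (forall k, `|u 0 k| = 1) ->
  w (tens (diag_mx u)) *m (w (dtens (delta_mx i j)) *m v) =
  (\prod_k u 0 k ^ ((lam k)%:Z + (k == i)%:Z - (k == j)%:Z)) *: (w (dtens (delta_mx i j)) *m v).
Proof.
move=> wr [_ vw] u1; have u0 k : u 0 k != 0 by rewrite -normr_eq0 u1 oner_eq0.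
have cT := @commutant_tens C d N (diag_mx u).
have e : diag_mx u *m delta_mx i j = (u 0 i / u 0 j) *: delta_mx i j *m diag_mx u.
  apply/matrixP => a b; rewrite mul_diag_mx mul_mx_diag !mxE.
  case: (eqVneq a i) => [->|]; last by rewrite !mulr0 mul0r.
  case: (eqVneq b j) => [->|]; last by rewrite !mulr0 mul0r.
  by rewrite !mulr1 divfK.
rewrite mulmxA -(rep_mul wr) //; last exact: dtens_commutant.
rewrite (tens_dtens d e) dtensZ -scalemxAl (rep_Z wr) (rep_mul wr) //; last exact: dtens_commutant.
rewrite -scalemxAl -mulmxA vw // -scalemxAr scalerA; congr (_ *: _).
under [RHS]eq_bigr do rewrite -addrA expfzDr // expfzDr //.
rewrite big_split mulrC /=; congr (_ * _); rewrite big_split; congr (_ * _) => /=.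
  rewrite (bigD1 i) //= eqxx big1 ?mulr1 // => k ki; by rewrite (negbTE ki).
rewrite (bigD1 j) //= eqxx big1 ?mulr1 // => k kj; by rewrite (negbTE kj).
Qed.

End GenericMaps.

(** * Matching irreducible representations with blocks *)

Section IrreducibleBlocks.
Variables (R : realType) (d N : nat).
Hypotheses (d_gt0 : (1 <= d)%N) (dN : (d <= N)%N).
Local Notation C := R[i].
Local Notation G := [set: 'S_d]%G.
Local Notation dtens := (@dtens C d N).
Local Notation m := #|{: word d N}|.
Variable sG : irrType C G.

(** Besides the block, the data keep a highest weight vector killed by the raising operators: it
    yields the Casimir eigenvalue and, by transfer of weights, the injectivity of the matching. *)
Definition in_block (lam : young d) (W : unitary_rep R N) (i : sG) : Prop :=
  exists w : 'M[C]_m -> 'M[C]_(rep_dim W), exists v,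
  [/\ commutant_rep w, forall U, U \is unitarymx -> w (tens d U) = W U,
      w (block_op N i) = 1%:M, weight_vector w (fun k => rowlen lam k) v
    & forall k l : 'I_N, (k < l)%N -> w (dtens (delta_mx k l)) *m v = 0].

Lemma diag_unit_unitary (u : 'rV[C]_N) : (forall k, `|u 0 k| = 1) -> diag_mx u \is unitarymx.
Proof. exact: diag_unitary. Qed.

Lemma irrep_in_block lam W : is_irrep lam W -> exists i, in_block lam W i.
Proof.
move=> hW; have [w [wl wT]] := irrep_commutant_morphism d_gt0 dN hW.
have [[n0 _] [[v v0 hv] hw]] := hW.
have wr : commutant_rep w.
  split=> // [||X].
  - apply: (unitary_commutant_repM wl) => U V uU uV.
    have uUV := mul_unitarymx uU uV; rewrite (wT _ uU) (wT _ uV) (wT _ uUV).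
    exact: (rep_mxM W uU uV).
  - rewrite -(rep_mx1 W) -tens1; apply: wT.
    by apply/unitarymxP; rewrite mul1mx trmx1 map_mx1.
  have [s [us ->]] := irrep_span hW X.
  exists (\sum_(cU <- s) cU.1 *: tens d cU.2).
    by apply: commutant_sum => q _ t; rewrite -scalemxAl -scalemxAr commutant_tens.
  rewrite (linear_map_sum _ _ _ wl); apply: eq_big_seq => q qs.
  by rewrite wT // (allP us).
have [i wi] := rep_block sG n0 wr.
have vw : weight_vector w (fun k => rowlen lam k) v.
  by split=> // u u1; rewrite (wT _ (diag_unit_unitary u1)) hv.
(* A nonzero image under a raising operator would have the weight lam + e_k - e_l, which is not
   below lam. *)
exists i, w, v; split=> // k l kl; apply/eqP; apply: contraT => x0.
case: (@weight_le_raise N (fun k => (rowlen lam k)%:Z) k l kl); apply: hw.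
exists (w (dtens (delta_mx k l)) *m v) => // u u1.
by rewrite -(wT _ (diag_unit_unitary u1)) (raise_weight k l wr vw u1).
Qed.

(** Weights transfer within a block, so each of the two highest weights is below the other. *)
Lemma in_block_inj lam lam' W W' i : is_irrep lam W -> is_irrep lam' W' ->
  in_block lam W i -> in_block lam' W' i -> lam = lam'.
Proof.
have half l l' V V' : is_irrep l V -> is_irrep l' V' -> in_block l V i -> in_block l' V' i ->
    weight_le (fun k : 'I_N => (rowlen l k)%:Z) (fun k => (rowlen l' k)%:Z).
  move=> [[n0 _] _] [[n0' _] [_ hw']] [w [v [wr wT wi vw _]]] [w' [v' [wr' wT' wi' _ _]]].
  apply: hw'.
  have [x [x0 hx]] := weight_transfer n0 n0' wr wr' wi wi' (fun k => rowlen_le l k) vw.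
  by exists x => // u u1; rewrite -(wT' _ (diag_unit_unitary u1)) hx.
move=> h h' b b'; apply: (rowlen_inj dN) => k.
by have := weight_le_anti (half _ _ _ _ h h' b b') (half _ _ _ _ h' h b' b) k => -[].
Qed.

End IrreducibleBlocks.

(** * Hurwitz numbers and convergence *)

Local Open Scope classical_set_scope.

Section ComplexLimits.
Variable R : realType.
Local Notation C := R[i].

Lemma cvg_realC (u : nat -> R) (l : R) : (u n @[n --> \oo] --> l) ->
  ((u n)%:C : C^o) @[n --> \oo] --> (l%:C : C^o).
Proof.
move=> ul; apply/cvgrPdist_lt => /= e e0.
have [r eE] : exists r : R, e = r%:C by exists (complex.Re e); rewrite RRe_real // gtr0_real.
rewrite eE in e0 *; have r0 : 0 < r by rewrite -ltcR.
move/cvgrPdist_lt: ul => /(_ _ r0); apply: filterS => n.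
by rewrite -rmorphB norm_realC ltcR.
Qed.

Lemma cvg0_dominated (z : nat -> C) (u : nat -> R) (c : C) :
  (u n @[n --> \oo] --> (0 : R)) -> (forall n, `|z n| <= c * (u n)%:C) ->
  (z n : C^o) @[n --> \oo] --> (0 : C^o).
Proof.
move=> u0 zu; have cu : (c * (u n)%:C : C^o) @[n --> \oo] --> (c * 0 : C^o).
  by apply: cvgMr; exact: (cvg_realC u0).
rewrite mulr0 in cu; apply/cvgr0Pnorm_lt => /= e e0.
move/cvgr0Pnorm_lt: cu => /(_ _ e0); apply: filterS => n.
by apply: le_lt_trans; rewrite [X in _ <= X]ger0_norm // (le_trans _ (zu n)).
Qed.

End ComplexLimits.

Section GeneratingFunctionBound.
Variables (R : realType) (d : nat) (x : R).
Hypotheses (x0 : 0 <= x) (xd : forall j : 'I_d, j%:R * x < 1).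
Local Notation eta := (monotone_sum (fun j : 'I_d => j%:R : R)).

Lemma eta_ge0 k s : 0 <= eta k s.
Proof.
by apply: sumr_ge0 => t _; elim: (tval t) => [|i u IH]; rewrite ?big_nil // big_cons mulr_ge0.
Qed.

(** Multiplication by 1 - j x removes the variable j from the generating series of nonnegative
    terms, so each variable costs a factor 1 / (1 - j x), finite by [xd]. *)
Lemma eta_series_bound m k : (k + m = d)%N ->
  exists B, forall n, \sum_(s < n) x ^+ s * eta k s <= B.
Proof.
elim: m k => [|m IH] k; first rewrite addn0 => ->.
  exists 1 => -[|n]; first by rewrite big_ord0.
  rewrite big_ord_recl /= expr0 mul1r monotone_sum_deg0 big1 ?addr0 // => s _.
  by rewrite monotone_sum_none mulr0.
move=> kd.
have [B hB] := IH k.+1 (etrans (addSnnS _ _) kd).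
have kd' : (k < d)%N by rewrite -kd addnS ltnS leq_addr.
pose j := Ordinal kd'; exists (B / (1 - j%:R * x)) => n.
rewrite ler_pdivlMr ?subr_gt0 //; pose e k n := \sum_(s < n) x ^+ s * eta k s.
rewrite -/(e k n); have mono : e k n <= e k n.+1.
  by rewrite /e big_ord_recr /= lerDl mulr_ge0 ?exprn_ge0 ?eta_ge0.
have rec : e k n.+1 = j%:R * x * e k n + e k.+1 n.+1.
  rewrite /e big_ord_recl [in RHS]big_ord_recl /= !monotone_sum_deg0 addrCA; congr (_ + _).
  rewrite mulr_sumr -big_split /=; apply: eq_bigr => s _.
  by rewrite /bump /= add1n (monotone_sum_rec _ j) exprS; ring.
rewrite mulrBr mulr1 lerBlDr (le_trans mono) // rec addrC mulrC lerD //.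
exact: hB.
Qed.

Lemma eta_series_cvg0 (k : nat) : (k <= d)%N -> (x ^+ s * eta k s @[s --> \oo] --> (0 : R)).
Proof.
move=> kd; have [B hB] := eta_series_bound (subnKC kd).
apply: cvg_series_cvg_0; apply: nondecreasing_is_cvgn.
  apply/nondecreasing_seqP => n; rewrite /series /= big_nat_recr //= lerDl.
  by rewrite mulr_ge0 ?exprn_ge0 ?eta_ge0.
by exists B => _ [n _ <-]; rewrite /series /= big_mkord.
Qed.

End GeneratingFunctionBound.

(** Every finite set of index pairs lies in a square. *)
Lemma summable_square_bound (R : realType) (f : nat * nat -> R) (B : R) :
  (forall k, 0 <= f k) -> (forall n, \sum_(r < n) \sum_(s < n) f (r : nat, s : nat) <= B) ->
  summable [set: nat * nat] (fun k => (f k)%:E).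
Proof.
move=> f0 fB; rewrite /summable; apply: (@le_lt_trans _ _ B%:E); last exact: ltry.
apply: ge_ereal_sup => _ [A [fA _] <-].
have [q AE] : exists q : seq (nat * nat), A = [set` q] by apply/finite_seqP.
pose n := (\max_(k <- q) maxn k.1 k.2).+1.
pose L : seq (nat * nat) := [seq (r, s) | r <- index_iota 0 n, s <- index_iota 0 n].
have uL : uniq L by apply: allpairs_uniq; rewrite ?iota_uniq // => -[a b] [a' b'] _ _ [-> ->].
have AL : {subset A <= [set` L]}.
  move=> k; rewrite AE !inE /= => Ak.
  have kn : (maxn k.1 k.2 < n)%N.
    rewrite ltnS; by apply: (@leq_bigmax_seq _ q xpredT (fun k => maxn k.1 k.2) k).
  case: k kn {Ak} => r s /=; rewrite gtn_max => /andP[rn sn].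
  by apply/allpairsP; exists (r, s); split=> //; rewrite mem_index_iota.
apply: (@le_trans _ _ (\sum_(k \in [set` L]) `|(f k)%:E|)%E).
  by apply: lee_fsum_nneg_subset => //; exact: finite_seq.
rewrite -fsbig_seq // (eq_bigr (fun k => (f k)%:E)) => [|k _]; last by rewrite gee0_abs // lee_fin.
rewrite sumEFin lee_fin; apply: le_trans (fB n).
rewrite big_allpairs_dep big_mkord; apply: ler_sum => r _.
by rewrite big_mkord.
Qed.

Section Hurwitz.
Variables (R : realType) (d : nat).
Local Notation C := R[i].
Local Notation G := [set: 'S_d]%G.
Local Notation pelt := (regular_repr C G).

Lemma jm_completeE s : jm_complete R d s = monotone_sum (@jm C d) 0 s.
Proof.
rewrite /jm_complete /monotone_sum; apply: eq_big => t.
  by rewrite (eq_all (a2 := predT)) ?all_predT ?andbT.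
by move=> _; rewrite big_tuple.
Qed.

Lemma prod_pelt n (F : 'I_n -> 'S_d) : \prod_k pelt (F k) = pelt (\prod_k F k)%g.
Proof. by rewrite (big_morph _ (@peltM C d) (pelt1 C d)). Qed.

Lemma transp_sumX r : transp_sum R d ^+ r =
  \sum_(tau : r.-tuple 'S_d | [forall k, tnth tau k \in transpositions d])
    pelt (\prod_(k < r) tnth tau k)%g.
Proof.
have -> : transp_sum R d ^+ r = \prod_(k < r) transp_sum R d by rewrite prodr_const card_ord.
rewrite /transp_sum /gset_mx bigA_distr_big /=.
rewrite [RHS](reindex (fun f : {ffun 'I_r -> 'S_d} => [tuple f k | k < r])) /=; last first.
  exists (fun tau : r.-tuple 'S_d => [ffun k => tnth tau k]) => [f _|tau _].
    by apply/ffunP => k; rewrite ffunE tnth_mktuple.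
  by apply: eq_from_tnth => k; rewrite tnth_mktuple ffunE.
apply: eq_big => [f|f _].
  by apply: eq_forallb => k; rewrite tnth_mktuple.
by rewrite prod_pelt; congr (pelt _); apply: eq_bigr => k _; rewrite tnth_mktuple.
Qed.

Lemma tperm_lt_inj (i j i' j' : 'I_d) : (i < j)%N -> (i' < j')%N ->
  tperm i j = tperm i' j' -> i = i' /\ j = j'.
Proof.
move=> ij ij' e; have ji : j = tperm i' j' i by rewrite -e tpermL.
case: tpermP ji ij => [-> ->|-> ->|_ _ ->] //; last by rewrite ltnn.
by move/(ltn_trans ij'); rewrite ltnn.
Qed.

(** A transposition determines its pair i < j, so different index data in the expansion of h_s give
    different tuples, and the existential condition [monotone_walk] counts each of them once. *)
Lemma jm_complete_monotone s : jm_complete R d s =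
  \sum_(mu : s.-tuple 'S_d | monotone_walk mu) pelt (\prod_(k < s) tnth mu k)%g.
Proof.
pose h (ij : s.-tuple ('I_d * 'I_d)) : s.-tuple 'S_d :=
  [tuple tperm (tnth ij k).1 (tnth ij k).2 | k < s].
pose A := [set ij : s.-tuple ('I_d * 'I_d) | [forall k, ((tnth ij k).1 < (tnth ij k).2)%N]
   && sorted leq [seq val x.2 | x <- ij]]%SET.
have hinj : {in A &, injective h}.
  move=> x y; rewrite !inE => /andP[/forallP hx _] /andP[/forallP hy _] e.
  apply: eq_from_tnth => k; have := congr1 (fun t => tnth t k) e; rewrite !tnth_mktuple.
  by case/(tperm_lt_inj (hx k) (hy k)); case: (tnth x k) (tnth y k) => a b [a' b'] /= -> ->.
transitivity (\sum_(ij in A) pelt (\prod_(k < s) tnth (h ij) k)%g); last first.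
  rewrite -(big_imset (fun mu : s.-tuple 'S_d => pelt (\prod_(k < s) tnth mu k)%g)) //=.
  apply: eq_bigl => mu; apply/imsetP/existsP => [[ij ijA ->]|[ij /and3P[h1 /forallP h2 h3]]].
    move: ijA; rewrite inE => /andP[h1 h2]; exists ij; rewrite h1 h2 andbT.
    by apply/forallP => k; rewrite tnth_mktuple.
  exists ij; first by rewrite inE h1 h3.
  by apply: eq_from_tnth => k; rewrite tnth_mktuple (eqP (h2 k)).
rewrite /jm_complete /jucys_murphy.
under eq_bigr do rewrite bigA_distr_big_dep.
rewrite pair_big_dep /=.
pose z (p : s.-tuple 'I_d * {ffun 'I_s -> 'I_d}) : s.-tuple ('I_d * 'I_d) :=
  [tuple (p.2 k, tnth p.1 k) | k < s].
rewrite [RHS](reindex z) /=; last first.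
  exists (fun ij : s.-tuple ('I_d * 'I_d) => ([tuple (tnth ij k).2 | k < s], [ffun k => (tnth ij k).1])).
    move=> [t f] _; congr (_, _); first by apply: eq_from_tnth => k; rewrite !tnth_mktuple.
    by apply/ffunP => k; rewrite ffunE tnth_mktuple.
  move=> ij _; apply: eq_from_tnth => k; rewrite tnth_mktuple /= tnth_mktuple ffunE.
  by rewrite -surjective_pairing.
apply: eq_big => [[t f]|[t f] _] /=.
  rewrite [in RHS]inE [RHS]andbC; congr (_ && _).
    congr (sorted leq _); rewrite -map_comp -{1}(map_tnth_enum t) -map_comp.
    by apply: eq_map => k.
  by apply: eq_forallb => k; rewrite tnth_mktuple.
rewrite prod_pelt; congr (pelt _); apply: eq_bigr => k _.
by rewrite !tnth_mktuple.
Qed.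

Lemma mul_pelt_sum (I J : finType) (P : pred I) (Q : pred J) (f : I -> 'S_d) (g : J -> 'S_d) :
  (\sum_(i | P i) pelt (f i)) * (\sum_(j | Q j) pelt (g j)) =
  \sum_(x : I * J | P x.1 && Q x.2) pelt (f x.1 * g x.2)%g.
Proof.
rewrite mulr_suml -[RHS](pair_big P Q (fun i j => pelt (f i * g j)%g)) /=.
by apply: eq_bigr => i _; rewrite mulr_sumr; apply: eq_bigr => j _; rewrite peltM.
Qed.

Lemma hurwitz_count (a b c : young d) r s :
  hurwitz R a b c r s = #|hurwitz_tuples a b c r s|%:R.
Proof.
rewrite /hurwitz /coef_id -/(identity_coef _) /class_sum transp_sumX jm_complete_monotone /gset_mx.
rewrite !mul_pelt_sum identity_coef_sum.
rewrite -sum1_card natr_sum big_mkcond [RHS]big_mkcond /=; apply: eq_bigr => -[[[[p q] u] tau] mu] _ /=.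
rewrite identity_coef_pelt [in RHS]inE /= -!andbA.
by case: (_ == 1%g) => //=; case: ifP.
Qed.

End Hurwitz.

Local Close Scope classical_set_scope.

Local Open Scope classical_set_scope.

(** Iterates [cycle_weight_rec]; y = -1 / x turns 1 - y J into 1 + J / x. *)
Lemma cycle_weight_jm_prod (C : numClosedFieldType) d (x : C) m k : x != 0 -> (k + m = d)%N ->
  cycle_weight d x d = jm_prod d (- x^-1) k m * cycle_weight d x k.
Proof.
move=> x0; elim: m k => [|m IH] k; first by rewrite addn0 => ->; rewrite mul1r.
move=> kd; have kd' : (k < d)%N by rewrite -kd addnS ltnS leq_addr.
rewrite /= (IH k.+1) ?addSnnS // -mulrA; congr (_ * _).
by rewrite (cycle_weight_rec (Ordinal kd')) // insubT /= scaleNr opprK.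
Qed.

Lemma cvg_sumC (R : realType) (I : Type) (r : seq I) (u : I -> nat -> R[i]) (l : I -> R[i]) :
  (forall i, (u i n : R[i]^o) @[n --> \oo] --> (l i : R[i]^o)) ->
  (\sum_(i <- r) u i n : R[i]^o) @[n --> \oo] --> (\sum_(i <- r) l i : R[i]^o).
Proof.
move=> ul; elim: r => [|i r IH].
  rewrite big_nil (_ : (fun n => _) = cst (0 : R[i]^o)); first exact: cvg_cst.
  by apply/funext => n; rewrite big_nil.
rewrite big_cons (_ : (fun n => _) = (fun n => u i n + \sum_(i <- r) u i n : R[i]^o)).
  by apply: cvgD; [exact: ul | exact: IH].
by apply/funext => n; rewrite big_cons.
Qed.

(** * Convergence and value of the double series *)

Section Convergence.
Variables (R : realType) (d N : nat).
Hypotheses (d_gt0 : (0 < d)%N) (dN : (d <= N)%N).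
Local Notation C := R[i].
Local Notation G := [set: 'S_d]%G.
Local Notation eta := (monotone_sum (fun j : 'I_d => j%:R : R)).
Local Notation x := (N%:R^-1 : R).

Lemma N_gt0 : 0 < N%:R :> R. Proof. by rewrite ltr0n (leq_trans d_gt0). Qed.

Lemma x_ge0 : 0 <= x. Proof. by rewrite invr_ge0 ltW ?N_gt0. Qed.

Lemma jx_lt1 (j : 'I_d) : j%:R * x < 1.
Proof. by rewrite ltr_pdivrMr ?N_gt0 // mul1r ltr_nat (leq_trans _ dN). Qed.

Lemma realC_eta k s : (eta k s)%:C = monotone_sum (fun j : 'I_d => j%:R : C) k s.
Proof.
rewrite /monotone_sum rmorph_sum; apply: eq_bigr => u _.
by rewrite rmorph_prod; apply: eq_bigr => i _; rewrite rmorph_nat.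
Qed.

Lemma series_exp_le (y : R) n : 0 <= y -> \sum_(r < n) y ^+ r / r`!%:R <= expR y.
Proof.
move=> y0; have := nondecreasing_cvgn_le _ (@is_cvg_series_exp_coeff R y) n.
rewrite /series /= big_mkord; apply.
apply/nondecreasing_seqP => m; rewrite /series /= big_nat_recr //= lerDl.
exact: exp_coeff_ge0.
Qed.

Lemma hurwitz_bound (a b c : young d) : exists2 B : R, 0 <= B & forall r s,
  `|hurwitz R a b c r s| <= (B * #|transpositions d|%:R ^+ r * eta 0 s)%:C.
Proof.
pose B : R := #|cycle_class a|%:R * #|cycle_class b|%:R * #|cycle_class c|%:R.
exists B => [|r s]; first by rewrite !mulr_ge0.
rewrite /hurwitz /coef_id -/(identity_coef _) jm_completeE !rmorphM rmorphXn /= realC_eta !rmorph_nat.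
by apply: row_bound_coef; rewrite /class_sum /transp_sum;
  do !apply: row_boundM; try apply: row_boundX; try exact: row_bound_gset; exact: row_bound_monotone_sum.
Qed.

(** The terms are dominated by those of a product: the exponential series at |t| T / N, with T the
    number of transpositions, times the series of h_s(0, ..., d - 1) / N^s. *)
Lemma expansion_abs_convergent (t : R) (a b c : young d) :
  abs_convergent (expansion_term N t a b c).
Proof.
have [B B0 hB] := hurwitz_bound a b c.
have [A hA] := eta_series_bound x_ge0 jx_lt1 (add0n d).
pose T : R := #|transpositions d|%:R; pose y := `|t| * x * T.
have y0 : 0 <= y by rewrite !mulr_ge0 ?x_ge0.
have e0 s : 0 <= x ^+ s * eta 0 s by rewrite mulr_ge0 ?exprn_ge0 ?x_ge0 ?eta_ge0.
apply: (@summable_square_bound R (fun k => Normc.normc (expansion_term N t a b c k.1 k.2)) (B * (expR y * A))).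
  by move=> k; rewrite -lecR; exact: (normr_ge0 (expansion_term N t a b c k.1 k.2)).
move=> n; apply: (@le_trans _ _ (\sum_(r < n) \sum_(s < n) B * (y ^+ r / r`!%:R * (x ^+ s * eta 0 s)))).
  apply: ler_sum => r _; apply: ler_sum => s _ /=.
  rewrite -lecR -[X in X <= _]/(`|expansion_term N t a b c r s|).
  rewrite /expansion_term normrM norm_realC.
  apply: le_trans (ler_wpM2l _ (hB _ _)) _; first by rewrite lecR.
  rewrite -rmorphM lecR !normrM !normrX normrN normrN1 expr1n mulr1 normfV normrM normrX !normr_nat.
  rewrite /y !exprMn exprD !exprVn le_eqVlt; apply/orP; left; apply/eqP.
  by field; rewrite !pnatr_eq0 !expf_neq0 ?lt0r_neq0 ?N_gt0 // -lt0n fact_gt0.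
under eq_bigr do rewrite -mulr_sumr -mulr_sumr.
rewrite -mulr_sumr -mulr_suml ler_wpM2l // ler_pM // ?series_exp_le //.
- by apply: sumr_ge0 => r _; rewrite divr_ge0 ?exprn_ge0.
- by apply: sumr_ge0.
Qed.

Local Notation yC := (- N%:R^-1 : C).

(** The factor of smallest index stands next to the generating series and turns H_k into H_(k+1),
    until H_d = 1 is left. Each step leaves an error of size N^-(n+1) times a coefficient of h_n,
    which tends to 0 as the term of a convergent scalar series. *)
Lemma jm_prod_limit m k (B : 'M[C]_#|G|) : (k + m = d)%N ->
  (identity_coef (B * jm_prod d yC k m * trunc_gen d yC k n.+1) : C^o) @[n --> \oo]
    --> (identity_coef B : C^o).
Proof.
elim: m k => [|m IH] k kd.
  rewrite addn0 in kd; rewrite kd (_ : (fun n => _) = cst (identity_coef B)); first exact: cvg_cst.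
  apply/funext => n; rewrite /= mulr1 /trunc_gen big_ord_recl /= monotone_sum_deg0 expr0 scale1r.
  by rewrite big1 ?addr0 ?mulr1 // => s _; rewrite monotone_sum_none scaler0.
have kd' : (k < d)%N by rewrite -kd addnS ltnS leq_addr.
pose j := Ordinal kd'; pose A := B * jm_prod d yC k.+1 m * jm C j.
have [b b0 hb] := row_bound_ex A.
rewrite (_ : (fun n => _) = (fun n =>
  identity_coef (B * jm_prod d yC k.+1 m * trunc_gen d yC k.+1 n.+1) -
  yC ^+ n.+1 * identity_coef (A * monotone_sum (@jm C d) k n))); last first.
  apply/funext => n; rewrite /= insubT /=.
  rewrite -[in LHS]mulrA -[X in B * X]mulrA (trunc_gen_rec yC j n).
  rewrite mulrBr mulrBr ringmxZr ringmxZr -scaleNr addrC identity_coefP mulNr addrC.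
  by rewrite /A !mulrA.
rewrite -[X in _ --> X]subr0; apply: cvgB; first by apply: IH; rewrite addSnnS.
have u0 : (x * (x ^+ n * eta k n) @[n --> \oo] --> (0 : R)).
  rewrite -(mulr0 x); apply: cvgMr; exact: (eta_series_cvg0 x_ge0 jx_lt1 (ltnW kd')).
apply: (cvg0_dominated (c := b) u0) => n.
rewrite normrM normrX normrN normfV normr_nat mulrA -exprS rmorphM rmorphXn fmorphV rmorph_nat.
rewrite mulrCA ler_wpM2l ?exprn_ge0 ?invr_ge0 //.
apply: row_bound_coef; apply: row_boundM => //; rewrite /= realC_eta.
exact: row_bound_monotone_sum.
Qed.

(** On block i, K is the scalar k_i, and by Jucys' factorization the product of the 1 + J_j / N is
    q_i / N^d. The series in s therefore sums to N^d / q_i, and the series in r to an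
    exponential. *)
Lemma double_series_blocks (t : R) (I : finType) (e : I -> 'M[C]_#|G|) (k : I -> R) (q : I -> C)
    (a b c : young d) :
  \sum_i e i = 1 -> (forall i, transp_sum R d * e i = (k i)%:C *: e i) ->
  (forall i, q i != 0) -> (forall i, e i * cycle_weight d N%:R d = q i *: e i) ->
  double_series (expansion_term N t a b c) =
  \sum_i (expR (- t * k i / N%:R))%:C * (N%:R ^+ d / q i) *
    identity_coef (class_sum R a * class_sum R b * class_sum R c * e i).
Proof.
move=> e1 ke q0 qe; set B := _ * class_sum R c.
have N0 : (N%:R : C) != 0 by rewrite pnatr_eq0 -lt0n (leq_trans d_gt0).
under [RHS]eq_bigr do rewrite -mulrA.
rewrite /double_series; apply: (@cvg_lim (C^o) (@norm_hausdorff _ (C^o)) nat \oo).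
(* [jm_prod_limit] concerns truncations of positive length, hence the shift. *)
rewrite -cvg_shiftS /=.
rewrite (_ : (fun n : nat => _) = (fun n : nat => \sum_i
  (series (exp_coeff (- t * k i / N%:R)) n.+1)%:C *
   (N%:R ^+ d / q i * identity_coef ((B * e i) * jm_prod d yC 0 d * trunc_gen d yC 0 n.+1)))).
  apply: cvg_sumC => i; apply: cvgM.
    apply: cvg_realC; rewrite (cvg_shiftS (series _)); exact: is_cvg_series_exp_coeff.
  apply: cvgMr; exact: jm_prod_limit.
apply/funext => n.
have yE : yC = (- x)%:C by rewrite rmorphN fmorphV rmorph_nat.
have eJ i : e i * jm_prod d yC 0 d = (q i / N%:R ^+ d) *: e i.
  have := qe i; rewrite (cycle_weight_jm_prod N0 (add0n d)) cycle_weight0 ringmxZr mulr1 ringmxZr.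
  move/(congr1 (GRing.scale (N%:R ^- d))); rewrite !scalerA mulVf ?expf_neq0 // scale1r => ->.
  by rewrite mulrC.
transitivity (\sum_i (series (exp_coeff (- t * k i / N%:R)) n.+1)%:C *
    identity_coef (B * e i * trunc_gen d yC 0 n.+1)); last first.
  apply: eq_bigr => i _; congr (_ * _); rewrite -[B * e i * jm_prod _ _ _ _]mulrA eJ ringmxZr ringmxZl identity_coefZ.
  by rewrite [RHS]mulrA -[LHS]mul1r; congr (_ * _); rewrite mulrA divfK // divff ?expf_neq0.
transitivity (\sum_(r < n.+1) \sum_(s < n.+1) ((- t) ^+ r / (r`!%:R * N%:R ^+ r))%:C * yC ^+ s *
   identity_coef (B * transp_sum R d ^+ r * monotone_sum (@jm C d) 0 s)).
  apply: eq_bigr => r _; apply: eq_bigr => s _; rewrite /expansion_term /hurwitz jm_completeE.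
  congr (_ * _); rewrite yE -(rmorphXn (real_complex R)) -(rmorphM (real_complex R)); congr (_%:C).
  rewrite exprD [(- x) ^+ s]exprNn exprVn; field.
  by rewrite !pnatr_eq0 !expf_neq0 ?lt0r_neq0 ?N_gt0 // -lt0n fact_gt0.
transitivity (\sum_(r < n.+1) ((- t) ^+ r / (r`!%:R * N%:R ^+ r))%:C *
   identity_coef (B * transp_sum R d ^+ r * trunc_gen d yC 0 n.+1)).
  apply: eq_bigr => r _; rewrite /trunc_gen mulr_sumr identity_coef_sum mulr_sumr.
  by apply: eq_bigr => s _; rewrite ringmxZr identity_coefZ mulrA.
have Kr i r : transp_sum R d ^+ r * e i = (k i)%:C ^+ r *: e i.
  elim: r => [|r IH]; first by rewrite !expr0 mul1r scale1r.
  by rewrite exprSr -mulrA ke ringmxZr IH scalerA -exprS.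
transitivity (\sum_(r < n.+1) \sum_i ((- t) ^+ r / (r`!%:R * N%:R ^+ r))%:C * (k i)%:C ^+ r *
   identity_coef (B * e i * trunc_gen d yC 0 n.+1)).
  apply: eq_bigr => r _.
  have -> : B * transp_sum R d ^+ r = \sum_i B * transp_sum R d ^+ r * e i.
    by rewrite -mulr_sumr e1 mulr1.
  rewrite mulr_suml identity_coef_sum mulr_sumr.
  by apply: eq_bigr => i _; rewrite -[B * _ * e i]mulrA Kr ringmxZr ringmxZl identity_coefZ mulrA.
rewrite exchange_big /=; apply: eq_bigr => i _; rewrite -mulr_suml; congr (_ * _).
rewrite /series /= big_mkord rmorph_sum; apply: eq_bigr => r _.
rewrite -(rmorphXn (real_complex R)) -(rmorphM (real_complex R)); congr (_%:C); rewrite /exp_coeff /= !exprMn exprVn.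
by field; rewrite !pnatr_eq0 !expf_neq0 ?lt0r_neq0 ?N_gt0 // -lt0n fact_gt0.
Qed.

End Convergence.

Local Close Scope classical_set_scope.

(** * The partition function *)

(** Here q = N^d, D = d!, c = <e_i>, n = n_i, x1 = dim W, the a's are the characters, zd = z^d and
    [ex] is the exponential; D c = n^2 cancels all multiplicities. *)
Lemma block_summand (F : fieldType) (ex q n D c x1 a1 a2 a3 zd : F) :
  q != 0 -> n != 0 -> D != 0 -> c != 0 -> x1 != 0 -> D * c = n ^+ 2 ->
  zd * q^-1 / D * (ex * (q / (n * x1 / c)) * (n * a1 / c * (n * a2 / c) * (n * a3 / c) * c)) =
  a1 * a2 * a3 / x1 * (zd * ex).
Proof.
move=> q0 n0 D0 c0 x0 e; have -> : D = n ^+ 2 / c by rewrite -e mulfK.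
by field; rewrite q0 n0 c0 x0.
Qed.

Lemma exchange_triple (F : comNzRingType) (Y I : finType) (P : Y -> Y -> Y -> F) (w : I -> F)
    (c : I -> Y -> Y -> Y -> F) :
  \sum_x \sum_y \sum_z P x y z * (\sum_i w i * c i x y z) =
  \sum_i w i * \sum_x \sum_y \sum_z P x y z * c i x y z.
Proof.
under [RHS]eq_bigr do rewrite mulr_sumr.
rewrite [RHS]exchange_big; apply: eq_bigr => x _ /=.
under [RHS]eq_bigr do rewrite mulr_sumr.
rewrite [RHS]exchange_big; apply: eq_bigr => y _ /=.
under [RHS]eq_bigr do rewrite mulr_sumr.
rewrite [RHS]exchange_big; apply: eq_bigr => z _ /=.
by rewrite mulr_sumr; apply: eq_bigr => i _; rewrite mulrCA.
Qed.

Section Assembly.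
Variables (R : realType) (d N : nat).
Hypotheses (d_gt0 : (1 <= d)%N) (dN : (d <= N)%N).
Local Notation C := R[i].
Local Notation G := [set: 'S_d]%G.
Local Notation pelt := (regular_repr C G).
Variable sG : irrType C G.
Local Notation n_ := (@irr_degree C _ G sG).
Local Notation e_ := (@Wedderburn_id C _ G sG).

Lemma transp_sum_jm : transp_sum R d = jm_total C d.
Proof.
rewrite /transp_sum /gset_mx /transpositions big_imset /=; last first.
  move=> [i j] [i' j']; rewrite !inE /= => ij ij' e.
  by have [-> ->] := tperm_lt_inj ij ij' e.
rewrite /jm_total /jm (exchange_big_dep xpredT) //= pair_big_dep /=.
by apply: eq_big => [[i j]|[i j] _]; rewrite ?inE.
Qed.

Lemma content_sum_casimir (lam : young d) :
  content_sum C (fun k : 'I_N => rowlen lam k) = (casimir R N lam)%:C.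
Proof.
rewrite /content_sum /casimir rmorph_sum; apply: eq_bigr => i _.
by rewrite rmorphM rmorphB rmorphB rmorphD rmorph1 !rmorph_nat.
Qed.

Lemma in_block_casimir lam W (i : sG) : in_block (N := N) lam W i ->
  transp_sum R d * e_ i = ((casimir R N lam - (N * d)%:R) / 2)%:C *: e_ i.
Proof.
move=> [w [v [wr _ wi vw hv]]]; rewrite transp_sum_jm.
have := casimir_block wr wi vw (fun k => rowlen_le lam k) hv.
rewrite content_sum_casimir => e; rewrite [LHS]e; congr (_ *: _).
by rewrite (rmorphM (real_complex R)) (rmorphB (real_complex R)) (fmorphV (real_complex R)) !(rmorph_nat (real_complex R)).
Qed.

Lemma in_block_power_weight lam W (i : sG) U : (0 < rep_dim W)%N -> in_block (N := N) lam W i ->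
  U \is unitarymx -> power_weight U i = (n_ i)%:R * rep_char W U / identity_coef (e_ i).
Proof.
move=> n0 [w [v [wr wT wi _ _]]] uU; congr (_ / _).
have := rep_trace n0 wr wi (@commutant_tens C d N U).
by rewrite (wT _ uU).
Qed.

Lemma power_elt_powersum (U : 'M[C]_N) : power_elt d U = \sum_(a : young d) powersum a U *: class_sum R a.
Proof.
rewrite (power_elt_classes (cl := @cycle_young d) (p := fun a U => powersum a U)); last first.
  by move=> V s; exact: cycle_trace_young.
apply: eq_bigr => a _; congr (_ *: _); apply: eq_bigl => s; exact: cycle_youngE.
Qed.

Lemma powersum3_expansion (U1 U2 U3 : 'M[C]_N) (i : sG) :
  \sum_(a : young d) \sum_(b : young d) \sum_(c : young d) powersum3 a b c U1 U2 U3 *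
    identity_coef (class_sum R a * class_sum R b * class_sum R c * e_ i) =
  identity_coef (power_elt d U1 *m power_elt d U2 *m power_elt d U3 *m e_ i).
Proof.
rewrite (power_elt_powersum U1) (power_elt_powersum U2) (power_elt_powersum U3).
exact: esym (triple_expansion _ _ _ (@class_sum R d) _).
Qed.

End Assembly.

Theorem theorem6p1 (R : realType) (d N : nat) (hd : (1 <= d)%N)
    (hdN : (d <= N)%N) (t : R) (ht : 0 < t)
    (W : young d -> unitary_rep R N)
    (hW : forall lam, lam \in youngN d N -> is_irrep lam (W lam)) :
  let z := expR (- t / 2) in
  [/\ forall (a b c : young d) (r s : nat),
        hurwitz R a b c r s = #|hurwitz_tuples a b c r s|%:R,
      forall a b c : young d, abs_convergent (expansion_term N t a b c)
    & forall U1 U2 U3 : 'M[R[i]]_N,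
        U1 \is unitarymx -> U2 \is unitarymx -> U3 \is unitarymx ->
        Zpart W t U1 U2 U3 =
        ((z / N%:R) ^+ d / d`!%:R)%:C *
        \sum_(a : young d) \sum_(b : young d) \sum_(c : young d)
          powersum3 a b c U1 U2 U3
          * double_series (expansion_term N t a b c)].
Proof.
move=> z; split=> [a b c r s|a b c|U1 U2 U3 u1 u2 u3].
- exact: hurwitz_count.
- exact: expansion_abs_convergent.
pose sG : irrType R[i] [set: 'S_d]%G := DecSocleType (regular_repr R[i] [set: 'S_d]%G).
have N0 : (0 < N)%N by exact: leq_trans hdN.
have all_lam (lam : young d) : lam \in youngN d N.
  by rewrite inE (leq_trans (size_rows lam)).
have [f fB] := boolp.choice (fun lam => irrep_in_block hd hdN sG (hW _ (all_lam lam))).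
have finj : injective f.
  move=> a b ab; have := fB b; rewrite -ab.
  exact: (in_block_inj hdN (hW _ (all_lam a)) (hW _ (all_lam b)) (fB a)).
have fbij : bijective f.
  apply: inj_card_bij => //.
  exact: (card_blocks N0 hdN sG (fun U s => cycle_trace_young U s)).
have [g fg gf] := fbij.
pose k i := (casimir R N (g i) - (N * d)%:R) / 2.
pose e (i : sG) := Wedderburn_id i.
have e1 : \sum_i e i = 1 := Wedderburn_sum_id_pchar sG (num_pchar_group R[i] [set: 'S_d]%G).
have ke i : transp_sum R d * e i = (k i)%:C *: e i.
  by rewrite /k -(gf i) fg; exact: in_block_casimir (fB _).
have q0 (i : sG) := power_weight1_neq0 hdN i.
have qe (i : sG) := power_weight1_block N0 i.
have ds a b c := double_series_blocks hd hdN t a b c e1 ke q0 qe.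
under eq_bigr do under eq_bigr do under eq_bigr do rewrite ds.
rewrite exchange_triple.
rewrite /Zpart (eq_bigl xpredT) // (reindex g) /=; last by exists f => i _; rewrite ?fg ?gf.
rewrite mulr_sumr; apply: eq_bigr => i _.
have [[n0 _] _] := hW _ (all_lam (g i)).
have bi : in_block (g i) (W (g i)) i by have := fB (g i); rewrite gf.
rewrite (powersum3_expansion U1 U2 U3 i) (power_elt3_block N0 i u1 u2 u3).
have u0 : (1%:M : 'M[R[i]]_N) \is unitarymx by apply/unitarymxP; rewrite mul1mx trmx1 map_mx1.
have c0 := block_coef_neq0 i; have cE := block_id_coef i.
have := in_block_power_weight n0 bi u0; rewrite /rep_char rep_mx1 mxtrace1 => pw0.
have pw1 := in_block_power_weight n0 bi u1.
have pw2 := in_block_power_weight n0 bi u2.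
have pw3 := in_block_power_weight n0 bi u3.
rewrite pw0 pw1 pw2 pw3.
have nf : (#|[set: 'S_d]%G|%:R : R[i]) = d`!%:R by rewrite cardsT card_Sn.
rewrite nf natrX in cE.
have zE : ((z / N%:R) ^+ d / d`!%:R)%:C = (z ^+ d)%:C * (N%:R ^+ d)^-1 / d`!%:R :> R[i].
  rewrite expr_div_n (rmorphM (real_complex R)) (rmorphM (real_complex R)) !(fmorphV (real_complex R)).
  by rewrite (rmorphXn (real_complex R) d N%:R) !(rmorph_nat (real_complex R)).
rewrite zE; apply: etrans; last first.
  apply: esym; apply: block_summand cE => //; rewrite ?expf_neq0 ?pnatr_eq0 -?lt0n ?irr_degree_gt0 ?fact_gt0 //.
congr (_ * _); rewrite -(rmorphM (real_complex R)); congr (_%:C).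
(* With k = (C - N d) / 2, where C is the Casimir value, - t d / 2 - t k / N equals - t C / (2 N):
   the factor z^d absorbs the shift by N d. *)
rewrite -expRM_natl -expRD; congr expR; rewrite /k natrM; field.
by rewrite pnatr_eq0 -lt0n.
Qed.
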